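(* Let $\Omega$ be an open set in $\mathbb{R}^n$, with $n\ge 2$, and let $A$ be a non-degenerate Young function. Assume that $f:\mathbb{R}\to\mathbb{R}$ is a Lipschitz continuous function. If $|\Omega|=\infty$, assume, in addition, that $f(0)=0$. Then the composition operator $T_f(u)=f\circ u$ maps $W^{1,A}(\Omega)$ into $W^{1,A}(\Omega)$ and is continuous in the modular topology.
   Context: $|\Omega|$ denotes the Lebesgue measure of $\Omega$. A Young function is a convex, left-continuous function $A:[0,\infty)\to[0,\infty]$ with $A(0)=0$ which is non-constant in $(0,\infty)$; it is non-degenerate if $A(t)>0$ for $t>0$. The Orlicz space $L^A(\Omega)$ consists of the measurable functions $u$ on $\Omega$ with $\int_\Omega A(|u|/\lambda)\,dx<\infty$ for some $\lambda>0$ (for vector-valued $u$, $|u|$ is the Euclidean length). A sequence $u_k\to u$ modularly in $L^A(\Omega)$ if there is $\lambda>0$ with $\lim_{k}\int_\Omega A(|u_k-u|/\lambda)\,dx=0$. The Orlicz-Sobolev space $W^{1,A}(\Omega)$ consists of the weakly differentiable $u\in L^A(\Omega)$ with $\nabla u\in L^A(\Omega)$; $u_k\to u$ modularly in $W^{1,A}(\Omega)$ if $u_k\to u$ and $\nabla u_k\to\nabla u$ modularly in $L^A(\Omega)$. Continuity of $T_f$ in the modular topology means: whenever $u_k\to u$ modularly in the domain space, $f(u_k)\to f(u)$ modularly in the target space. *)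

(* Defs.v *)
From HB Require Import structures.
From mathcomp Require Import all_boot all_order all_algebra.
From mathcomp Require Import all_classical all_reals all_analysis.
From mathcomp Require Import measurable_realfun.

Set Implicit Arguments.
Unset Strict Implicit.
Unset Printing Implicit Defensive.

Import Order.TTheory GRing.Theory Num.Theory.
Import numFieldNormedType.Exports.

Local Open Scope classical_set_scope.
Local Open Scope ring_scope.

(* Borel sigma-algebra on row vectors, the points of R^n being 'rV[R]_n. *)

Section rV_measurable.
Context {R : realType} {n : nat}.

HB.instance Definition _ := @isMeasurable.Build
  (sigma_display (@open 'rV[R]_n)) 'rV[R]_n <<s @open 'rV[R]_n >>
  (@sigma_algebra0 _ setT _) (@sigma_algebraC _ _)
  (@sigma_algebra_bigcup _ setT _).

Lemma rV_open_measurable (U : set 'rV[R]_n) : open U -> measurable U.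
Proof. exact: sub_sigma_algebra. Qed.

Lemma rV_ballE (a : 'rV[R]_n) (e : R) : 0 < e ->
  ball a e = \bigcap_(i in [set: 'I_n]) [set v : 'rV[R]_n | ball (a 0 i) e (v 0 i)].
Proof.
move=> e0; apply/seteqP; split=> v /=.
  by case=> _ h i _; exact: h.
by move=> h; split=> // i j; rewrite (ord1 i); exact: h.
Qed.

Lemma rV_open_bigcup (U : set 'rV[R]_n) : open U ->
  U = \bigcup_(q in [set: 'rV[rat]_n * nat])
        (if `[< ball (map_mx ratr q.1 : 'rV[R]_n) q.2.+1%:R^-1 `<=` U >]
         then ball (map_mx ratr q.1 : 'rV[R]_n) q.2.+1%:R^-1 else set0).
Proof.
move=> oU; apply/seteqP; split=> v; last first.
  by move=> [q _]; case: asboolP => // + ?; exact.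
move=> Uv; have /nbhs_ballP[e /= e0 evU] : nbhs v U by exact: open_nbhs_nbhs.
have [k ke] : exists k, k.+1%:R^-1 < e / 2.
  have e20 : 0 < e / 2 by rewrite divr_gt0.
  have [k _ hk] := near_infty_natSinv_lt (PosNum e20).
  by exists k; apply: hk => /=.
have k0 : 0 < k.+1%:R^-1 :> R by rewrite invr_gt0.
have qi (i : 'I_n) : exists q : rat, `|ratr q - v 0 i| < k.+1%:R^-1.
  have /rat_in_itvoo[q] : v 0 i - k.+1%:R^-1 < v 0 i + k.+1%:R^-1.
    by rewrite ltrD2l gtrN.
  by rewrite in_itv/= => qv; exists q; rewrite ltr_distl.
pose c : 'rV[rat]_n := \row_i projT1 (cid (qi i)).
have cE i : `|ratr (c 0 i) - v 0 i| < k.+1%:R^-1.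
  by rewrite mxE; case: cid.
exists (c, k) => //=; case: asboolP => [_|[]]; last first.
  move=> w; rewrite rV_ballE// => cw; apply: evU; rewrite rV_ballE// => i _ /=.
  have := cw i I; rewrite /= mxE -!ball_normE/= => h.
  have -> : v 0 i - w 0 i = (v 0 i - ratr (c 0 i)) + (ratr (c 0 i) - w 0 i).
    by rewrite addrA subrK.
  rewrite (le_lt_trans (ler_normD _ _))// (splitr e) ltrD// ?(lt_trans h)//.
  by rewrite distrC (lt_trans (cE i)).
by rewrite rV_ballE// => i _ /=; rewrite mxE -ball_normE/=; exact: cE.
Qed.

Lemma measurable_fun_rV d (T : measurableType d) (f : T -> 'rV[R]_n) :
  (forall i, measurable_fun setT (fun t => f t 0 i)) -> measurable_fun setT f.
Proof.
move=> mf; apply: (measurability (@open 'rV[R]_n)) => // _ [U oU <-].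
rewrite setTI (rV_open_bigcup oU) preimage_bigcup.
apply: countable_bigcupT_measurable => //= -[q k].
case: asboolP => _; last by rewrite preimage_set0.
rewrite /= rV_ballE// preimage_bigcap; apply: fin_bigcap_measurable => // i _.
rewrite -[X in measurable X]setTI; apply: (mf i) => //.
by apply: open_measurable; exact: ball_open.
Qed.

Lemma measurable_coord i : measurable_fun setT (fun v : 'rV[R]_n => v 0 i).
Proof.
apply: (measurability _ (RGenOpens.measurableE R)) => _ [_ [x [y ->]] <-].
rewrite setTI; apply: rV_open_measurable.
apply: open_comp; last exact: interval_open.
by move=> v _; exact: coord_continuous.
Qed.

End rV_measurable.

(* Lebesgue measure on R^n, by recursion on n: the image of the product of the
   Lebesgue measures on R and on R^n under (t, v) |-> (t, v_1, ..., v_n). *)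

Section lebesgue_rV_succ.
Context {R : realType} {n : nat}.
Local Open Scope ereal_scope.

Definition cons_rV (p : R * 'rV[R]_n) : 'rV[R]_n.+1 := row_mx (p.1)%:M p.2.

Definition uncons_rV (v : 'rV[R]_n.+1) : R * 'rV[R]_n :=
  (v 0%R 0%R, rsubmx (v : 'rV[R]_(1 + n))).

Lemma cons_rVK : cancel cons_rV uncons_rV.
Proof.
move=> [t v]; rewrite /uncons_rV /cons_rV row_mxKr; congr pair.
transitivity (row_mx (t%:M : 'M[R]_1) v 0%R (lshift n 0%R)).
  by congr (row_mx _ _ _ _); exact/val_inj.
by rewrite row_mxEl mxE eqxx mulr1n.
Qed.

Lemma cons_rV0 p : cons_rV p 0%R 0%R = p.1.
Proof. by have /(congr1 fst) := cons_rVK p. Qed.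

Lemma cons_rVS p i : cons_rV p 0%R (lift ord0 i) = p.2 0%R i.
Proof.
transitivity (row_mx (p.1%:M : 'M[R]_1) p.2 0%R (rshift 1 i)).
  by congr (row_mx _ _ _ _); exact/val_inj.
by rewrite row_mxEr.
Qed.

Lemma measurable_cons_rV : measurable_fun setT cons_rV.
Proof.
apply: measurable_fun_rV => i; case: (unliftP ord0 i) => [j|] ->.
  rewrite (_ : (fun t => _) = (fun v : 'rV[R]_n => v 0%R j) \o snd).
    by apply: measurableT_comp => //; exact: measurable_coord.
  by apply/funext => p; exact: cons_rVS.
by rewrite (_ : (fun t => _) = fst)//; apply/funext => p; exact: cons_rV0.
Qed.

Lemma measurable_uncons_rV : measurable_fun setT uncons_rV.
Proof.
apply/measurable_fun_pairP; split; first exact: measurable_coord.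
apply: measurable_fun_rV => i.
rewrite (_ : (fun t => _) = (fun v : 'rV[R]_n.+1 => v 0%R (rshift 1 i))).
  exact: measurable_coord.
by apply/funext => v; rewrite /= mxE.
Qed.

Variable m : {sigma_finite_measure set 'rV[R]_n -> \bar R}.

Definition lebesgue_rV_succ : set 'rV[R]_n.+1 -> \bar R :=
  pushforward (lebesgue_measure \x m) cons_rV.

Let lebesgue_rV_succ0 : lebesgue_rV_succ set0 = 0.
Proof. by rewrite /lebesgue_rV_succ /pushforward preimage_set0 measure0. Qed.

Let lebesgue_rV_succ_ge0 A : 0 <= lebesgue_rV_succ A.
Proof. by rewrite /lebesgue_rV_succ /pushforward measure_ge0. Qed.

Let lebesgue_rV_succ_sigma_additive : semi_sigma_additive lebesgue_rV_succ.
Proof.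
by apply: measure_semi_sigma_additive; exact: measurable_cons_rV.
Qed.

HB.instance Definition _ := isMeasure.Build _ _ _ lebesgue_rV_succ
  lebesgue_rV_succ0 lebesgue_rV_succ_ge0 lebesgue_rV_succ_sigma_additive.

Let lebesgue_rV_succ_sigma_finite : sigma_finite setT lebesgue_rV_succ.
Proof.
have [F FT mF] : sigma_finite setT (lebesgue_measure \x m).
  have /sigma_finiteP[F [TF ndF Foo]] := sigma_finiteT (@lebesgue_measure R).
  have /sigma_finiteP[G [TG ndG Goo]] := sigma_finiteT m.
  exists (fun k => F k `*` G k).
    rewrite -setXTT TF TG predeqE => -[x y]; split.
      move=> [/= [i _ Fix] [j _ Gjy]]; exists (maxn i j) => //; split.
      - by move: x Fix; exact/subsetPset/ndF/leq_maxl.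
      - by move: y Gjy; exact/subsetPset/ndG/leq_maxr.
    by move=> [k _ []/= ? ?]; split; exists k.
  move=> k; have [? ?] := Foo k; have [? ?] := Goo k.
  split; first exact: measurableX.
  by rewrite product_measure1E// lte_mul_pinfty// ge0_fin_numE.
exists (fun k => uncons_rV @^-1` F k).
  by rewrite -preimage_bigcup -FT preimage_setT.
move=> k; have [mFk Fkoo] := mF k; split.
  by rewrite -[X in measurable X]setTI; exact: measurable_uncons_rV.
rewrite /lebesgue_rV_succ /pushforward -comp_preimage.
by rewrite (_ : uncons_rV \o cons_rV = id)//; apply/funext => p; exact: cons_rVK.
Qed.

HB.instance Definition _ := Measure_isSigmaFinite.Build _ _ _ lebesgue_rV_succ
  lebesgue_rV_succ_sigma_finite.

End lebesgue_rV_succ.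

Fixpoint lebesgue_rV {R : realType} (n : nat) :
    {sigma_finite_measure set 'rV[R]_n -> \bar R} :=
  match n with
  | 0 => \d_(0 : 'rV[R]_0)
  | k.+1 => lebesgue_rV_succ (lebesgue_rV k)
  end.

Lemma lebesgue_rV_box (R : realType) (n : nat) (B : 'I_n -> set R) :
  (forall i, measurable (B i)) ->
  lebesgue_rV n [set v : 'rV[R]_n | forall i, B i (v 0 i)] =
  (\prod_(i < n) lebesgue_measure (B i))%E.
Proof.
elim: n B => [|n IH] B mB.
  by rewrite big_ord0 /= diracE mem_set// => -[].
rewrite big_ord_recl -IH => [|i]; last exact: mB.
rewrite /= /lebesgue_rV_succ /pushforward -product_measure1E; first last.
- rewrite (_ : mkset _ = \bigcap_(i in [set: 'I_n])
      ((fun v : 'rV[R]_n => v 0 i) @^-1` B (lift ord0 i))).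
    apply: fin_bigcap_measurable => // i _; rewrite -[X in measurable X]setTI.
    exact: measurable_coord.
  by apply/seteqP; split=> v /= h i; [move=> _|]; exact: h.
- exact: mB.
congr (product_measure1 _ _ _); apply/seteqP; split=> -[t v] /=.
  move=> h; split; first by have := h ord0; rewrite cons_rV0.
  by move=> i; have := h (lift ord0 i); rewrite cons_rVS.
move=> [h0 h] i; case: (unliftP ord0 i) => [j|] ->.
  by rewrite cons_rVS; exact: h.
by rewrite cons_rV0.
Qed.

Section orlicz_sobolev.
Context {R : realType} {n : nat}.
Implicit Types (Omega : set 'rV[R]_n) (u : 'rV[R]_n -> R)
  (g : 'rV[R]_n -> 'rV[R]_n) (A : R -> \bar R).

Local Notation mu := (@lebesgue_rV R n).

(* Only the values of A on [0, +oo[ are meaningful. *)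
Record young_function A : Prop := {
  young_ge0 : forall t, 0 <= t -> (0 <= A t)%E ;
  young0 : A 0 = 0%E ;
  young_convex : forall s t p, 0 <= s -> 0 <= t -> 0 <= p <= 1 ->
    (A (p * s + (1 - p) * t)%R <= p%:E * A s + (1 - p)%:E * A t)%E ;
  young_left_continuous : forall t, 0 < t -> A s @[s --> t^'-] --> A t ;
  young_nonconstant : exists s t, [/\ 0 < s, 0 < t & A s != A t]
}.

Definition young_nondegenerate A := forall t, 0 < t -> (0 < A t)%E.

(* The norm of the normed space 'rV[R]_n is the sup norm. *)
Definition euclidean_norm (v : 'rV[R]_n) : R :=
  Num.sqrt (\sum_(i < n) v 0 i ^+ 2).

(* [w] is the length |u| of a scalar or vector-valued function u. *)
Definition orlicz_modular A Omega (w : 'rV[R]_n -> R) (lam : R) : \bar R :=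
  (\int[mu]_(x in Omega) A (w x / lam)%R)%E.

(* Elements of function spaces are represented by total functions on R^n, of
   which only the values on Omega matter, measurable for the Borel
   sigma-algebra as everywhere in the library; every class of Lebesgue
   measurable functions modulo equality a.e. has such a representative. *)
Definition orlicz A Omega u :=
  measurable_fun Omega u /\
  exists2 lam : R, 0 < lam & (orlicz_modular A Omega (fun x => `|u x|%R) lam < +oo)%E.

Definition orlicz_vec A Omega g :=
  measurable_fun Omega g /\
  exists2 lam : R, 0 < lam &
    (orlicz_modular A Omega (fun x => euclidean_norm (g x)) lam < +oo)%E.

Definition modular_cvg A Omega (u_ : nat -> 'rV[R]_n -> R) u :=
  exists2 lam : R, 0 < lam &
    orlicz_modular A Omega (fun x => `|u_ k x - u x|) lam @[k --> \oo] --> 0%E.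

Definition modular_cvg_vec A Omega (g_ : nat -> 'rV[R]_n -> 'rV[R]_n) g :=
  exists2 lam : R, 0 < lam &
    orlicz_modular A Omega (fun x => euclidean_norm (g_ k x - g x)) lam
      @[k --> \oo] --> 0%E.

Definition partial (i : 'I_n) (phi : 'rV[R]_n -> R) : 'rV[R]_n -> R :=
  'D_(delta_mx 0 i) phi.

Definition smooth (phi : 'rV[R]_n -> R) := forall s : seq 'I_n,
  continuous (foldr partial phi s) /\
  forall i x, derivable (foldr partial phi s) x (delta_mx 0 i).

Definition test_function Omega (phi : 'rV[R]_n -> R) :=
  let supp := closure [set x | phi x != 0] in
  [/\ smooth phi, compact supp & supp `<=` Omega].

Definition locally_integrable_on Omega u :=
  measurable_fun Omega u /\
  forall K, compact K -> K `<=` Omega -> mu.-integrable K (EFin \o u).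

Definition weak_gradient Omega u g :=
  [/\ locally_integrable_on Omega u,
      forall i, locally_integrable_on Omega (fun x => g x 0 i) &
      forall phi, test_function Omega phi -> forall i,
        \int[mu]_(x in Omega) (u x * partial i phi x) =
        - \int[mu]_(x in Omega) (g x 0 i * phi x)].

Definition orlicz_sobolev A Omega u :=
  orlicz A Omega u /\ exists2 g, weak_gradient Omega u g & orlicz_vec A Omega g.

(* Weak gradients being unique up to equality a.e., the choice of the
   representatives g_ k and g is immaterial. *)
Definition modular_cvg_sobolev A Omega (u_ : nat -> 'rV[R]_n -> R) u :=
  modular_cvg A Omega u_ u /\
  exists (g_ : nat -> 'rV[R]_n -> 'rV[R]_n) g, [/\ forall k, weak_gradient Omega (u_ k) (g_ k),
    weak_gradient Omega u g & modular_cvg_vec A Omega g_ g].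

End orlicz_sobolev.

(* Main.v *)
(* A Lipschitz function f is f 0 plus the primitive of a bounded Borel function
   h, by Radon-Nikodym applied to the Stieltjes measure of f t + L t. So the
   theorem is about the maps u |-> f 0 + (primitive of h) o u.

   Chain rule: grad (f o u) = h(u) grad u in the weak sense. If h is bounded and
   Lipschitz, this follows from the L^1 differentiability of u against a test
   function, which in turn comes from the continuity of translations in L^1; both
   sides pass to bounded pointwise limits in h, so a monotone class argument gives
   all bounded Borel h. No fact on the level sets of u is needed.

   Continuity: modular convergence implies L^1 convergence on compact sets.
   By the chain rule, h(u_k) grad u_k, hence h(u_k) grad u, tends to h(u) grad u
   as distributions. This holds for every bounded Borel h, in particular for h^2,
   so expanding the square shows that |h(u_k) - h(u)|^2 |d_i u phi| has integral
   tending to 0, and therefore |h(u_k) - h(u)| a does for every integrable a that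
   vanishes where grad u does, such as a = A(|grad u| / l). By convexity, for large
   lam, A(|h(u_k) grad u_k - h(u) grad u| / lam) is at most
   A(|grad u_k - grad u| / l1) + |h(u_k) - h(u)| / (2 M) A(|grad u| / l2). *)

From HB Require Import structures.
Require Import Defs.
From mathcomp Require Import all_boot all_order all_algebra.
From mathcomp Require Import all_classical all_reals all_analysis.
From mathcomp Require Import measurable_realfun.
From mathcomp Require Import lra ring.
Set Implicit Arguments.
Unset Strict Implicit.
Unset Printing Implicit Defensive.
Import Order.TTheory GRing.Theory Num.Theory.
Import numFieldNormedType.Exports.
Local Open Scope classical_set_scope.
Local Open Scope ring_scope.

(** * Monotone classes *)

(** The obstacle is that [h] is only Borel: [h (u_k x)] need not tend to [h (u x)], even when [u_k]
    tends to [u] uniformly. For f = |.|, u = 0 and u_k = 1 / (k + 1), one version of [h] is 1 on the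
    positive numbers and has any value at 0. What survives is convergence in the mean against
    weights that vanish with grad u, and it is extracted from the chain rule for all bounded Borel
    functions at once. [A] may grow arbitrarily fast or reach +oo, so A (c t) is not bounded by a
    multiple of A t. Constants are therefore absorbed into a larger [lam], and the small factor
    |h(u_k) - h(u)| / (2 M) comes out of [A] by convexity and A 0 = 0, since 2 M makes it at most 1.
    The weight A (|grad u| / l) is not bounded by a multiple of the |d_i u phi| either. Only the
    zero sets are related, hence a truncation to pass from one weight to the other. As [u] and its
    gradient are only locally integrable, identities are localised to a compact set somewhat larger
    than the support of the test function, which leaves room for small translations. *)

Section functional_monotone_class.
Context d (T : measurableType d) (R : realType).
Variables (G : set (set T)) (P : (T -> R) -> Prop).
Hypotheses (GE : @measurable _ T = <<s G >>) (GI : setI_closed G).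
Hypotheses (P1 : P (cst 1)) (PG : forall B, G B -> P (\1_B)).
Hypothesis PZD : forall (a : R) (f g : T -> R), P f -> P g -> P (fun x => a * f x + g x).
Hypothesis Plim : forall (f_ : nat -> T -> R) (f : T -> R) (M : R),
  (forall k, P (f_ k)) -> (forall k x, `|f_ k x| <= M) ->
  (forall x, f_ k x @[k --> \oo] --> f x) -> P f.

Let Psum I (s : seq I) (F : I -> T -> R) (c : I -> R) :
  (forall i, P (F i)) -> P (fun x => \sum_(i <- s) c i * F i x).
Proof.
move=> PF; elim: s => [|i s IH].
  rewrite (_ : (fun _ => _) = fun x => (-1) * cst 1 x + cst 1 x); first exact: PZD.
  by apply/funext => x; rewrite big_nil /= mulr1 addNr.
rewrite (_ : (fun _ => _) = fun x => c i * F i x + \sum_(i <- s) c i * F i x).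
  exact: PZD.
by apply/funext => x; rewrite big_cons.
Qed.

(** Dynkin's theorem: [G] being stable under intersections, closure under complements and countable
    disjoint unions is enough. Disjointness keeps the partial sums of indicators bounded by 1, as
    [Plim] requires. *)
Let Pindic B : measurable B -> P (\1_B).
Proof.
rewrite GE; move: B; apply: (dynkin_induction GE) => //.
- by rewrite indicT.
- move=> S _ PS; rewrite (_ : \1__ = fun x => (-1) * \1_S x + cst 1 x).
    exact: PZD.
  apply/funext => x; rewrite !indicE /= in_setC.
  by case: (x \in S); rewrite /= ?mulr1 ?mulr0 ?addNr ?add0r.
- move=> F _ tF PF; apply: (Plim (f_ := fun n x => \sum_(i <- iota 0 n) 1 * \1_(F i) x)
      (M := 1)) => [n||].
  + exact: Psum.
  + move=> n x; under eq_bigr do rewrite mul1r.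
    have [[i Fi]|h] := pselect (exists i, F i x); last first.
      by rewrite big1 ?normr0// => i _; rewrite indicE memNset// => Fi; apply: h; exists i.
    have Fj j : j != i -> \1_(F j) x = 0 :> R.
      move=> ji; rewrite indicE memNset// => Fj; move/negP: ji; apply; apply/eqP.
      by apply: tF => //; exists x.
    have [ni|ni] := ltnP i n.
      rewrite (bigD1_seq i)//= ?iota_uniq// ?mem_iota//=.
      rewrite big1 ?addr0 ?indicE ?mem_set ?normr1// => j; exact: Fj.
    rewrite big_seq big1 ?normr0// => j; rewrite mem_iota add0n /= => jn.
    by apply: Fj; rewrite neq_ltn (leq_trans jn ni).
  + move=> x; have [[i Fi]|h] := pselect (exists i, F i x); last first.
      rewrite indicE memNset/=; last by move=> [i _ Fi]; apply: h; exists i.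
      rewrite (_ : (fun _ => _) = cst 0); first exact: cvg_cst.
      apply/funext => n; rewrite big1//.
      by move=> i _; rewrite indicE memNset ?mulr0// => Fi; apply: h; exists i.
    rewrite indicE mem_set/=; last by exists i.
    apply: cvg_near_cst; exists i.+1 => // n /= ni.
    rewrite (bigD1_seq i)//= ?iota_uniq// ?mem_iota//=.
    rewrite big1 ?addr0 ?mul1r ?indicE ?mem_set// => j ji.
    rewrite mul1r indicE memNset// => Fj; move/negP: ji; apply; apply/eqP.
    by apply: tF => //; exists x.
Qed.

Import HBNNSimple.

(** Simple functions are combinations of indicators. Adding [M] makes the function nonnegative, so
    that its simple approximations lie below it and share the bound 2 M. *)
Lemma bounded_monotone_class (f : T -> R) (M : R) :
  measurable_fun setT f -> (forall x, `|f x| <= M) -> P f.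
Proof.
move=> mf fM.
have mg : measurable_fun setT (fun x => (f x + M)%:E).
  by apply/measurable_EFinP; exact: measurable_funD.
have g0 x : setT x -> (0 <= (f x + M)%:E)%E.
  by move=> _; rewrite lee_fin -lerBlDr sub0r lerNl (le_trans (ler_norm _))// normrN.
have g2M x : (f x + M <= M + M) by rewrite lerD2r (le_trans (ler_norm _)).
pose g_ := nnsfun_approx measurableT mg.
have Pg n : P (g_ n).
  rewrite (_ : _ (g_ n) = fun x =>
    \sum_(y <- finmap.enum_fset (fset_set (range (g_ n)))) y * \1_(g_ n @^-1` [set y]) x).
    by apply: Psum => y; exact: Pindic.
  by apply/funext => x; rewrite fimfunE fsbig_finite.
suff Pg' : P (fun x => f x + M).
  rewrite (_ : f = fun x => (- M) * cst 1 x + (f x + M)); first exact: PZD.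
  by apply/funext => x; rewrite /= mulr1 addrC addrK.
apply: (Plim (f_ := g_) (M := M + M)) => // [n x|x].
  rewrite ger0_norm//.
  have := le_approx n (fun x _ => g0 x I) (I : setT x).
  rewrite -(nnsfun_approxE measurableT mg) lee_fin => /le_trans; exact.
by have /fine_cvgP[] := cvg_nnsfun_approx measurableT mg g0 (I : setT x).
Qed.

End functional_monotone_class.

Section Rdominated_convergence.
Context d (T : measurableType d) (R : realType).
Variables (mu : {measure set T -> \bar R}) (D : set T).
Variables (f_ : nat -> T -> R) (f g : T -> R).
Hypotheses (mD : measurable D) (mf_ : forall n, measurable_fun D (f_ n)).
Hypotheses (ig : mu.-integrable D (EFin \o g)).
Hypothesis f_g : forall n x, D x -> `|f_ n x| <= g x.
Hypothesis f_f : forall x, D x -> f_ n x @[n --> \oo] --> f x.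

Lemma Rdominated_convergence : [/\ mu.-integrable D (EFin \o f),
  \int[mu]_(x in D) `|f_ n x - f x| @[n --> \oo] --> 0 &
  \int[mu]_(x in D) f_ n x @[n --> \oo] --> \int[mu]_(x in D) f x].
Proof.
have f_fE x : D x -> (EFin \o f_ n) x @[n --> \oo] --> (EFin \o f) x.
  by move=> Dx; apply: cvg_EFin; [exact: nearW|exact: f_f].
have mf : measurable_fun D (EFin \o f).
  apply: (emeasurable_fun_cvg (fun n => EFin \o f_ n)) => //.
  by move=> n; exact/measurable_EFinP.
have [] := @dominated_convergence _ _ _ mu _ mD (fun n => EFin \o f_ n)
    (EFin \o f) (EFin \o g) _ mf _ ig _.
- by move=> n; exact/measurable_EFinP.
- exact: aeW.
- by apply: aeW => x n Dx; rewrite /= lee_fin f_g.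
move=> intf h1 h2; split => //.
  by move/fine_cvgP : h1 => [].
have [_ h3] := (@fine_cvgP _ _ _ _ _ (fine (\int[mu]_(x in D) (EFin \o f) x)%E)).1
  (eq_ind_r (fun l => _ --> l) h2 (fineK (integrable_fin_num mD intf))).
exact: h3.
Qed.

End Rdominated_convergence.

Lemma max0r_le (R : realDomainType) (x y : R) : `|Num.max 0 x - Num.max 0 y| <= `|x - y|.
Proof.
by case: (leP 0 x) => x0; case: (leP 0 y) => y0; case: (ger0P (x - y)); rewrite ?ler_norml ?normrE; lra.
Qed.

Section lipschitz_monotone_class.
Context (R : realType) (P : (R -> R) -> Prop).
Hypothesis Plip : forall (h : R -> R) (M C : R), 0 <= C ->
  (forall x, `|h x| <= M) -> (forall x y, `|h x - h y| <= C * `|x - y|) -> P h.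
Hypothesis PZD : forall (a : R) (f g : R -> R), P f -> P g -> P (fun x => a * f x + g x).
Hypothesis Plim : forall (f_ : nat -> R -> R) (f : R -> R) (M : R),
  (forall k, P (f_ k)) -> (forall k x, `|f_ k x| <= M) ->
  (forall x, f_ k x @[k --> \oo] --> f x) -> P f.

Lemma lipschitz_monotone_class (h : R -> R) (M : R) :
  measurable_fun setT h -> (forall x, `|h x| <= M) -> P h.
Proof.
apply: (@bounded_monotone_class _ _ R (@RGenOInfty.G R)) => //.
- exact: RGenOInfty.measurableE.
- move=> _ _ [a ->] [b ->]; exists (Num.max a b).
  apply/seteqP; split => x /=; rewrite !in_itv/= !andbT gt_max.
    by move=> [-> ->].
  by move=> /andP[].
- apply: (Plip (M := 1) (C := 0)) => // [x|x y]; first by rewrite normr1.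
  by rewrite subrr normr0 mul0r.
- move=> _ [a ->].
  (* The nested maxima clamp [k (x - a)] to [0, 1]. This is a [k]-Lipschitz ramp, equal to 0 for
     [x <= a] and to 1 as soon as [k (x - a) >= 1], so its limit is the indicator of the open
     ray. *)
  apply: (Plim (f_ := fun k x => Num.max 0 (1 - Num.max 0 (1 - k%:R * (x - a)))) (M := 1)).
  + move=> k; apply: (Plip (M := 1) (C := k%:R)) => // [x|x y].
      by rewrite ger0_norm ?le_max ?lexx// ge_max ler01 gerDl oppr_le0 le_max lexx.
    apply: (le_trans (max0r_le _ _)); have E (s t : R) : 1 - s - (1 - t) = t - s by ring.
    rewrite E.
    rewrite distrC; apply: (le_trans (max0r_le _ _)); rewrite -[X in _ <= X * _]ger0_norm// -normrM.
    rewrite (_ : _ - _ = - (k%:R * (x - y))) ?normrN//; ring.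
  + move=> k x.
    by rewrite ger0_norm ?le_max ?lexx// ge_max ler01 gerDl oppr_le0 le_max lexx.
  + move=> x; have [xa|ax] := leP x a.
      rewrite indicE memNset; last by rewrite /= in_itv/= andbT; apply/negP; rewrite -leNgt.
      apply: cvg_near_cst; apply: nearW => k.
      apply/max_idPl; rewrite subr_le0 le_max; apply/orP; right.
      by rewrite lerDl oppr_ge0 mulr_ge0_le0// subr_le0.
    rewrite indicE mem_set; last by rewrite /= in_itv/= andbT.
    apply: cvg_near_cst; near=> k.
    have k1 : 1 <= k%:R * (x - a).
      rewrite -ler_pdivrMr ?subr_gt0// ltW//.
      near: k; exact: nbhs_infty_gtr.
    rewrite (max_idPl (_ : 1 - k%:R * (x - a) <= 0)) ?subr_le0// subr0.
    by apply/max_idPr.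
Unshelve. all: by end_near. Qed.

End lipschitz_monotone_class.

(** * Lebesgue measure on R^n *)

Section rV_boxes.
Context {R : realType} {n : nat}.
Local Notation mu := (@lebesgue_rV R n).

Definition rV_box (a b : 'I_n -> R) : set 'rV[R]_n :=
  [set v | forall i, a i < v 0 i < b i].

Lemma open_rV_box a b : open (rV_box a b).
Proof.
rewrite openE => v h; have := @filter_forall _ 'I_n (fun i (u : 'rV[R]_n) => a i < u 0 i < b i) (nbhs v) _.
apply => i; apply: (@coord_continuous R 1 n 0 i v `]a i, b i[%classic).
by apply: open_nbhs_nbhs; split; [exact: interval_open|by rewrite /= in_itv/= h].
Qed.

Lemma measurable_rV_box a b : measurable (rV_box a b).
Proof. by apply: rV_open_measurable; exact: open_rV_box. Qed.

Definition rV_boxes : set (set 'rV[R]_n) :=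
  [set B | exists a b, B = rV_box a b].

Lemma rV_boxesI : setI_closed rV_boxes.
Proof.
move=> _ _ [a [b ->]] [a' [b' ->]].
exists (fun i => Num.max (a i) (a' i)), (fun i => Num.min (b i) (b' i)).
apply/seteqP; split => v /=.
  by move=> [h h'] i; move: (h i) (h' i); rewrite gt_max lt_min => /andP[-> ->] /andP[-> ->].
move=> h; split=> i; have := h i; rewrite gt_max lt_min => /andP[/andP[h1 h2] /andP[h3 h4]].
  by rewrite h1.
by rewrite h2.
Qed.

(** A map into R^n is Borel as soon as its coordinates are, and a half-space is a countable union of
    boxes. Boxes thus form a generating pi-system on which both measures and functional classes can
    be tested. *)
Lemma measurable_rV_boxesE : @measurable _ 'rV[R]_n = <<s rV_boxes >>.
Proof.
apply/seteqP; split; last first.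
  apply: smallest_sub; first exact: sigma_algebra_measurable.
  by move=> _ [a [b ->]]; exact: measurable_rV_box.
suff mid : measurable_fun setT (fun v : g_sigma_algebraType rV_boxes => (v : 'rV[R]_n)).
  by move=> B mB; have := mid measurableT B mB; rewrite setTI preimage_id.
apply: measurable_fun_rV => i.
apply: (measurability _ (RGenOInfty.measurableE R)) => _ [_ [x ->] <-].
rewrite setTI (_ : _ @^-1` _ = \bigcup_k
    rV_box (fun j => if j == i then x else - k%:R) (fun=> k%:R)).
  by apply: bigcup_measurable => k _; apply: sub_sigma_algebra; do 2 eexists.
apply/seteqP; split => v /=; rewrite in_itv/= andbT; last first.
  by move=> [k _ /(_ i)]; rewrite eqxx => /andP[].
move=> xv.
have vk j : exists k, `|v 0 j| < k%:R.
  by exists (Num.truncn `|v 0 j|).+1; rewrite truncnS_gt.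
(* One integer has to dominate all coordinates, the [i]-th included, because [k] is the upper end of
   every side of the box. *)
pose K := (\max_(j < n) projT1 (cid (vk j)))%N.
have vK j : `|v 0 j| < K%:R.
  have := projT2 (cid (vk j)) => /lt_le_trans; apply.
  by rewrite ler_nat; exact: leq_bigmax.
exists K => // j; have := vK j; rewrite ltr_norml => /andP[h1 h2].
by rewrite h2 andbT; case: ifPn => // /eqP ->.
Qed.

Lemma lebesgue_rV_boxE a b :
  mu (rV_box a b) = (\prod_(i < n) lebesgue_measure `]a i, b i[%classic)%E.
Proof. exact: (lebesgue_rV_box (B := fun i => `]a i, b i[%classic)). Qed.

Lemma lebesgue_rV_box_lty a b : (mu (rV_box a b) < +oo)%E.
Proof.
rewrite lebesgue_rV_boxE; suff: (0 <= \prod_(i < n) lebesgue_measure `]a i, b i[%classic < +oo)%E by case/andP.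
elim/big_ind: _ => [|x y|i _].
- by rewrite lee01 ltry.
- move=> /andP[x0 xoo] /andP[y0 yoo]; rewrite mule_ge0//=.
  by rewrite lte_mul_pinfty// ge0_fin_numE.
- rewrite measure_ge0/= lebesgue_measure_itv/=.
  by case: ifPn => _; rewrite -?EFinB ltry.
Qed.

Lemma compact_sub_rV_box (K : set 'rV[R]_n) : compact K ->
  exists2 N, 0 < N & K `<=` rV_box (fun=> - N) (fun=> N).
Proof.
move=> /compact_bounded[M [_ /(_ (Num.max 0 M + 1))]].
have MM : M < Num.max 0 M + 1 by rewrite ltr_pwDr// le_max lexx orbT.
have M0 : 0 <= Num.max 0 M by rewrite le_max lexx.
move=> /(_ MM) h; exists (Num.max 0 M + 2); first by rewrite ltr_wpDl.
move=> v /h/= vM i; rewrite -ltr_norml (@le_lt_trans _ _ (Num.max 0 M + 1))//.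
  apply: le_trans vM; rewrite [leRHS]mx_normrE.
  exact: (@le_bigmax _ _ _ _ (fun ij : 'I_1 * 'I_n => `|v ij.1 ij.2|) (0, i)).
by rewrite ltrD2l (ltr_nat R 1 2).
Qed.

Lemma compact_rV_measurable (K : set 'rV[R]_n) : compact K -> measurable K.
Proof.
move=> cK; rewrite -(setCK K); apply: measurableC; apply: rV_open_measurable.
by apply: closed_openC; apply: compact_closed => //; exact: norm_hausdorff.
Qed.

Lemma compact_rV_lty (K : set 'rV[R]_n) : compact K -> (mu K < +oo)%E.
Proof.
move=> cK; have [N _ KN] := compact_sub_rV_box cK.
apply: le_lt_trans (lebesgue_rV_box_lty (fun=> - N) (fun=> N)).
apply: le_measure => //; rewrite inE; last exact: measurable_rV_box.
exact: compact_rV_measurable.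
Qed.

Lemma measurable_rV_coordP (D : set 'rV[R]_n) (g : 'rV[R]_n -> 'rV[R]_n) :
  measurable D -> (forall i, measurable_fun D (fun x => g x 0 i)) ->
  measurable_fun D g.
Proof.
move=> mD mg _ B mB.
have mgD : measurable_fun setT (g \_ D).
  apply: measurable_fun_rV => i.
  rewrite (_ : (fun t => _) = (fun x => g x 0 i) \_ D).
    exact/(measurable_restrictT _ mD).
  by apply/funext => x; rewrite /patch; case: ifP => //; rewrite mxE.
have := measurableI _ _ mD (mgD measurableT B mB); rewrite setTI.
congr measurable; apply/seteqP; split=> x /= -[Dx] gB; split => //.
  by move: gB; rewrite /patch mem_set.
by rewrite /patch mem_set.
Qed.

Lemma continuous_rV_measurable (f : 'rV[R]_n -> R) :
  continuous f -> measurable_fun setT f.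
Proof.
move=> cf; apply: (measurability _ (RGenOpens.measurableE R)) => _ [_ [x [y ->]] <-].
rewrite setTI; apply: rV_open_measurable; apply: open_comp; last exact: interval_open.
by move=> v _; exact: cf.
Qed.

Lemma measurable_rV_shift (c : 'rV[R]_n) : measurable_fun setT (fun x : 'rV[R]_n => x + c).
Proof.
apply: measurable_fun_rV => i.
rewrite (_ : (fun t => _) = (fun x => x + c 0 i) \o (fun v : 'rV[R]_n => v 0 i)).
  apply: measurableT_comp; last exact: measurable_coord.
  exact: measurable_funD.
by apply/funext => x /=; rewrite mxE.
Qed.

(** Uniqueness of measures: the preimage of a box under the translation is a box with the same side
    lengths, and cubes of finite measure exhaust the space. *)
Lemma lebesgue_rV_shift (c : 'rV[R]_n) B : measurable B ->
  pushforward mu (fun x : 'rV[R]_n => x + c) B = mu B.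
Proof.
move=> mB; apply/esym.
apply: (measure_unique rV_boxes (fun k => rV_box (fun=> - k%:R) (fun=> k%:R)) _ _ _ _
  mu (measure_function_pushforward__canonical__measure_function_Measure mu
        (measurable_rV_shift c)) _ _ B mB) => //.
- exact: measurable_rV_boxesE.
- exact: rV_boxesI.
- by move=> k; do 2 eexists.
- apply/seteqP; split => // v _.
  have [N N0 vN] := compact_sub_rV_box (@compact_set1 _ v).
  exists (Num.truncn N).+1 => // i; have := vN v erefl i.
  rewrite -!ltr_norml => /lt_trans; apply; exact: truncnS_gt.
- move=> _ [a [b ->]]; rewrite /= /pushforward.
  rewrite (_ : _ @^-1` _ = rV_box (fun i => a i - c 0 i) (fun i => b i - c 0 i)).
    rewrite [LHS]lebesgue_rV_boxE [RHS]lebesgue_rV_boxE; apply: eq_bigr => i _.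
    rewrite !lebesgue_measure_itv/= !lte_fin ltrD2r; case: ifP => // _.
    by rewrite -!EFinB opprB addrA subrK.
  by apply/seteqP; split => v /= h i; have := h i; rewrite mxE ltrBlDr ltrBrDr.
- by move=> k; exact: lebesgue_rV_box_lty.
Qed.

Lemma ge0_integral_rV_shift (c : 'rV[R]_n) (f : 'rV[R]_n -> \bar R) :
  measurable_fun setT f -> (forall x, 0 <= f x)%E ->
  (\int[mu]_x f (x + c)%R = \int[mu]_x f x)%E.
Proof.
move=> mf f0.
have := ge0_integral_pushforward (measurable_rV_shift c) mu measurableT mf
  (in1W f0).
rewrite preimage_setT /comp => <-.
by apply: eq_measure_integral => [|? B mB _]; [exact: measurable_rV_shift|exact: lebesgue_rV_shift].
Qed.

Lemma integrable_rV_shift (c : 'rV[R]_n) (f : 'rV[R]_n -> R) :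
  mu.-integrable setT (EFin \o f) -> mu.-integrable setT (EFin \o (fun x => f (x + c))).
Proof.
move=> /integrableP[mf foo]; apply/integrableP; split.
  exact: (measurableT_comp mf (measurable_rV_shift c)).
have mnf : measurable_fun setT (fun x => `|(f x)%:E|%E) by exact: measurableT_comp mf.
by rewrite (ge0_integral_rV_shift c mnf).
Qed.

Lemma Rintegral_rV_shift (c : 'rV[R]_n) (f : 'rV[R]_n -> R) :
  mu.-integrable setT (EFin \o f) ->
  \int[mu]_x f (x + c) = \int[mu]_x f x.
Proof.
move=> intf; have mf := measurable_int _ intf; rewrite /Rintegral; congr fine.
have intc : mu.-integrable ((fun x => x + c) @^-1` setT) ((EFin \o f) \o (fun x => x + c)).
  by rewrite preimage_setT; exact: integrable_rV_shift.
have := integral_pushforward (measurable_rV_shift c) mf intc measurableT.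
rewrite preimage_setT /comp => <-.
by apply: eq_measure_integral => [|? B mB _]; [exact: measurable_rV_shift|exact: lebesgue_rV_shift].
Qed.

End rV_boxes.

(** * Smooth functions and test functions *)

Section smooth_functions.
Context {R : realType} {n : nat}.
Implicit Types (phi psi : 'rV[R]_n -> R) (B : ('rV[R]_n -> R) -> Prop).
Local Notation e_ i := (delta_mx 0 i : 'rV[R]_n).

(** Both sides are limits of the same difference quotient. This hands partial derivatives over to
    the one-variable chain rule and to the fundamental theorem of calculus. *)
Lemma is_derive_line phi x v t df :
  is_derive (t *: v + x) v phi df <->
  is_derive t (1 : R) (fun s => phi (s *: v + x)) df.
Proof.
have E : (fun h : R => h^-1 *: (((fun s => phi (s *: v + x)) \o shift t) (h *: 1) -
      phi (t *: v + x))) =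
    (fun h : R => h^-1 *: ((phi \o shift (t *: v + x)) (h *: v) - phi (t *: v + x))).
  apply/funext => h /=; congr (_ *: (phi _ - _)).
  by rewrite [h *: 1]mulr1 scalerDl addrA.
by split=> -[dp dE]; split; move: dp dE; rewrite /derivable /derive E.
Qed.

(** Smoothness speaks of all iterated partial derivatives, so it is proved for a whole class stable
    under differentiation. The inductive form gives that stability by induction on how a function is
    built. *)
Inductive smooth_algebra B : ('rV[R]_n -> R) -> Prop :=
| smooth_algebra_base phi : B phi -> smooth_algebra B phi
| smooth_algebra_cst c : smooth_algebra B (fun=> c)
| smooth_algebraD phi psi : smooth_algebra B phi -> smooth_algebra B psi ->
    smooth_algebra B (fun x => phi x + psi x)
| smooth_algebraM phi psi : smooth_algebra B phi -> smooth_algebra B psi ->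
    smooth_algebra B (fun x => phi x * psi x).

Lemma smooth_algebra_prod B I (s : seq I) (F : I -> 'rV[R]_n -> R) :
  (forall i, smooth_algebra B (F i)) ->
  smooth_algebra B (fun x => \prod_(i <- s) F i x).
Proof.
move=> BF; elim: s => [|i s IH].
  by under eq_fun do rewrite big_nil; exact: smooth_algebra_cst.
by under eq_fun do rewrite big_cons; exact: smooth_algebraM.
Qed.

(** The derivative of a generator may be any member of the algebra. The sum and product rules extend
    this to all members, and then iterated partial derivatives never leave the algebra. *)
Lemma smooth_algebra_smooth B :
  (forall phi, B phi -> continuous phi /\ forall i, exists2 psi,
     smooth_algebra B psi & forall x, is_derive x (e_ i) phi (psi x)) ->
  forall phi, smooth_algebra B phi -> smooth phi.
Proof.
move=> HB.
have H phi : smooth_algebra B phi -> continuous phi /\ forall i, exists2 psi,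
     smooth_algebra B psi & forall x, is_derive x (e_ i) phi (psi x).
  elim=> {phi} [|c|phi psi sphi [cphi dphi] spsi [cpsi dpsi]|
    phi psi sphi [cphi dphi] spsi [cpsi dpsi]]; first exact: HB.
  - split; first exact: cst_continuous.
    by move=> i; exists (fun=> 0); [exact: smooth_algebra_cst|move=> x; exact: is_derive_cst].
  - split; first by move=> x; exact: (continuousD (cphi x) (cpsi x)).
    move=> i; have [p sp dp] := dphi i; have [q sq dq] := dpsi i.
    exists (fun x => p x + q x); first exact: smooth_algebraD.
    by move=> x; exact: is_deriveD.
  - split; first by move=> x; exact: (continuousM (cphi x) (cpsi x)).
    move=> i; have [p sp dp] := dphi i; have [q sq dq] := dpsi i.
    exists (fun x => phi x * q x + psi x * p x).
      by apply: smooth_algebraD; exact: smooth_algebraM.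
    by move=> x; exact: is_deriveM.
move=> phi sphi s.
have : smooth_algebra B (foldr partial phi s).
  elim: s => //= i s /H[_ /(_ i)[psi spsi dpsi]].
  rewrite (_ : partial _ _ = psi)//; apply/funext => x.
  exact: (@derive_val _ _ _ _ _ _ _ (dpsi x)).
move=> /H[cs ds]; split=> // i x; have [psi _ dpsi] := ds i.
exact: (@ex_derive _ _ _ _ _ _ _ (dpsi x)).
Qed.

Lemma smooth_continuous phi : smooth phi -> continuous phi.
Proof. by move=> /(_ [::])[]. Qed.

Lemma smooth_partial phi i : smooth phi -> smooth (partial i phi).
Proof. by move=> sphi s; have := sphi (rcons s i); rewrite foldr_rcons. Qed.

Lemma smooth_is_derive phi i x : smooth phi -> is_derive x (e_ i) phi (partial i phi x).
Proof. by move=> /(_ [::])[_ /(_ i x)] dphi; split. Qed.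

Lemma smoothM phi psi : smooth phi -> smooth psi -> smooth (fun x => phi x * psi x).
Proof.
move=> sphi spsi; apply: (@smooth_algebra_smooth smooth); last first.
  by apply: smooth_algebraM; exact: smooth_algebra_base.
move=> f sf; split; first exact: smooth_continuous.
move=> i; exists (partial i f); last by move=> x; exact: smooth_is_derive.
exact/smooth_algebra_base/smooth_partial.
Qed.

Lemma smooth_cst (c : R) : smooth (fun _ : 'rV[R]_n => c).
Proof.
by apply: (@smooth_algebra_smooth (fun _ => False)) => //; exact: smooth_algebra_cst.
Qed.

Lemma derive_shift phi (c x v : 'rV[R]_n) :
  'D_v (fun y => phi (y + c)) x = 'D_v phi (x + c).
Proof.
by rewrite /derive; under eq_fun do rewrite /= -addrA.
Qed.

Lemma partial_shift phi (c : 'rV[R]_n) i :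
  partial i (fun y => phi (y + c)) = fun y => partial i phi (y + c).
Proof. by apply/funext => x; rewrite /partial derive_shift. Qed.

Lemma continuous_addr (c : 'rV[R]_n) : continuous (fun x : 'rV[R]_n => x + c).
Proof. by move=> x; apply: continuousD; [exact: cvg_id|exact: cst_continuous]. Qed.

Lemma smooth_shift phi (c : 'rV[R]_n) : smooth phi -> smooth (fun x => phi (x + c)).
Proof.
move=> sphi s; have -> : foldr partial (fun x => phi (x + c)) s =
    fun x => foldr partial phi s (x + c).
  by elim: s => //= i s ->; rewrite partial_shift.
have [cs ds] := sphi s; split.
  by move=> x; exact: (continuous_comp (@continuous_addr c x) (cs _)).
move=> i x; have := ds i (x + c); rewrite /derivable.
by under [in X in _ -> X]eq_fun do rewrite /= -addrA.
Qed.

End smooth_functions.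

Section flat_function.
Context {R : realType}.
Implicit Types (y : R) (k : nat).

(* y^-k exp(-1/y), extended by 0 to y <= 0: these functions form a family
   which is closed under differentiation up to linear combinations. *)
Definition flat k y : R := if 0 < y then y^-1 ^+ k * expR (- y^-1) else 0.

Lemma flat_ge0 k y : 0 <= flat k y.
Proof.
rewrite /flat; case: ifPn => // y0.
by rewrite mulr_ge0 ?expR_ge0// exprn_ge0// invr_ge0 ltW.
Qed.

Lemma flat_gt0 y : (0 < flat 0 y) = (0 < y).
Proof.
rewrite /flat; case: ifPn => y0; last by rewrite ltxx.
by rewrite expr0 mul1r expR_gt0.
Qed.

Lemma flat0_le1 y : flat 0 y <= 1.
Proof.
rewrite /flat; case: ifPn => // y0.
by rewrite expr0 mul1r -expR0 ler_expR oppr_le0 invr_ge0 ltW.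
Qed.

(** Raising z <= exp z at z = 1 / ((k + 2) y) to the power k + 2 gives exp (-1/y) <= ((k + 2) y)^(k
    + 2), which leaves two powers of y after division by y^k. A quadratic bound is what forces the
    derivative at 0 to vanish. *)
Lemma flat_le k y : flat k y <= k.+2%:R ^+ k.+2 * y ^+ 2.
Proof.
rewrite /flat; case: ifPn => [y0|_]; last first.
  by rewrite mulr_ge0 ?sqr_ge0// exprn_ge0// ler0n.
have k0 : 0 < k.+2%:R :> R by rewrite ltr0n.
have eE : (k.+2%:R * y)^-1 ^+ k.+2 <= expR (y^-1).
  have h : (k.+2%:R * y)^-1 <= expR (k.+2%:R^-1 * y^-1).
    by rewrite invfM; apply: le_trans (expR_ge1Dx _); rewrite lerDr.
  rewrite -[in X in _ <= X](mulVKf (lt0r_neq0 k0) y^-1) expRM_natl.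
  by apply: lerXn2r h; rewrite nnegrE ?expR_ge0// invr_ge0 mulr_ge0// ltW.
have y2 : 0 < (k.+2%:R * y)^-1 ^+ k.+2 by rewrite exprn_gt0// invr_gt0 mulr_gt0.
have eE' : expR (- y^-1) <= (k.+2%:R * y) ^+ k.+2.
  rewrite expRN -[leRHS]invrK -exprVn lef_pV2// posrE ?expR_gt0//.
have yk0 : 0 <= y^-1 ^+ k by rewrite exprn_ge0// invr_ge0 ltW.
apply: (le_trans (ler_wpM2l yk0 eE')).
rewrite exprMn mulrCA exprVn ler_pM2l ?exprn_gt0//.
by rewrite -addn2 exprD mulrA mulVf ?mul1r// expf_neq0// gt_eqF.
Qed.

Lemma is_derive0_sqr (f : R -> R) (C : R) :
  (forall h, `|f h| <= C * h ^+ 2) -> is_derive (0 : R) (1 : R) f 0.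
Proof.
move=> fC.
have f0 : f 0 = 0.
  by apply/eqP; rewrite -normr_le0 (le_trans (fC 0))// expr0n mulr0.
have C0 : 0 <= C by have := fC 1; rewrite expr1n mulr1; exact: le_trans.
have H : (h^-1 *: ((f \o shift 0) (h *: (1 : R)) - f 0) : R) @[h --> 0^'] --> (0 : R).
  apply/cvgr0Pnorm_lt => e e0; near=> h.
  have h0 : h != 0 by near: h; exact: nbhs_dnbhs_neq.
  rewrite /= f0 subr0 addr0 [h *: _]mulr1 normrM normfV.
  rewrite ltr_pdivrMl ?normr_gt0// (le_lt_trans (fC h))//.
  rewrite -real_normK ?num_real// expr2 mulrCA ltr_pM2l ?normr_gt0//.
  rewrite (@le_lt_trans _ _ ((C + 1) * `|h|))// ?ler_pM2r ?normr_gt0// ?lerDl//.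
  rewrite -ltr_pdivlMl ?ltr_wpDl//; near: h.
  apply: dnbhs0_lt; by rewrite mulr_gt0// invr_gt0 ltr_wpDl.
split; first by apply/cvg_ex; exists 0.
exact: cvg_lim H.
Unshelve. all: by end_near. Qed.

(** Away from 0 this is calculus, and at 0 it is the quadratic bound. For [k = 0] the truncated
    exponent [k.-1] of the power rule is harmless, its coefficient being 0. *)
Lemma is_derive_flat k y :
  is_derive y (1 : R) (flat k) (flat k.+2 y - k%:R * flat k.+1 y).
Proof.
have [y0|y0|->] := ltgtP y 0.
- have -> : flat k.+2 y - k%:R * flat k.+1 y = 0.
    by rewrite /flat ltNge (ltW y0) mulr0 subr0.
  apply: (@near_eq_is_derive _ _ _ (cst 0)) => //.
    near=> z; rewrite /flat /= ltNge ifN// negbK ltW//.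
    by near: z; exact: lt_nbhsl.
- have -> : flat k.+2 y - k%:R * flat k.+1 y =
     y^-1 ^+ k * (expR (- y^-1) * (y ^- 2)) +
     expR (- y^-1) * (y^-1 ^+ k.-1 *+ k * (- y ^- 2)).
    rewrite /flat y0; case: k => [|k] /=.
      by rewrite mul0r subr0 mulr0n !mul0r mulr0 addr0 expr0 mul1r mulrC -exprVn.
    by rewrite -!exprVn !exprS -mulr_natl; ring.
  apply: (@near_eq_is_derive _ _ _ (fun z : R => z^-1 ^+ k * expR (- z^-1))) => //.
    by near=> z; rewrite /flat ifT//; near: z; exact: lt_nbhsr.
  have y_neq0 : y != 0 by rewrite gt_eqF.
  have dV : is_derive y (1 : R) (fun z : R => z^-1) (- y ^- 2).
    by apply: is_derive_eq (is_deriveV y_neq0 (is_derive_id y 1)) _; rewrite [_ *: _]mulr1.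
  have dX := is_deriveX k dV.
  have dE := @is_derive1_comp _ expR (fun z => - z^-1) y _ _ (is_derive_expR (- y^-1)) (is_deriveN dV).
  have := is_deriveM dX dE; rewrite (_ : _ * _ = fun z : R => z^-1 ^+ k * expR (- z^-1)).
    move=> dM; apply: is_derive_eq dM _.
  by rewrite opprK !fctE /= mulr_natl.
  by rewrite !fctE.
- have -> : flat k.+2 0 - k%:R * flat k.+1 0 = 0.
    by rewrite /flat ltxx mulr0 subr0.
  apply: (is_derive0_sqr (C := k.+2%:R ^+ k.+2)) => h.
  by rewrite ger0_norm ?flat_ge0//; exact: flat_le.
Unshelve. all: by end_near. Qed.

End flat_function.

Section box_bump.
Context {R : realType} {n : nat}.
Implicit Types (phi psi : 'rV[R]_n -> R).
Local Notation e_ i := (delta_mx 0 i : 'rV[R]_n).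

Definition flat_coord phi := exists k (i : 'I_n) (c d : R),
  phi = fun x => flat k (c * x 0 i + d).

Lemma continuous_flat k : continuous (@flat R k).
Proof.
move=> y; apply: differentiable_continuous; apply/derivable1_diffP.
exact: (@ex_derive _ _ _ _ _ _ _ (is_derive_flat k y)).
Qed.

Lemma flat_coord_smooth phi : smooth_algebra flat_coord phi -> smooth phi.
Proof.
apply: smooth_algebra_smooth => {}phi [k [i [c [d ->]]]]; split.
  move=> x; apply: (@continuous_comp _ _ _ (fun x : 'rV[R]_n => c * x 0 i + d) (flat k));
    last exact: continuous_flat.
  apply: continuousD; last exact: cst_continuous.
  apply: continuousM; first exact: cst_continuous.
  exact: coord_continuous.
move=> j; pose s : R := c * (e_ j) 0 i.
exists (fun x => (fun=> s) x * (flat k.+2 (c * x 0 i + d) +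
                   (fun=> - k%:R) x * flat k.+1 (c * x 0 i + d))).
  apply: smooth_algebraM; first exact: smooth_algebra_cst.
  apply: smooth_algebraD; first by apply: smooth_algebra_base; exists k.+2, i, c, d.
  apply: smooth_algebraM; first exact: smooth_algebra_cst.
  by apply: smooth_algebra_base; exists k.+1, i, c, d.
move=> x; set psi := fun x => flat k _; set df := (X in is_derive _ _ _ X).
have := is_derive_line psi x (e_ j) 0 df; rewrite scale0r add0r => ->; rewrite /psi /df.
rewrite (_ : (fun t => _) = flat k \o (fun t : R => s * t + (c * x 0 i + d))); last first.
  by apply/funext => t /=; congr (flat k _); rewrite /s !mxE; ring.
have dg : is_derive (0 : R) (1 : R) (fun t : R => s * t + (c * x 0 i + d)) s.
  by apply: is_derive_eq; rewrite addr0 [_ *: _]mulr1.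
have := @is_derive1_comp _ (flat k) (fun t : R => s * t + (c * x 0 i + d)) 0 _ s _ dg.
move=> /(_ _ (is_derive_flat k _)); rewrite mulr0 add0r => h.
by apply: is_derive_eq h _; rewrite mulrC mulNr.
Qed.

(** [j] is a steepness: for every [j > 0] the function is positive exactly on the open box, and
    since exp (-1 / (j y)) tends to 1 for y > 0, it tends to the indicator of the box as [j] grows.
    The arguments are written as affine forms so that each factor is literally a [flat_coord]. *)
Definition box_bump (j : R) (a b : 'I_n -> R) (x : 'rV[R]_n) : R :=
  \prod_(i < n) (flat 0 (j * x 0 i + (- (j * a i))) *
                 flat 0 (- j * x 0 i + j * b i)).

Lemma box_bumpE j a b x : box_bump j a b x =
  \prod_(i < n) (flat 0 (j * (x 0 i - a i)) * flat 0 (j * (b i - x 0 i))).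
Proof. by apply: eq_bigr => i _; congr (flat 0 _ * flat 0 _); ring. Qed.

Lemma smooth_box_bump j a b : smooth (box_bump j a b).
Proof.
apply: flat_coord_smooth; apply: smooth_algebra_prod => i.
apply: smooth_algebraM; apply: smooth_algebra_base; rewrite /flat_coord.
  by do 4 eexists.
by do 4 eexists.
Qed.

Lemma box_bump_itv j a b x : 0 <= box_bump j a b x <= 1.
Proof.
rewrite /box_bump; apply/andP; split.
  by apply: prodr_ge0 => i _; rewrite mulr_ge0 ?flat_ge0.
by apply: prodr_ile1 => i _; rewrite mulr_ge0 ?flat_ge0//= mulr_ile1 ?flat_ge0 ?flat0_le1.
Qed.

Lemma box_bump_gt0 j a b x : 0 < j ->
  rV_box a b x -> 0 < box_bump j a b x.
Proof.
move=> j0 xab; rewrite box_bumpE; apply: prodr_gt0 => i _.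
by have /andP[ax xb] := xab i; rewrite mulr_gt0// flat_gt0 mulr_gt0// subr_gt0.
Qed.

Lemma box_bump_eq0 j a b x : 0 < j -> ~ rV_box a b x -> box_bump j a b x = 0.
Proof.
move=> j0 /existsNP[i /negP]; rewrite negb_and -!leNgt => h.
rewrite box_bumpE (bigD1 i)//= /flat !pmulr_rgt0// !subr_gt0 !ltNge.
by case/orP: h => ->; rewrite /= ?mul0r ?mulr0 ?mul0r.
Qed.

Lemma cvg_flat0 (y : R) : 0 < y -> flat 0 (k.+1%:R * y) @[k --> \oo] --> (1 : R).
Proof.
move=> y0.
rewrite (_ : (fun k => _) = (fun k => expR (- (y^-1 * k.+1%:R^-1)))); last first.
  apply/funext => k; rewrite /flat mulr_gt0// ?ltr0n// expr0 mul1r invfM.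
  by rewrite [X in - X]mulrC.
rewrite -[X in _ --> X]expR0; apply: (cvg_comp _ expR); last exact: continuous_expR.
rewrite -oppr0; apply: cvgN; rewrite -(mulr0 y^-1).
by apply: cvgM; [exact: cvg_cst|exact: cvg_harmonic].
Qed.

Lemma cvg_box_bump a b x :
  box_bump k.+1%:R a b x @[k --> \oo] --> (\1_(rV_box a b) x : R).
Proof.
have [xab|xab] := pselect (rV_box a b x); last first.
  rewrite indicE memNset//; apply: cvg_near_cst; apply: nearW => k.
  by rewrite box_bump_eq0.
rewrite indicE mem_set//=; under eq_fun do rewrite box_bumpE.
have -> : 1%:R = \prod_(i < n) (1 * 1) :> R by rewrite big1// => ? _; rewrite mulr1.
apply: cvg_big => [|i _]; first exact: mul_continuous.
have /andP[ax xb] := xab i.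
by apply: cvgM; apply: cvg_flat0; rewrite subr_gt0.
Qed.

(** The boxes are the pi-system and ever steeper bumps reach their indicators. Through this lemma,
    statements on smooth multipliers are extended to bounded Borel multipliers. *)
Lemma smooth_monotone_class (P : ('rV[R]_n -> R) -> Prop) :
  (forall psi, smooth psi -> (forall x, 0 <= psi x <= 1) -> P psi) ->
  (forall (a : R) f g, P f -> P g -> P (fun x => a * f x + g x)) ->
  (forall (f_ : nat -> 'rV[R]_n -> R) f M, (forall k, P (f_ k)) ->
    (forall k x, `|f_ k x| <= M) ->
    (forall x, f_ k x @[k --> \oo] --> f x) -> P f) ->
  forall (f : 'rV[R]_n -> R) M, measurable_fun setT f -> (forall x, `|f x| <= M) -> P f.
Proof.
move=> Ps PZD Plim; apply: (@bounded_monotone_class _ _ R (@rV_boxes R n)) => //.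
- exact: measurable_rV_boxesE.
- exact: rV_boxesI.
- by apply: Ps => [|x]; [exact: smooth_cst|rewrite /= ler01 lexx].
- move=> _ [a [b ->]]; apply: (Plim (fun k => box_bump k.+1%:R a b) _ 1).
  + by move=> k; apply: Ps; [exact: smooth_box_bump|exact: box_bump_itv].
  + move=> k x; have /andP[h0 h1] := box_bump_itv k.+1%:R a b x.
    by rewrite ger0_norm.
  + exact: cvg_box_bump.
Qed.

End box_bump.

Section test_functions.
Context {R : realType} {n : nat}.
Implicit Types (phi psi : 'rV[R]_n -> R) (Omega K : set 'rV[R]_n).

(** Trades the closure of the support for any compact set outside which the function vanishes. Such
    a set is easier to exhibit, and products and partial derivatives inherit it. *)
Lemma test_functionP Omega phi : test_function Omega phi <->
  smooth phi /\ exists K, [/\ compact K, K `<=` Omega & forall x, ~ K x -> phi x = 0].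
Proof.
split=> [[sphi cK KO]|[sphi [K [cK KO phiK]]]].
  split=> //; eexists; split; [exact: cK|exact: KO|].
  move=> x xK; apply: contrapT => /eqP phix; apply: xK; exact: subset_closure.
have sK : closure [set x | phi x != 0] `<=` K.
  rewrite closureE; apply: bigcap_inf; split.
    by apply: compact_closed => //; exact: norm_hausdorff.
  by move=> x /= /eqP phix; apply: contrapT => /phiK.
split=> //; last exact: subset_trans KO.
by apply: subclosed_compact cK sK; exact: closed_closure.
Qed.

Lemma test_functionM Omega phi psi : test_function Omega phi -> smooth psi ->
  test_function Omega (fun x => phi x * psi x).
Proof.
move=> /test_functionP[sphi [K [cK KO phiK]]] spsi; apply/test_functionP; split.
  exact: smoothM.
by exists K; split=> // x /phiK ->; rewrite mul0r.
Qed.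

Lemma test_function_box_bump Omega (a b : 'I_n -> R) :
  (forall x : 'rV[R]_n, (forall i, a i <= x 0 i <= b i) -> Omega x) ->
  test_function Omega (box_bump 1 a b).
Proof.
move=> abO; apply/test_functionP; split; first exact: smooth_box_bump.
exists [set v : 'rV[R]_n | forall i, `[a i, b i]%classic (v ord0 i)]; split.
- by apply: (@rV_compact R n (fun i => `[a i, b i]%classic)) => i; exact: segment_compact.
- move=> x h; apply: abO => i; have := h i; by rewrite /= in_itv/=.
- move=> x h; apply: box_bump_eq0 => // h'; apply: h => i; rewrite /= in_itv/=.
  by have /andP[/ltW -> /ltW ->] := h' i.
Qed.

(** Bumps on cubes with rational centre and radius 1 / (k + 1) are countably many; those that are
    not test functions on [Omega] are replaced by 0. Countability allows almost everywhere
    statements to be checked bump by bump. *)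
Lemma test_function_cover Omega : open Omega ->
  exists phi_ : nat -> 'rV[R]_n -> R, (forall q, test_function Omega (phi_ q)) /\
    forall x, Omega x -> exists q, phi_ q x != 0.
Proof.
move=> oO.
pose phi (q : 'rV[rat]_n * nat) : 'rV[R]_n -> R := box_bump 1
  (fun i => ratr (q.1 0 i) - q.2.+1%:R^-1) (fun i => ratr (q.1 0 i) + q.2.+1%:R^-1).
pose good q := `[< test_function Omega (phi q) >].
exists (fun m => if unpickle m is Some q then if good q then phi q else fun=> 0 else fun=> 0).
have t0 : test_function Omega (fun=> 0).
  apply/test_functionP; split; first exact: smooth_cst.
  by exists set0; split => //; exact: compact0.
split=> [m|x Ox].
  by case: unpickle => // q; case: ifPn => // /asboolP.
suff [q [gq qx]] : exists q, good q /\ phi q x != 0.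
  by exists (pickle q); rewrite pickleK gq.
have /nbhs_ballP[e /= e0 exO] : nbhs x Omega by exact: open_nbhs_nbhs.
have [k ke] : exists k, k.+1%:R^-1 < e / 2.
  have e20 : 0 < e / 2 by rewrite divr_gt0.
  have [k _ hk] := near_infty_natSinv_lt (PosNum e20).
  by exists k; apply: hk => /=.
have k0 : 0 < k.+1%:R^-1 :> R by rewrite invr_gt0.
have qi (i : 'I_n) : exists q : rat, `|ratr q - x 0 i| < k.+1%:R^-1.
  have /rat_in_itvoo[q] : x 0 i - k.+1%:R^-1 < x 0 i + k.+1%:R^-1.
    by rewrite ltrD2l gtrN.
  by rewrite in_itv/= => qv; exists q; rewrite ltr_distl.
pose c : 'rV[rat]_n := \row_i projT1 (cid (qi i)).
have cE i : `|ratr (c 0 i) - x 0 i| < k.+1%:R^-1.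
  by rewrite mxE; case: cid.
exists (c, k); split.
  (* The radius is below [e / 2] and [x] is closer to the centre than the radius, so the closed cube
     stays within [e] of [x]. *)
  apply/asboolP; apply: test_function_box_bump => y /= yc; apply: exO.
  rewrite rV_ballE// => i _ /=; rewrite -ball_normE/=.
  have -> : x 0 i - y 0 i = (x 0 i - ratr (c 0 i)) + (ratr (c 0 i) - y 0 i).
    by rewrite addrA subrK.
  rewrite (le_lt_trans (ler_normD _ _))// (splitr e) ltrD//.
    by rewrite distrC (lt_trans (cE i)).
  by rewrite (le_lt_trans _ ke)// distrC ler_distl.
by rewrite gt_eqF// box_bump_gt0// => i /=; rewrite -ltr_distl distrC.
Qed.

End test_functions.

(** * Translations in L^1 *)

Section Rintegrable.
Context d (T : measurableType d) (R : realType) (mu : {measure set T -> \bar R}).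
Variables (D : set T) (mD : measurable D).
Implicit Types f g h : T -> R.
Local Notation intg f := (mu.-integrable D (EFin \o f)).

Lemma intg_measurable f : intg f -> measurable_fun D f.
Proof. by move=> /measurable_int/measurable_EFinP. Qed.

Lemma intgD f g : intg f -> intg g -> intg (fun x => f x + g x).
Proof. by move=> fi gi; apply: eq_integrable (integrableD mD fi gi). Qed.

Lemma intgB f g : intg f -> intg g -> intg (fun x => f x - g x).
Proof. by move=> fi gi; apply: eq_integrable (integrableB mD fi gi). Qed.

Lemma intgZ (a : R) f : intg f -> intg (fun x => a * f x).
Proof. by move=> intf; apply: eq_integrable (integrableZl mD a intf). Qed.

Lemma intg_norm f : intg f -> intg (fun x => `|f x|).
Proof. exact: integrable_norm. Qed.

Lemma intg_le f g : measurable_fun D f -> (forall x, D x -> `|f x| <= g x) ->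
  intg g -> intg f.
Proof.
move=> mf fg intg'; apply: le_integrable (intg') => //; first exact/measurable_EFinP.
by move=> x Dx; rewrite lee_fin (le_trans (fg x Dx))// ler_norm.
Qed.

Lemma intgMb f h (M : R) : intg f -> measurable_fun D h ->
  (forall x, D x -> `|h x| <= M) -> intg (fun x => h x * f x).
Proof.
move=> intf mh hM; apply: (@intg_le _ (fun x => M * `|f x|)).
- by apply: measurable_funM => //; exact: intg_measurable.
- by move=> x Dx; rewrite normrM ler_wpM2r// hM.
- exact/intgZ/intg_norm.
Qed.

End Rintegrable.

Lemma intg_indic d (T : measurableType d) (R : realType)
    (mu : {measure set T -> \bar R}) (B : set T) : measurable B -> (mu B < +oo)%E ->
  mu.-integrable setT (EFin \o (\1_B : T -> R)).
Proof.
move=> mB Boo; apply/integrableP; split; first exact/measurable_EFinP.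
under eq_integral do rewrite gee0_abs ?lee_fin//.
by rewrite integral_indic// setIT.
Qed.

(** A pointwise limit of the continuous functions x / (x^2 + 1 / (k + 1)). They all vanish at 0, in
    agreement with the convention that 0 is its own inverse. *)
Lemma measurable_invr (R : realType) : measurable_fun setT (fun x : R => x^-1).
Proof.
have k0 k : (0 : R) < k.+1%:R^-1 by rewrite invr_gt0.
apply: (measurable_fun_cvg (h := fun k (x : R) => x * (x ^+ 2 + k.+1%:R^-1)^-1)).
  move=> k; apply: continuous_measurable_fun => x.
  apply: cvgM; first exact: cvg_id.
  apply: cvgV; first by rewrite gt_eqF// ltr_wpDl// sqr_ge0.
  by apply: cvgD; [exact: exprn_continuous|exact: cvg_cst].
move=> x _; have [->|x0] := eqVneq x 0.
  by rewrite invr0; under eq_fun do rewrite mul0r; exact: cvg_cst.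
rewrite [X in _ --> X](_ : _ = x * (x ^+ 2 + 0)^-1); last first.
  by rewrite addr0 expr2 invfM mulrA divff// mul1r.
apply: cvgM; first exact: cvg_cst.
apply: cvgV; first by rewrite addr0 expf_neq0.
by apply: cvgD; [exact: cvg_cst|exact: cvg_harmonic].
Qed.

Section shift_continuity.
Context {R : realType} {n : nat}.
Local Notation mu := (@lebesgue_rV R n).
Local Notation intg f := (mu.-integrable setT (EFin \o f)).
Implicit Types f g : 'rV[R]_n -> R.

Let shiftcvg f := forall c_ : nat -> 'rV[R]_n, c_ k @[k --> \oo] --> (0 : 'rV[R]_n) ->
  \int[mu]_x `|f (x + c_ k) - f x| @[k --> \oo] --> (0 : R).

(** Translation preserves the L^1 norm, so |f (. + c) - f| has integral at most 2 |f - g|_1 plus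
    that of |g (. + c) - g|. With [e / 4] for each of the three, the sum is below [e]. *)
Let shiftcvg_closure f : intg f ->
  (forall e, 0 < e -> exists g, [/\ intg g, shiftcvg g & \int[mu]_x `|f x - g x| <= e]) ->
  shiftcvg f.
Proof.
move=> intf H c_ c0; apply/cvgr0Pnorm_lt => e e0.
have [g [intg' Sg fge]] := H (e / 4) ltac:(by rewrite divr_gt0).
have /cvgr0Pnorm_lt/(_ (e / 4)) := Sg c_ c0.
move=> /(_ ltac:(by rewrite divr_gt0)); apply: filterS => k.
rewrite !ger0_norm ?Rintegral_ge0// => gk.
have intfc := integrable_rV_shift (c_ k) intf.
have intgc := integrable_rV_shift (c_ k) intg'.
have ifg := intg_norm (intgB measurableT intf intg').
have igc := intg_norm (intgB measurableT intgc intg').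
have ifc := intg_norm (intgB measurableT intfc intf).
have ifgc : intg (fun x => `|f (x + c_ k) - g (x + c_ k)|).
  exact: intg_norm (intgB measurableT intfc intgc).
have : \int[mu]_x `|f (x + c_ k) - f x| <=
   \int[mu]_x (`|f (x + c_ k) - g (x + c_ k)| + (`|g (x + c_ k) - g x| + `|f x - g x|)).
  apply: le_Rintegral => //; first by do 2 apply: intgD => //.
  move=> x _; rewrite [`|f x - g x|]distrC.
  rewrite (_ : f (x + c_ k) - f x = (f (x + c_ k) - g (x + c_ k)) +
      ((g (x + c_ k) - g x) + (g x - f x))); last by ring.
  by rewrite (le_trans (ler_normD _ _))// lerD2l ler_normD.
rewrite !RintegralD//; last exact: intgD.
rewrite (Rintegral_rV_shift (c_ k) (f := fun x => `|f x - g x|))// => h.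
lra.
Qed.

Let shiftcvg_continuous f K (M : R) : continuous f -> compact K ->
  (forall x, ~ K x -> f x = 0) -> (forall x, `|f x| <= M) -> intg f /\ shiftcvg f.
Proof.
move=> cf cK fK fM.
have mf := continuous_rV_measurable cf.
have M0 : 0 <= M by apply: le_trans (fM 0).
have intB (N : R) : intg (fun x => (M + M) * \1_(rV_box (fun=> - N) (fun=> N) : set 'rV[R]_n) x).
  apply: intgZ => //; apply: intg_indic; first exact: measurable_rV_box.
  exact: lebesgue_rV_box_lty.
have [N N0 KN] := compact_sub_rV_box cK.
split.
  apply: (intg_le measurableT mf _ (intB N)) => x _.
  have [Kx|/fK ->] := pselect (K x).
    by rewrite indicE mem_set ?mulr1; [rewrite (le_trans (fM _))// lerDl|exact: KN].
  by rewrite normr0 mulr_ge0// addr_ge0.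
move=> c_ c0.
(* A convergent sequence of shifts is bounded, so all the translates of [f] live in one enlarged
   box, and 2 M times its indicator dominates the differences. *)
have [C [_ /(_ (Num.max 0 C + 1)) cC]] : bounded_fun c_ by apply: cvg_seq_bounded; apply/cvg_ex; exists 0.
have {}cC k i : `|c_ k 0 i| <= Num.max 0 C + 1.
  apply: le_trans (cC _ k I); last by rewrite ltr_pwDr// le_max lexx orbT.
  rewrite [leRHS]mx_normrE.
  exact: (@le_bigmax _ _ _ _ (fun ij : 'I_1 * 'I_n => `|c_ k ij.1 ij.2|) (0, i)).
have C0 : 0 <= Num.max 0 C + 1 by rewrite addr_ge0// le_max lexx.
have := @Rdominated_convergence _ _ R mu setT (fun k x => f (x + c_ k)) f
  (fun x => (M + M) * \1_(rV_box (fun=> - (N + (Num.max 0 C + 1)))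
       (fun=> N + (Num.max 0 C + 1)) : set 'rV[R]_n) x) measurableT.
case=> //.
- by move=> k; exact: (measurableT_comp mf (measurable_rV_shift (c_ k))).
- move=> k x _; have [Kx|/fK ->] := pselect (K (x + c_ k)); last first.
    by rewrite normr0 mulr_ge0// addr_ge0.
  rewrite indicE mem_set ?mulr1; first by rewrite (le_trans (fM _))// lerDl.
  move=> i; rewrite /= -ltr_norml.
  rewrite (_ : x 0 i = (x + c_ k) 0 i - c_ k 0 i); last by rewrite mxE addrK.
  rewrite (le_lt_trans (ler_normB _ _))// ltr_leD//.
  by rewrite ltr_norml; exact: KN.
- move=> x _; have xc : x + c_ k @[k --> \oo] --> x + 0.
    by apply: cvgD => //; exact: cvg_cst.
  by move: xc; rewrite addr0 => xc; apply: (cvg_comp _ _ xc); exact: cf.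
Qed.

(** A smooth weight that is positive exactly on the open cube of half-side [m]. Its products with
    bounded Borel functions are dense in L^1. *)
Let w (m : nat) : 'rV[R]_n -> R := box_bump 1 (fun=> - m%:R) (fun=> m%:R).

Let wK m : exists2 K : set 'rV[R]_n, compact K & forall x, ~ K x -> w m x = 0.
Proof.
have /test_functionP[_ [K [cK _ wK]]] : test_function setT (w m).
  exact: test_function_box_bump.
by exists K.
Qed.

Let w_norm m x : `|w m x| <= 1.
Proof. by have /andP[w0 w1] := box_bump_itv 1 (fun=> - m%:R) (fun=> m%:R) x; rewrite ger0_norm. Qed.

Let cw m : continuous (w m).
Proof. exact/smooth_continuous/smooth_box_bump. Qed.

(** The fixed integrable weight turns bounded pointwise convergence of the factors into L^1
    convergence of the products, so the limit step of the monotone class is the closedness of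
    [shiftcvg] in L^1. *)
Let shiftcvg_bounded m (b : 'rV[R]_n -> R) (M : R) : measurable_fun setT b -> (forall x, `|b x| <= M) ->
  shiftcvg (fun x => b x * w m x).
Proof.
have [K cK wK'] := wK m.
have intw : intg (w m) by have [] := shiftcvg_continuous (@cw m) cK wK' (@w_norm m).
move=> mb bM.
pose P (b : 'rV[R]_n -> R) := [/\ measurable_fun setT b,
  exists M : R, forall x, `|b x| <= M & shiftcvg (fun x => b x * w m x)].
suff [] : P b by [].
apply: (smooth_monotone_class (P := P)) mb bM.
- move=> psi spsi psi01.
  have psi1 x : `|psi x| <= 1 by have /andP[p0 p1] := psi01 x; rewrite ger0_norm.
  have cpsi := smooth_continuous spsi.
  split; first exact: continuous_rV_measurable.
    by exists 1.
  have [] // := @shiftcvg_continuous (fun x => psi x * w m x) K 1.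
  + by move=> x; apply: continuousM; [exact: cpsi|exact: cw].
  + by move=> x /wK' ->; rewrite mulr0.
  + by move=> x; rewrite normrM mulr_ile1.
- move=> a f g [mf [F fF] Sf] [mg [G gG] Sg]; split.
  + by apply: measurable_funD => //; exact: measurable_funM.
  + exists (`|a| * F + G) => x; rewrite (le_trans (ler_normD _ _))// lerD// normrM.
    by rewrite ler_wpM2l.
  + move=> c_ c0.
    have intf : intg (fun x => f x * w m x) by apply: intgMb intw mf _.
    have intg' : intg (fun x => g x * w m x) by apply: intgMb intw mg _.
    have intfc k := intg_norm (intgB measurableT (integrable_rV_shift (c_ k) intf) intf).
    have intgc k := intg_norm (intgB measurableT (integrable_rV_shift (c_ k) intg') intg').
    have intafg : intg (fun x => (a * f x + g x) * w m x).
      apply: eq_integrable (intgD measurableT (intgZ measurableT a intf) intg') => //.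
      by move=> x _ /=; rewrite mulrDl mulrA.
    have intafgc k := intg_norm (intgB measurableT (integrable_rV_shift (c_ k) intafg) intafg).
    apply: (@squeeze_cvgr _ _ _ _ (fun=> 0) (fun k => `|a| * \int[mu]_x
       `|f (x + c_ k) * w m (x + c_ k) - f x * w m x| +
       \int[mu]_x `|g (x + c_ k) * w m (x + c_ k) - g x * w m x|)); last 2 first.
    * exact: cvg_cst.
    * rewrite -[X in _ --> X](addr0 0) -[X in X + _](mulr0 `|a|).
      apply: cvgD; last exact: Sg.
      by apply: cvgM; [exact: cvg_cst|exact: Sf].
    * apply: nearW => k; rewrite Rintegral_ge0//=.
      rewrite -RintegralZl// -RintegralD//; last exact: intgZ.
      apply: le_Rintegral => //; first by apply: intgD => //; exact: intgZ.
      move=> x _; rewrite -normrM (le_trans _ (ler_normD _ _))//.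
      by rewrite le_eqVlt; apply/orP; left; apply/eqP; congr `|_|; ring.
- move=> f_ f F Pf fF cvf; split.
  + by apply: (measurable_fun_cvg (h := f_)) => // k; have [] := Pf k.
  + exists F => x; rewrite -(cvg_lim _ (cvg_norm (cvf x)))//.
    by apply: limr_le; [exact: cvgP (cvg_norm (cvf x))|exact: nearW].
  + have [||||intfw fw0 _] := @Rdominated_convergence _ _ R mu setT
       (fun k x => f_ k x * w m x) (fun x => f x * w m x) (fun x => F * `|w m x|) measurableT.
    * by move=> k; apply: measurable_funM; [have [] := Pf k|exact: continuous_rV_measurable].
    * exact/intgZ/intg_norm.
    * by move=> k x _; rewrite normrM ler_wpM2r.
    * by move=> x _; apply: cvgM => //; exact: cvg_cst.
    apply: shiftcvg_closure => // e e0.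
    have /cvgr0Pnorm_lt/(_ _ e0)[k _ /(_ k (leqnn k))] := fw0.
    rewrite ger0_norm ?Rintegral_ge0// => fke.
    exists (fun x => f_ k x * w m x); have [mfk _ Sfk] := Pf k; split => //.
      by apply: intgMb intw mfk (fun x _ => fF k x).
    by rewrite ltW//; under eq_Rintegral do rewrite distrC.
Qed.

(** On [E m] the function is the weight [w m] times a factor bounded by [m]. The restrictions of [f]
    to [E m] tend to [f] in L^1, because [m * w m x] tends to infinity at every [x]. *)
Lemma cvg_L1_shift f (c_ : nat -> 'rV[R]_n) : intg f -> c_ k @[k --> \oo] --> (0 : 'rV[R]_n) ->
  \int[mu]_x `|f (x + c_ k) - f x| @[k --> \oo] --> (0 : R).
Proof.
move=> intf; move: c_; rewrite -/(shiftcvg f).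
have mf := intg_measurable intf.
have mw m : measurable_fun setT (w m) by apply: continuous_rV_measurable; exact: cw.
pose E m : set 'rV[R]_n := [set x | `|f x| <= m%:R * w m x].
have mE m : measurable (E m).
  rewrite -[X in measurable X]setTI; apply: measurable_fun_ler => //.
    exact: measurableT_comp.
  exact: measurable_funM.
have [||||_ fE0 _] := @Rdominated_convergence _ _ R mu setT
   (fun m x => \1_(E m) x * f x) f (fun x => `|f x|) measurableT.
- by move=> m; exact: measurable_funM.
- exact: intg_norm.
- move=> m x _; rewrite normrM ler_piMl// indicE.
  by case: (_ \in _); rewrite ?normr1 ?normr0.
- move=> x _; apply: cvg_near_cst.
  have [N N0 xN] := compact_sub_rV_box (@compact_set1 _ x).
  pose m0 := (Num.truncn N).+1.
  have wx : 0 < w m0 x.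
    apply: box_bump_gt0 => // i; have := xN x erefl i.
    by rewrite -!ltr_norml => /lt_trans; apply; exact: truncnS_gt.
  exists (maxn m0 (Num.truncn (`|f x| / w m0 x)).+1) => // m /=.
  rewrite geq_max => /andP[m0m fm].
  rewrite indicE mem_set ?mul1r//= /E/=.
  apply: (@le_trans _ _ (m%:R * w m0 x)).
    rewrite -ler_pdivrMr//; apply: ltW; apply: (lt_le_trans (truncnS_gt _)).
    by rewrite ler_nat.
  rewrite ler_wpM2l// /w !box_bumpE; apply: ler_prod => i _.
  have flat_mono (y z : R) : y <= z -> flat 0 y <= flat 0 z.
    move=> yz; rewrite /flat; case: ifPn => y0; last by case: ifPn; rewrite // expr0 mul1r expR_ge0.
    by rewrite (lt_le_trans y0 yz) !expr0 !mul1r ler_expR lerN2 lef_pV2// posrE (lt_le_trans y0).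
  rewrite mulr_ge0 ?flat_ge0//= ler_pM ?flat_ge0//; apply: flat_mono; rewrite !mul1r.
    by rewrite lerD2l lerN2 lerN2 ler_nat.
  by rewrite lerD2r ler_nat.
apply: shiftcvg_closure => // e e0.
have /cvgr0Pnorm_lt/(_ _ e0)[m _ /(_ m (leqnn m))] := fE0.
rewrite ger0_norm ?Rintegral_ge0// => fme.
pose b x := \1_(E m) x * f x / w m x.
have bw x : b x * w m x = \1_(E m) x * f x.
  rewrite /b; have [wx|wx] := eqVneq (w m x) 0; last by rewrite divfK.
  rewrite wx mulr0 indicE; have [|_] := boolP (x \in E m); last by rewrite mul0r.
  by rewrite inE /E/= wx mulr0 normr_le0 => /eqP ->; rewrite mulr0.
have bm x : `|b x| <= m%:R.
  rewrite /b indicE; have [|_] := boolP (x \in E m); last by rewrite !mul0r normr0.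
  rewrite inE /E/= mul1r => fx; rewrite normrM normfV.
  have [->|wx] := eqVneq (w m x) 0; first by rewrite normr0 invr0 mulr0.
  by rewrite ler_pdivrMr ?normr_gt0// (le_trans fx)// ler_wpM2l// ler_norm.
have mb : measurable_fun setT b.
  apply: measurable_funM; first exact: measurable_funM.
  exact: (measurableT_comp (@measurable_invr R) (mw m)).
exists (fun x => \1_(E m) x * f x); split.
- apply: (intgMb measurableT (M := 1) intf) => [|x _]; first exact: measurable_indic.
  by rewrite indicE; case: (_ \in _); rewrite ?normr1 ?normr0.
- have := @shiftcvg_bounded m b m%:R mb bm.
  by under eq_fun do rewrite bw.
- by rewrite ltW//; under eq_Rintegral do rewrite distrC.
Qed.

End shift_continuity.

Lemma EFin_Rintegral d (T : measurableType d) (R : realType)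
    (mu : {measure set T -> \bar R}) (D : set T) (f : T -> R) : measurable D ->
  mu.-integrable D (EFin \o f) ->
  (\int[mu]_(x in D) f x)%:E = (\int[mu]_(x in D) (f x)%:E)%E.
Proof. by move=> mD intf; rewrite fineK//; exact: integrable_fin_num. Qed.

Lemma fine_integral d (T : measurableType d) (R : realType)
    (m : {measure set T -> \bar R}) (D : set T) (g : T -> \bar R) : measurable D ->
  m.-integrable D g -> m.-integrable D (EFin \o (fine \o g)) /\
  (\int[m]_(x in D) (fine (g x))%:E = \int[m]_(x in D) g x)%E.
Proof.
move=> mD intg; have mg := measurable_int _ intg.
have mfg : measurable_fun D (EFin \o (fine \o g)).
  by apply/measurable_EFinP; exact: measurableT_comp.
split; last first.
  apply: ae_eq_integral => //.
  have := integrable_ae mD intg; apply: filterS => x gx Dx.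
  by rewrite fineK// gx.
apply: (le_integrable mD mfg _ intg) => x _ /=.
by case: (g x) => //= *; rewrite ?normr0 ?leey.
Qed.

(** * Fubini's theorem for real-valued integrals *)

Section Rfubini.
Context d1 d2 (T1 : measurableType d1) (T2 : measurableType d2) (R : realType).
Variables (m1 : {sigma_finite_measure set T1 -> \bar R}).
Variables (m2 : {sigma_finite_measure set T2 -> \bar R}).
Implicit Types f : T1 * T2 -> R.

Lemma integrable_fubini_G (f : T1 * T2 -> \bar R) : (m1 \x m2)%E.-integrable setT f ->
  m2.-integrable setT (fubini_G m1 f).
Proof.
move=> intf; have mf := measurable_int _ intf.
apply/integrableP; split; first exact: (measurable_fubini_G intf).
apply: le_lt_trans ((integrable21ltyP m1 m2 mf).1 intf).
apply: ge0_le_integral => //.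
- by apply: measurableT_comp => //; exact: (measurable_fubini_G intf).
- apply: (@measurable_fun_fubini_tonelli_G _ _ _ _ _ m1 (fun z => `|f z|%E)) => //.
  exact: measurableT_comp.
- by move=> y _; exact: (le_abse_integral m1 measurableT (measurable_fun_pair1 y mf)).
Qed.

Lemma Rfubini f : (m1 \x m2)%E.-integrable setT (EFin \o f) ->
  m1.-integrable setT (EFin \o (fun x => \int[m2]_y f (x, y))) /\
  \int[m1]_x (\int[m2]_y f (x, y)) = \int[m2]_y (\int[m1]_x f (x, y)).
Proof.
move=> intf; have [iF eF] := fine_integral measurableT (integrable_fubini_F intf).
have [iG eG] := fine_integral measurableT (integrable_fubini_G intf).
split; first exact: iF.
rewrite /Rintegral; congr fine; rewrite -/(fubini_F _ _) .
transitivity (\int[m1]_x (fubini_F m2 (EFin \o f)) x)%E; first by rewrite -eF.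
transitivity (\int[m2]_y (fubini_G m1 (EFin \o f)) y)%E; last by rewrite -eG.
exact: Fubini.
Qed.

Lemma product_integrable21 f (V : T2 -> R) : measurable_fun setT f ->
  m2.-integrable setT (EFin \o V) ->
  (forall y, (\int[m1]_x `|f (x, y)|%:E <= (V y)%:E)%E) ->
  (m1 \x m2)%E.-integrable setT (EFin \o f).
Proof.
move=> mf iV fV.
have mEf : measurable_fun setT (EFin \o f) by exact/measurable_EFinP.
apply/integrable21ltyP => //.
have := integrable_lty measurableT iV; apply: le_lt_trans.
apply: ge0_le_integral => //.
- by move=> y _; exact: integral_ge0.
- apply: (@measurable_fun_fubini_tonelli_G _ _ _ _ _ m1 (fun z => `|f z|%:E)) => //.
  by apply/measurable_EFinP; exact: measurableT_comp.
- exact: measurable_int iV.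
- by move=> y _; exact: fV.
Qed.

End Rfubini.

Section smooth_ftc.
Context {R : realType} {n : nat}.
Local Notation e_ i := (delta_mx 0 i : 'rV[R]_n).

Lemma smooth_derive_line (theta : 'rV[R]_n -> R) i (y : 'rV[R]_n) (s : R) : smooth theta ->
  is_derive s (1 : R) (fun s => theta (s *: e_ i + y)) (partial i theta (s *: e_ i + y)).
Proof. by move=> stheta; apply/is_derive_line; exact: smooth_is_derive. Qed.

Lemma smooth_continuous_line (theta : 'rV[R]_n -> R) i (y : 'rV[R]_n) : smooth theta ->
  continuous (fun s : R => theta (s *: e_ i + y)).
Proof.
move=> stheta s; apply: differentiable_continuous; apply/derivable1_diffP.
exact: (@ex_derive _ _ _ _ _ _ _ (smooth_derive_line i y s stheta)).
Qed.

Lemma smooth_ftc (theta : 'rV[R]_n -> R) i (y : 'rV[R]_n) (t : R) : smooth theta -> 0 < t ->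
  \int[lebesgue_measure]_(s in `[0, t]) partial i theta (s *: e_ i + y) =
  theta (t *: e_ i + y) - theta y.
Proof.
move=> stheta t0.
pose F (s : R) := theta (s *: e_ i + y).
have := @continuous_FTC2 R (fun s => partial i theta (s *: e_ i + y)) F 0 t t0.
rewrite /Rintegral => ->.
- by rewrite /F scale0r add0r.
- apply: continuous_subspaceT => s.
  by apply: smooth_continuous_line; exact: smooth_partial.
- split; first by move=> s _; exact: (@ex_derive _ _ _ _ _ _ _ (smooth_derive_line i y s stheta)).
    by apply: cvg_at_right_filter; exact: smooth_continuous_line.
  by apply: cvg_at_left_filter; exact: smooth_continuous_line.
- move=> s _; rewrite derive1E.
  exact: (@derive_val _ _ _ _ _ _ _ (smooth_derive_line i y s stheta)).
Qed.

End smooth_ftc.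

Section Rfubini_mul.
Context d1 d2 (T1 : measurableType d1) (T2 : measurableType d2) (R : realType).
Variables (m1 : {sigma_finite_measure set T1 -> \bar R}).
Variables (m2 : {sigma_finite_measure set T2 -> \bar R}).
Implicit Types f : T1 * T2 -> R.

Lemma ae_eq_Rintegral d (T : measurableType d) (m : {measure set T -> \bar R}) (f g : T -> R) :
  measurable_fun setT f -> measurable_fun setT g ->
  {ae m, forall x, f x = g x} -> \int[m]_x f x = \int[m]_x g x.
Proof.
move=> mf mg fg; rewrite /Rintegral; congr fine; apply: ae_eq_integral => //.
- exact/measurable_EFinP.
- exact/measurable_EFinP.
- by apply: filterS fg => x -> _.
Qed.

Lemma Rfubini2 f : (m1 \x m2)%E.-integrable setT (EFin \o f) ->
  m2.-integrable setT (EFin \o (fun y => \int[m1]_x f (x, y))).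
Proof. by move=> /integrable_fubini_G/fine_integral[]. Qed.

Lemma Rfubini_mul f (h : T1 -> R) (M : R) :
  (m1 \x m2)%E.-integrable setT (EFin \o f) ->
  measurable_fun setT h -> (forall x, `|h x| <= M) ->
  \int[m1]_x (h x * (\int[m2]_y f (x, y))) = \int[m2]_y (\int[m1]_x (h x * f (x, y))).
Proof.
move=> intf mh hM.
have inthf : (m1 \x m2)%E.-integrable setT (EFin \o (fun z => h z.1 * f z)).
  by apply: (intgMb measurableT (M := M)) => //; exact: measurableT_comp.
have [i1 <-] := Rfubini inthf; have [i2 _] := Rfubini intf.
(* The factor [h x] leaves the inner integral only when the section at [x] is integrable, that is,
   for almost every [x]. *)
apply: ae_eq_Rintegral; last 1 first.
- have := ae_integrable1 intf; apply: filterS => x ix.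
  by rewrite -RintegralZl.
- by apply: measurable_funM => //; exact: (intg_measurable i2).
- exact: (intg_measurable i1).
Qed.

End Rfubini_mul.

Lemma measurable_sgr (R : realType) : measurable_fun setT (Num.sg : R -> R).
Proof.
rewrite (_ : Num.sg = fun x : R => x * `|x|^-1).
  apply: measurable_funM => //.
  exact: (measurableT_comp (@measurable_invr R) (@normr_measurable R setT)).
apply/funext => x; have [->|x0] := eqVneq x 0; first by rewrite sgr0 mul0r.
by rewrite {2}[x]numEsg mulfK// normr_eq0.
Qed.

(** * Difference quotients and the chain rule *)

Section difference_quotient.
Context {R : realType} {n : nat}.
Local Notation mu := (@lebesgue_rV R n).
Local Notation leb := (@lebesgue_measure R).
Local Notation e_ i := (delta_mx 0 i : 'rV[R]_n).
Local Notation intg f := (mu.-integrable setT (EFin \o f)).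
Implicit Types (f g U G rho phi : 'rV[R]_n -> R).

(** Orthogonality extends from smooth functions to bounded Borel ones, among which is the sign of
    [rho]. *)
Lemma smooth_orthogonal rho : intg rho ->
  (forall psi, smooth psi -> (forall x, 0 <= psi x <= 1) -> \int[mu]_x (rho x * psi x) = 0) ->
  \int[mu]_x `|rho x| = 0.
Proof.
move=> irho H; have mrho := intg_measurable irho.
pose P (b : 'rV[R]_n -> R) := [/\ measurable_fun setT b, exists M, forall x, `|b x| <= M &
  \int[mu]_x (rho x * b x) = 0].
have iM (b : 'rV[R]_n -> R) : measurable_fun setT b -> (exists M, forall x, `|b x| <= M) ->
    intg (fun x => rho x * b x).
  move=> mb [M bM]; under eq_fun do rewrite mulrC.
  exact: (intgMb measurableT (M := M)).
suff [_ _] : P (fun x => Num.sg (rho x)).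
  by move=> <-; apply: eq_Rintegral => x _; rewrite normrEsg mulrC.
apply: (smooth_monotone_class (P := P) _ _ _ (M := 1)).
- move=> psi spsi psi01; split; last exact: H.
    by apply: continuous_rV_measurable; exact: smooth_continuous.
  by exists 1 => x; have /andP[p0 p1] := psi01 x; rewrite ger0_norm.
- move=> a f g [mf [F fF] f0] [mg [G gG] g0]; split.
  + by apply: measurable_funD => //; exact: measurable_funM.
  + exists (`|a| * F + G) => x; rewrite (le_trans (ler_normD _ _))// lerD// normrM.
    by rewrite ler_wpM2l.
  + transitivity (\int[mu]_x (a * (rho x * f x) + rho x * g x)).
      by apply: eq_Rintegral => x _; ring.
    have irf : intg (fun x => rho x * f x) by apply: iM => //; exists F.
    have irg : intg (fun x => rho x * g x) by apply: iM => //; exists G.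
    rewrite RintegralD//; last exact: intgZ.
    by rewrite RintegralZl// f0 g0 mulr0 addr0.
- move=> f_ f F Pf fF cvf; split.
  + by apply: (measurable_fun_cvg (h := f_)) => // k; have [] := Pf k.
  + exists F => x; rewrite -(cvg_lim _ (cvg_norm (cvf x)))//.
    by apply: limr_le; [exact: cvgP (cvg_norm (cvf x))|exact: nearW].
  + have [||||_ _ h] := @Rdominated_convergence _ _ R mu setT
       (fun k x => rho x * f_ k x) (fun x => rho x * f x) (fun x => F * `|rho x|) measurableT.
    * by move=> k; apply: measurable_funM => //; have [] := Pf k.
    * exact/intgZ/intg_norm.
    * by move=> k x _; rewrite normrM mulrC ler_wpM2r.
    * by move=> x _; apply: cvgM => //; exact: cvg_cst.
    have E0 : (fun k => \int[mu]_x (rho x * f_ k x)) = fun=> 0.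
      by apply/funext => k; have [] := Pf k.
    by move: h; rewrite E0 => h; exact: (cvg_unique _ h (cvg_cst _)).
- exact: (measurableT_comp (@measurable_sgr R)).
- by move=> x; rewrite normr_sg; case: (_ != 0).
Qed.

Lemma test_function_bounded (Omega : set 'rV[R]_n) phi : test_function Omega phi ->
  exists2 M, 0 <= M & forall x, `|phi x| <= M.
Proof.
move=> /test_functionP[sphi [K [cK _ phiK]]].
have : compact (phi @` K).
  apply: continuous_compact => //; apply: continuous_subspaceT.
  exact: smooth_continuous.
move=> /compact_bounded[C [_ /(_ (Num.max 0 C + 1))]].
have CC : C < Num.max 0 C + 1 by rewrite ltr_pwDr// le_max lexx orbT.
have C0 : 0 <= Num.max 0 C + 1 by rewrite addr_ge0// le_max lexx.
move=> /(_ CC) h; exists (Num.max 0 C + 1) => // x.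
have [Kx|/phiK ->] := pselect (K x); last by rewrite normr0.
by apply: h; exists x.
Qed.

Lemma test_function_partial (Omega : set 'rV[R]_n) phi i : test_function Omega phi ->
  test_function Omega (partial i phi).
Proof.
move=> /test_functionP[sphi [K [cK KO phiK]]]; apply/test_functionP; split.
  exact: smooth_partial.
exists K; split => // x Kx; rewrite /partial.
transitivity ('D_(e_ i) (cst 0 : 'rV[R]_n -> R) x); last exact: derive_cst.
apply: near_eq_derive.
have : nbhs x (~` K).
  apply: open_nbhs_nbhs; split => //; apply: closed_openC.
  by apply: compact_closed => //; exact: norm_hausdorff.
by apply: filterS => y /phiK.
Qed.

End difference_quotient.

(** * L^1 differentiability along a coordinate direction *)

Section difference_lemma.
Context {R : realType} {n : nat}.
Local Notation mu := (@lebesgue_rV R n).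
Local Notation leb := (@lebesgue_measure R).
Local Notation e_ i := (delta_mx 0 i : 'rV[R]_n).
Local Notation intg f := (mu.-integrable setT (EFin \o f)).
Variables (i : 'I_n) (U G phi : 'rV[R]_n -> R) (t M W : R).
Hypotheses (iU : intg U) (iG : intg G) (tphi : test_function setT phi).
Hypotheses (t0 : 0 < t) (phiM : forall x, `|phi x| <= M).
(* G is the weak i-th derivative of U near the support of phi. *)
Hypothesis UG : forall psi r, smooth psi -> 0 <= r <= t ->
  \int[mu]_x (U x * partial i (fun y => phi y * psi y) (x - r *: e_ i)) =
  - \int[mu]_x (G x * (phi (x - r *: e_ i) * psi (x - r *: e_ i))).
Hypothesis GW : forall r, 0 <= r <= t -> \int[mu]_x `|G (x + r *: e_ i) - G x| <= W.

Let ind (s : R) : R := \1_(`[0, t]%classic) s.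

Let mind : measurable_fun setT ind.
Proof. exact: measurable_indic. Qed.

Let iind : leb.-integrable setT (EFin \o ind).
Proof.
apply: intg_indic; first exact: measurable_itv.
by rewrite [ltLHS](lebesgue_measure_itv `[0, t])/= lte_fin t0 -EFinB ltry.
Qed.

Let int_ind : \int[leb]_s ind s = t.
Proof.
rewrite /Rintegral integral_indic// setIT.
rewrite [X in fine X](lebesgue_measure_itv `[0, t])/= lte_fin t0.
by rewrite oppr0 addr0.
Qed.

Let indP (s : R) : ind s != 0 -> 0 <= s <= t.
Proof.
rewrite /ind indicE; have [|] := boolP (s \in _); last by rewrite eqxx.
by rewrite inE/= in_itv/=.
Qed.

Let mline (c : R) : measurable_fun setT
  (fun z : 'rV[R]_n * R => z.1 + (c - z.2) *: e_ i).
Proof.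
apply: measurable_fun_rV => j.
rewrite (_ : (fun z => _) = fun z : 'rV[R]_n * R => z.1 0 j + (c - z.2) * e_ i 0 j).
  apply: measurable_funD.
    exact: (measurableT_comp (measurable_coord j)).
  apply: measurable_funM; last exact: measurable_cst.
  by apply: measurable_funB => //; exact: measurable_snd.
by apply/funext => z; rewrite !mxE.
Qed.

Let mline' : measurable_fun setT
  (fun z : 'rV[R]_n * R => z.2 *: e_ i + (z.1 - t *: e_ i)).
Proof.
have := measurableT_comp (measurable_rV_shift (- (t *: e_ i))) (@mline 0).
rewrite (_ : _ \o _ = fun z : 'rV[R]_n * R => z.1 + (0 - z.2) *: e_ i - t *: e_ i)//.
move=> _.
apply: measurable_fun_rV => j.
rewrite (_ : (fun z => _) = fun z : 'rV[R]_n * R => z.2 * e_ i 0 j + (z.1 0 j - t * e_ i 0 j)).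
  apply: measurable_funD.
    by apply: measurable_funM; [exact: measurable_snd|exact: measurable_cst].
  apply: measurable_funB; last exact: measurable_cst.
  exact: (measurableT_comp (measurable_coord j)).
by apply/funext => z; rewrite !mxE.
Qed.

Let mG := intg_measurable iG.
Let mU := intg_measurable iU.
Let sphi : smooth phi. Proof. by case: tphi. Qed.
Let mphi : measurable_fun setT phi.
Proof. by apply: continuous_rV_measurable; exact: smooth_continuous. Qed.

(** The shift is [t - s] because the argument of the test function will travel from [x - t *: e_ i]
    at s = 0 to [x] at s = t. *)
Let k (z : 'rV[R]_n * R) : R := ind z.2 * (G (z.1 + (t - z.2) *: e_ i) - G z.1).

Let mk : measurable_fun setT k.
Proof.
apply: measurable_funM; first exact: (measurableT_comp mind).
apply: measurable_funB; first exact: (measurableT_comp mG (@mline t)).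
exact: (measurableT_comp mG).
Qed.

Let iGs r := integrable_rV_shift (r *: e_ i) iG.

Let kW s : (\int[mu]_x `|k (x, s)|%:E <= (ind s * W)%:E)%E.
Proof.
have iGG := intg_norm (intgB measurableT (iGs (t - s)) iG).
have ind0 : 0 <= ind s by rewrite /ind indicE.
rewrite /k /=; under eq_integral do rewrite normrM ger0_norm//.
rewrite -(EFin_Rintegral measurableT); last exact: intgZ.
rewrite lee_fin RintegralZl//.
have [->|s0] := eqVneq (ind s) 0; first by rewrite !mul0r.
rewrite ler_wpM2l// GW//; have /andP[s1 s2] := indP s0.
by rewrite subr_ge0 s2 lerBlDr lerDl.
Qed.

Let ik : (mu \x leb)%E.-integrable setT (EFin \o k).
Proof.
apply: (@product_integrable21 _ _ _ _ R mu leb k (fun s => W * ind s) mk); first exact: intgZ.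
by move=> s; rewrite mulrC; exact: kW.
Qed.

Let J x := \int[leb]_s k (x, s).

Let iJ : intg J. Proof. by have [] := Rfubini ik. Qed.

(** [t * G x + J x] is the integral of [G] over the segment from [x] to [x + t *: e_ i], so the
    vanishing of [rho] is the fundamental theorem of calculus for a weakly differentiable
    function. *)
Let rho x := U (x + t *: e_ i) - U x - t * G x - J x.

Let iUs := integrable_rV_shift (t *: e_ i) iU.

Let irho : intg rho.
Proof.
apply: intgB => //; apply: intgB => //; last exact: intgZ.
exact: intgB.
Qed.

(** Fubini moves the fundamental theorem onto the smooth function [theta]. The double integral of
    U(x) d_i theta (x - (t - s) e_i) over s in [0, t] yields, integrated in s first, differences of
    [theta], hence of [U] after a translation; integrated in x first, it yields translates of
    [G]. *)
Let rho_orthogonal psi : smooth psi -> \int[mu]_x (rho x * phi x * psi x) = 0.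
Proof.
move=> spsi; pose theta x := phi x * psi x.
have ttheta : test_function setT theta by exact: test_functionM.
have stheta : smooth theta by case: ttheta.
have [C0 _ thetaC] := test_function_bounded ttheta.
have [C1 C10 dthetaC] := test_function_bounded (test_function_partial i ttheta).
have mtheta : measurable_fun setT theta.
  by apply: continuous_rV_measurable; exact: smooth_continuous.
have mdtheta : measurable_fun setT (partial i theta).
  by apply: continuous_rV_measurable; apply: smooth_continuous; exact: smooth_partial.
have iMtheta f : intg f -> intg (fun x => theta x * f x).
  by move=> intf; apply: (intgMb measurableT (M := C0)).
have mthetas (c : 'rV[R]_n) : measurable_fun setT (fun x : 'rV[R]_n => theta (x + c)).
  exact: (measurableT_comp mtheta (measurable_rV_shift c)).
have iMthetas (c : 'rV[R]_n) f : intg f -> intg (fun x : 'rV[R]_n => theta (x + c) * f x).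
  by move=> intf; apply: (intgMb measurableT (M := C0)).
pose f1 (z : 'rV[R]_n * R) := U z.1 *
  (partial i theta (z.2 *: e_ i + (z.1 - t *: e_ i)) * ind z.2).
have mf1 : measurable_fun setT f1.
  apply: measurable_funM; first exact: (measurableT_comp mU).
  apply: measurable_funM; first exact: (measurableT_comp mdtheta mline').
  exact: (measurableT_comp mind).
have if1 : (mu \x leb)%E.-integrable setT (EFin \o f1).
  apply: (@product_integrable21 _ _ _ _ R mu leb f1
    (fun s => C1 * (\int[mu]_x `|U x|) * ind s) mf1); first exact: intgZ.
  move=> s; have ind0 : 0 <= ind s by rewrite /ind indicE.
  rewrite [X in (_ <= X%:E)%E](_ : _ = (C1 * ind s) * \int[mu]_x `|U x|); last by ring.
  have inU := intg_norm iU.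
  rewrite -RintegralZl// (EFin_Rintegral measurableT); last exact: intgZ.
  apply: ge0_le_integral => //.
  - apply/measurable_EFinP; apply: measurableT_comp => //.
    exact: (measurable_fun_pair1 s mf1).
  - exact: (measurable_int _ (intgZ measurableT (C1 * ind s) inU)).
  - move=> x _; rewrite lee_fin /f1/= !normrM (ger0_norm ind0) mulrC.
    by rewrite ler_wpM2r// ler_wpM2r.
(* inner integral of f1 in s: the fundamental theorem of calculus *)
have E1 x : \int[leb]_s f1 (x, s) = U x * (theta x - theta (x - t *: e_ i)).
  have := smooth_ftc i (x - t *: e_ i) stheta t0.
  rewrite [t *: _ + _]addrC subrK => <-.
  rewrite [in RHS]Rintegral_mkcond -RintegralZl//.
    apply: eq_Rintegral => s _; rewrite /f1/= /patch /ind indicE; congr (_ * _).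
    by case: ifP; rewrite ?mulr1 ?mulr0.
  rewrite (_ : EFin \o _ = EFin \o (fun s => partial i theta (s *: e_ i + (x - t *: e_ i)) * ind s)).
    apply: (intgMb measurableT (M := C1)) iind _ _ => //.
    have := measurable_fun_pair2 x (measurableT_comp mdtheta mline'); exact.
  apply/funext => s; rewrite /= /patch /ind indicE.
  by case: ifP; rewrite ?mulr1 ?mulr0.
(* inner integral of f1 in x: the weak derivative *)
have E2 s : \int[mu]_x f1 (x, s) =
    - (ind s * \int[mu]_x (theta x * G (x + (t - s) *: e_ i))).
  have [s0|s0] := eqVneq (ind s) 0.
    rewrite s0 mul0r oppr0 /f1 /= s0; under eq_Rintegral do rewrite !mulr0.
    by rewrite Rintegral_cst// mul0r.
  have /andP[s1 s2] := indP s0.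
  have ts : 0 <= t - s <= t by rewrite subr_ge0 s2 lerBlDr lerDl.
  transitivity (ind s * \int[mu]_x (U x * partial i theta (x - (t - s) *: e_ i))).
    rewrite -RintegralZl//.
      apply: eq_Rintegral => x _; rewrite /f1/= [RHS]mulrC -mulrA; congr (_ * (partial i theta _ * _)).
      by rewrite scalerBl opprB addrCA addrC.
    under eq_fun do rewrite /= mulrC.
    apply: (intgMb measurableT (M := C1)) => //.
    exact: (measurableT_comp mdtheta (measurable_rV_shift _)).
  rewrite UG// mulrN; congr (- (_ * _)).
  rewrite -(Rintegral_rV_shift ((t - s) *: e_ i)).
    by apply: eq_Rintegral => x _; rewrite addrK mulrC.
  by under eq_fun do rewrite /= mulrC; exact: iMthetas.
have iE2 := Rfubini2 if1.
have [iE1 fub1] := Rfubini if1.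
have E3 : \int[mu]_x (theta x * J x) = - (\int[leb]_s \int[mu]_x f1 (x, s)) -
    t * \int[mu]_x (theta x * G x).
  rewrite /J (Rfubini_mul ik mtheta thetaC).
  transitivity (\int[leb]_s ((-1) * (\int[mu]_x f1 (x, s)) -
      (\int[mu]_x (theta x * G x)) * ind s)).
    apply: eq_Rintegral => s _; rewrite E2 mulN1r opprK [X in _ - X]mulrC -mulrBr.
    rewrite -RintegralB//; [|exact: iMtheta|exact: iMtheta].
    rewrite -RintegralZl//; last by apply: intgB => //; exact: iMtheta.
    by apply: eq_Rintegral => x _; rewrite /k/= -mulrBr mulrCA.
  rewrite RintegralB//; [|exact: intgZ|exact: intgZ].
  by rewrite !RintegralZl// int_ind mulN1r [t * _]mulrC.
have E4 : \int[mu]_x (theta x * (U (x + t *: e_ i) - U x)) = - (\int[leb]_s \int[mu]_x f1 (x, s)).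
  rewrite -fub1; under [in RHS]eq_Rintegral do rewrite E1.
  under eq_Rintegral do rewrite mulrBr.
  rewrite RintegralB//; [|exact: iMtheta|exact: iMtheta].
  under [in RHS]eq_Rintegral do rewrite mulrBr ![U _ * _]mulrC.
  rewrite RintegralB//; [|exact: iMtheta|exact: iMthetas].
  rewrite opprB; congr (_ - _).
  rewrite -[RHS](Rintegral_rV_shift (t *: e_ i)); last exact: iMthetas.
  by apply: eq_Rintegral => x _; rewrite addrK.
transitivity (\int[mu]_x (theta x * (U (x + t *: e_ i) - U x) - t * (theta x * G x) -
    theta x * J x)).
  by apply: eq_Rintegral => x _; rewrite /rho /theta; ring.
have i1 : intg (fun x => theta x * (U (x + t *: e_ i) - U x)).
  by apply: iMtheta; exact: intgB.
have i2 : intg (fun x => t * (theta x * G x)) by apply: intgZ => //; exact: iMtheta.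
have i3 : intg (fun x => theta x * J x) by exact: iMtheta.
rewrite RintegralB//; last exact: intgB.
rewrite RintegralB// RintegralZl//; last exact: iMtheta.
by rewrite E4 E3; ring.
Qed.

(** [rho * phi] vanishes almost everywhere, so only [J] remains. By Tonelli its L^1 norm is at most
    the average over s of the translation errors of [G], that is, [t * W]. *)
Lemma difference_le :
  \int[mu]_x (`|U (x + t *: e_ i) - U x - t * G x| * `|phi x|) <= M * (t * W).
Proof.
have M0 : 0 <= M by exact: le_trans (phiM 0).
have irhophi : intg (fun x => rho x * phi x).
  by under eq_fun do rewrite /= mulrC; apply: (intgMb measurableT (M := M)).
have rho0 := smooth_orthogonal irhophi (fun psi sp _ => rho_orthogonal sp).
have nrho := intg_norm irhophi.
have nJ := intg_norm iJ.
have iD : intg (fun x => U (x + t *: e_ i) - U x - t * G x).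
  by apply: intgB => //; [exact: intgB|exact: intgZ].
have : \int[mu]_x (`|U (x + t *: e_ i) - U x - t * G x| * `|phi x|) <=
    \int[mu]_x (`|rho x * phi x| + M * `|J x|).
  apply: le_Rintegral => //.
  - under eq_fun do rewrite /= mulrC.
    apply: (intgMb measurableT (M := M)); first exact: intg_norm.
      exact: measurableT_comp.
    by move=> x _; rewrite normr_id.
  - by apply: intgD => //; exact: intgZ.
  - move=> x _; rewrite (_ : U _ - U x - t * G x = rho x + J x); last by rewrite /rho subrK.
    rewrite (le_trans (ler_wpM2r _ (ler_normD _ _)))// mulrDl normrM lerD2l.
    by rewrite mulrC ler_wpM2r.
move=> /le_trans; apply.
rewrite RintegralD//; last exact: intgZ.
rewrite rho0 add0r RintegralZl// ler_wpM2l//.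
rewrite -lee_fin (EFin_Rintegral measurableT)//.
apply: (@le_trans _ _ (\int[mu]_x (\int[leb]_s `|k (x, s)|%:E))%E).
  apply: ge0_le_integral => //.
  - exact: (measurable_int _ nJ).
  - apply: (@measurable_fun_fubini_tonelli_F _ _ _ _ _ leb (fun z => `|k z|%:E)) => //.
    by apply/measurable_EFinP; exact: measurableT_comp.
  - move=> x _; apply: (@le_trans _ _ `|\int[leb]_s (k (x, s))%:E|%E).
      by rewrite /J /Rintegral; case: (integral _ _ _) => //= *; rewrite ?normr0 ?leey.
    apply: le_abse_integral => //; apply/measurable_EFinP.
    exact: (measurable_fun_pair2 x mk).
rewrite (@fubini_tonelli _ _ _ _ _ mu leb (fun z => `|k z|%:E)) => //.
- apply: (@le_trans _ _ (\int[leb]_s (W * ind s)%:E)%E).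
    apply: ge0_le_integral => //.
    + by move=> s _; exact: integral_ge0.
    + apply: (@measurable_fun_fubini_tonelli_G _ _ _ _ _ mu (fun z => `|k z|%:E)) => //.
      by apply/measurable_EFinP; exact: measurableT_comp.
    + exact: (measurable_int _ (intgZ measurableT W iind)).
    + by move=> s _; rewrite mulrC; exact: kW.
  rewrite -(EFin_Rintegral measurableT); last exact: intgZ.
  by rewrite RintegralZl// int_ind mulrC.
- by apply/measurable_EFinP; exact: measurableT_comp.
Qed.

End difference_lemma.

(** * Primitives of bounded Borel functions *)

Section primitive.
Context {R : realType}.
Local Notation leb := (@lebesgue_measure R).
Implicit Types (h : R -> R) (x y : R).

(** The oriented integral of [h] from 0 to [t]: depending on the sign of [t], one of the two
    intervals is empty, and at t = 0 the terms cancel. *)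
Definition prim h (t : R) : R :=
  \int[leb]_(s in `[0, t]) h s - \int[leb]_(s in `[t, 0]) h s.

Lemma bounded_itv_integrable h (M : R) x y : measurable_fun setT h ->
  (forall s, `|h s| <= M) -> leb.-integrable `[x, y] (EFin \o h).
Proof.
move=> mh hM; apply: measurable_bounded_integrable => //.
- rewrite [ltLHS](lebesgue_measure_itv `[x, y])/=.
  by case: ifP => _; rewrite -?EFinB ltry.
- exact: (measurable_funTS mh).
- exists M; split; first exact: num_real.
  by move=> N MN s _; rewrite /= (le_trans (hM s))// ltW.
Qed.

Lemma prim0 h : prim h 0 = 0.
Proof. by rewrite /prim subrr. Qed.

Lemma Rintegral_itv_split h (M : R) x y z : measurable_fun setT h ->
  (forall s, `|h s| <= M) -> x <= y -> y <= z ->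
  \int[leb]_(s in `[x, z]) h s = \int[leb]_(s in `[x, y]) h s + \int[leb]_(s in `[y, z]) h s.
Proof.
move=> mh hM xy yz; have ih a b := bounded_itv_integrable a b mh hM.
have := @Rintegral_itvB R h (BLeft x) (BRight z) y (ih x z).
rewrite !bnd_simp => /(_ xy yz) /eqP; rewrite subr_eq addrC => /eqP ->.
rewrite Rintegral_itv_obnd_cbnd//.
by apply: integrableS (ih y z) => //; apply: subset_itvr; rewrite bnd_simp.
Qed.

Lemma Rintegral_itv_point h x : \int[leb]_(s in `[x, x]) h s = 0.
Proof. by rewrite set_itv1 Rintegral_set1. Qed.

Lemma Rintegral_itv_empty h x y : y < x -> \int[leb]_(s in `[x, y]) h s = 0.
Proof. by move=> yx; rewrite set_itv_ge ?Rintegral_set0// bnd_simp -ltNge. Qed.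

Lemma primB h (M : R) x y : measurable_fun setT h -> (forall s, `|h s| <= M) -> x <= y ->
  prim h y - prim h x = \int[leb]_(s in `[x, y]) h s.
Proof.
move=> mh hM xy; rewrite /prim.
have S := Rintegral_itv_split mh hM.
have [x0|x0] := leP 0 x.
  have E z : 0 <= z -> \int[leb]_(s in `[z, 0]) h s = 0.
    by rewrite le_eqVlt => /predU1P[<-|/Rintegral_itv_empty//]; exact: Rintegral_itv_point.
  by rewrite !E ?(le_trans x0 xy)// (S 0 x y)//; ring.
rewrite (Rintegral_itv_empty h x0).
have [y0|y0] := leP 0 y.
  have -> : \int[leb]_(s in `[y, 0]) h s = 0.
    by move: y0; rewrite le_eqVlt => /predU1P[<-|/Rintegral_itv_empty//]; exact: Rintegral_itv_point.
  by rewrite (S x 0 y) ?(ltW x0)//; ring.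
by rewrite (Rintegral_itv_empty h y0) (S x y 0) ?(ltW y0)//; ring.
Qed.

Lemma Rintegral_itv_cst (c x y : R) : x <= y -> \int[leb]_(s in `[x, y]) c = c * (y - x).
Proof.
move=> xy; rewrite Rintegral_cst; last exact: measurable_itv.
congr (_ * _); rewrite [X in fine X](lebesgue_measure_itv `[x, y])/= lte_fin.
by move: xy; rewrite le_eqVlt => /predU1P[->|->//]; rewrite ltxx subrr.
Qed.

Lemma prim_lipschitz h (M : R) x y : measurable_fun setT h -> (forall s, `|h s| <= M) ->
  `|prim h y - prim h x| <= M * `|y - x|.
Proof.
move=> mh hM; wlog xy : x y / x <= y.
  have [xy|yx] := leP x y; first exact.
  by rewrite distrC [`|y - x|]distrC; apply; exact: ltW.
rewrite (primB mh hM xy) (ger0_norm (_ : 0 <= y - x)) ?subr_ge0// -(Rintegral_itv_cst M xy).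
have ih := bounded_itv_integrable x y mh hM.
apply: (le_trans (le_normr_Rintegral _ ih)); first exact: measurable_itv.
apply: le_Rintegral => //; first exact: integrable_norm.
by apply: (@bounded_itv_integrable (fun=> M) `|M|).
Qed.

(** Between [x] and [y], [h] stays within C |y - x| of [h x]. This is the regularity with which the
    chain rule starts, before the passage to Borel functions. *)
Lemma prim_taylor h (M C : R) x y : measurable_fun setT h -> (forall s, `|h s| <= M) ->
  (forall s s', `|h s - h s'| <= C * `|s - s'|) -> 0 <= C ->
  `|prim h y - prim h x - h x * (y - x)| <= C * `|y - x| ^+ 2.
Proof.
move=> mh hM hC C0.
have ih a b := bounded_itv_integrable a b mh hM.
have ic (c : R) a b : leb.-integrable `[a, b] (EFin \o (fun=> c)).
  by apply: (@bounded_itv_integrable (fun=> c) `|c|).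
have aux a b (c : R) (D : R) : a <= b -> (forall s, a <= s <= b -> `|h s - c| <= D) ->
    `|\int[leb]_(s in `[a, b]) h s - c * (b - a)| <= D * (b - a).
  move=> ab hD; rewrite -!(Rintegral_itv_cst _ ab) -RintegralB//.
  have iB : leb.-integrable `[a, b] (EFin \o (fun s => h s - c)).
    by apply: (intgB _ (ih a b) (ic c a b)); exact: measurable_itv.
  apply: (le_trans (le_normr_Rintegral _ iB)); first exact: measurable_itv.
  by apply: le_Rintegral => //; exact: integrable_norm.
have [xy|yx] := leP x y.
  rewrite (primB mh hM xy) (ger0_norm (_ : 0 <= y - x)) ?subr_ge0// expr2 mulrA.
  apply: aux => // s /andP[xs sy]; rewrite (le_trans (hC _ _))// ler_wpM2l//.
  by rewrite ger0_norm ?subr_ge0// lerD2r.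
rewrite [`|y - x|]distrC (ger0_norm (_ : 0 <= x - y)) ?subr_ge0 ?(ltW yx)// expr2 mulrA.
rewrite -normrN (_ : - (prim h y - prim h x - h x * (y - x)) = (prim h x - prim h y) - h x * (x - y)); last by ring.
rewrite (primB mh hM (ltW yx)); apply: aux; first exact: ltW.
move=> s /andP[ys sx]; rewrite (le_trans (hC _ _))// ler_wpM2l//.
by rewrite distrC ger0_norm ?subr_ge0// lerD2l lerN2.
Qed.

Lemma primZD (a : R) h h' (M M' : R) t : measurable_fun setT h -> (forall s, `|h s| <= M) ->
  measurable_fun setT h' -> (forall s, `|h' s| <= M') ->
  prim (fun s => a * h s + h' s) t = a * prim h t + prim h' t.
Proof.
move=> mh hM mh' hM'; rewrite /prim.
have E x y : \int[leb]_(s in `[x, y]) (a * h s + h' s) =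
    a * \int[leb]_(s in `[x, y]) h s + \int[leb]_(s in `[x, y]) h' s.
  have ih := bounded_itv_integrable x y mh hM.
  rewrite RintegralD ?RintegralZl//; first exact: intgZ.
  exact: bounded_itv_integrable hM'.
by rewrite !E; ring.
Qed.

Lemma prim_cvg (h_ : nat -> R -> R) h (M : R) t : (forall k, measurable_fun setT (h_ k)) ->
  (forall k s, `|h_ k s| <= M) -> (forall s, h_ k s @[k --> \oo] --> h s) ->
  prim (h_ k) t @[k --> \oo] --> prim h t.
Proof.
move=> mh hM hh.
have E x y : \int[leb]_(s in `[x, y]) h_ k s @[k --> \oo] --> \int[leb]_(s in `[x, y]) h s.
  have [|||||_ _ //] := @Rdominated_convergence _ _ R leb `[x, y] h_ h (fun=> M) _.
  - exact: measurable_itv.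
  - by move=> k; exact: (measurable_funTS (mh k)).
  - by apply: (@bounded_itv_integrable (fun=> M) `|M|).
  - by move=> k s _; exact: hM.
  - by move=> s _; exact: hh.
by apply: cvgB; exact: E.
Qed.

Lemma measurable_prim h (M : R) : measurable_fun setT h -> (forall s, `|h s| <= M) ->
  measurable_fun setT (prim h).
Proof.
move=> mh hM; apply: continuous_measurable_fun => x.
have M0 : 0 <= M by exact: le_trans (hM 0).
apply/cvgrPdist_lt => e e0; near=> y.
rewrite (le_lt_trans (prim_lipschitz _ _ mh hM))//.
apply: (@le_lt_trans _ _ ((M + 1) * `|x - y|)).
  by rewrite ler_wpM2r// lerDl.
rewrite -ltr_pdivlMl ?ltr_wpDl//; near: y.
apply/nbhs_ballP; exists ((M + 1)^-1 * e) => //=.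
by rewrite mulr_gt0// invr_gt0 ltr_wpDl.
Unshelve. all: by end_near. Qed.

End primitive.

Section shift_estimates.
Context {R : realType} {n : nat}.
Local Notation mu := (@lebesgue_rV R n).
Local Notation intg f := (mu.-integrable setT (EFin \o f)).
Implicit Types (f g U G rho phi : 'rV[R]_n -> R).

(** Compactness makes the admissible size of the translation uniform over [K]. [K'] is the image of
    [K] times a segment under the translation map, hence compact. *)
Lemma compact_shift_sub (K Omega : set 'rV[R]_n) (v : 'rV[R]_n) :
  compact K -> open Omega -> K `<=` Omega ->
  exists2 d : R, 0 < d & exists K', [/\ compact K', K' `<=` Omega &
    forall x s, K x -> `|s| <= d -> K' (x + s *: v)].
Proof.
move=> cK oO KO.
pose m (z : 'rV[R]_n * R) := z.1 + z.2 *: v.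
have cm : continuous m.
  by move=> z; apply: cvgD; [exact: cvg_fst|apply: cvgZr_tmp; exact: cvg_snd].
have : \forall s \near (0 : R), K `<=` (fun x => Omega (x + s *: v)).
  apply: ((compact_near_coveringP K).1 cK R (nbhs (0 : R)) (fun s x => Omega (x + s *: v))) => x Kx.
  have : nbhs (x, 0 : R) (m @^-1` Omega).
    apply: cm; apply: open_nbhs_nbhs; split => //.
    by rewrite /m /= scale0r addr0; exact: KO.
  by [].
move=> /nbhs_ballP[e /= e0 He]; exists (e / 2); first by rewrite divr_gt0.
exists (m @` (K `*` `[- (e / 2), e / 2]%classic)); split.
- apply: continuous_compact; first exact: continuous_subspaceT.
  by apply: compact_setX => //; exact: segment_compact.
- move=> y [[x s] /= [Kx]]; rewrite in_itv/= -ler_norml => se <-.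
  apply: (He s) => //; rewrite -ball_normE/= sub0r normrN.
  by rewrite (le_lt_trans se)// ltr_pdivrMr// ltr_pMr// ltr1n.
- by move=> x s Kx se; exists (x, s) => //; split => //=; rewrite in_itv/= -ler_norml.
Qed.

(** Failing this, shifts of length at most 1 / (k + 1) with error above [e] would contradict the
    sequential statement. *)
Lemma L1_shift_eps f (v : 'rV[R]_n) (e : R) : intg f -> 0 < e ->
  exists2 d : R, 0 < d & forall r, `|r| <= d -> \int[mu]_x `|f (x + r *: v) - f x| <= e.
Proof.
move=> intf e0; apply: contrapT => H.
have H' k : exists r : R, `|r| <= k.+1%:R^-1 /\ e < \int[mu]_x `|f (x + r *: v) - f x|.
  apply: contrapT => Hk; apply: H; exists k.+1%:R^-1; first by rewrite invr_gt0.
  move=> r rk; rewrite leNgt; apply/negP => er; apply: Hk; by exists r.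
have [r_ Hr] := choice H'.
have r0 : r_ k @[k --> \oo] --> (0 : R).
  apply/norm_cvg0P; apply: (@squeeze_cvgr _ _ _ _ (fun=> 0) (fun k => k.+1%:R^-1)).
  - by apply: nearW => k; rewrite normr_ge0; have [] := Hr k.
  - exact: cvg_cst.
  - exact: cvg_harmonic.
have c0 : r_ k *: v @[k --> \oo] --> (0 : 'rV[R]_n).
  by rewrite -(scale0r v); apply: cvgZr_tmp.
have /cvgr0Pnorm_lt/(_ _ e0)[k _ /(_ k (leqnn k))] := cvg_L1_shift intf c0.
rewrite ger0_norm ?Rintegral_ge0// => /lt_trans/(_ (Hr k).2).
by rewrite ltxx.
Qed.

(** Split according to the size of [G]: where |G| > N the minimum is at most [A] and the tail of [G]
    is small; elsewhere the integrand is at most N C |d_k|. Working with integrals throughout spares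
    the extraction of almost everywhere convergent subsequences. *)
Lemma cvg_L1_weight d (T : measurableType d) (m : {measure set T -> \bar R}) (D : set T)
    (G : T -> R) (d_ : nat -> T -> R) (A C : R) : measurable D ->
  m.-integrable D (EFin \o G) -> (forall k, m.-integrable D (EFin \o d_ k)) ->
  0 <= A -> 0 <= C ->
  \int[m]_(x in D) `|d_ k x| @[k --> \oo] --> (0 : R) ->
  \int[m]_(x in D) (`|G x| * Num.min A (C * `|d_ k x|)) @[k --> \oo] --> (0 : R).
Proof.
move=> mD iG id A0 C0 d0.
have mG := intg_measurable iG.
pose E N : set T := [set x | N%:R < `|G x|].
have mE N : measurable_fun D (\1_(E N) : T -> R).
  have -> : \1_(E N) = (fun b : bool => b%:R : R) \o (fun x => N%:R < `|G x|).
    by apply/funext => x; rewrite indicE /=; congr (_%:R); congr nat_of_bool; apply/idP/idP; rewrite inE.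
  apply: (measurableT_comp (f := fun b : bool => b%:R : R)) => //.
  by apply: measurable_fun_ltr => //; exact: measurableT_comp.
have iEG N : m.-integrable D (EFin \o (fun x => \1_(E N) x * `|G x|)).
  apply: (intgMb mD (M := 1)) => //; first exact: intg_norm.
  by move=> x _; rewrite indicE; case: (_ \in _); rewrite ?normr1 ?normr0.
have [||||_ _ EG0] := @Rdominated_convergence _ _ R m D
    (fun N x => \1_(E N) x * `|G x|) (fun=> 0) (fun x => `|G x|) mD.
- by move=> N; exact: intg_measurable (iEG N).
- exact: intg_norm.
- move=> N x _; rewrite normrM normr_id ler_piMl// indicE.
  by case: (_ \in _); rewrite ?normr1 ?normr0.
- move=> x _; apply: cvg_near_cst.
  exists (Num.truncn `|G x|).+1 => // N /= GN.
  rewrite indicE memNset ?mul0r// /E/=; apply/negP; rewrite -leNgt ltW//.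
  by rewrite (lt_le_trans (truncnS_gt _))// ler_nat.
rewrite Rintegral_cst// mul0r in EG0.
apply/cvgr0Pnorm_lt => e e0.
have e2 : 0 < e / 2 / (A + 1) by rewrite !divr_gt0// ltr_wpDl.
have /cvgr0Pnorm_lt/(_ _ e2)[N _ /(_ N (leqnn N))] := EG0.
rewrite ger0_norm; last first.
  by apply: Rintegral_ge0 => x _; rewrite mulr_ge0// indicE.
move=> EN.
have e3 : 0 < e / 2 / (N%:R * C + 1) by rewrite !divr_gt0// ltr_wpDl// mulr_ge0.
have /cvgr0Pnorm_lt/(_ _ e3) := d0; apply: filterS => k.
rewrite ger0_norm ?Rintegral_ge0// => dk.
have mmin : measurable_fun D (fun x => Num.min A (C * `|d_ k x|)).
  apply: measurable_minr => //; apply: measurable_funM => //.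
  by apply: measurableT_comp => //; exact: intg_measurable (id k).
have min0 x : 0 <= Num.min A (C * `|d_ k x|) by rewrite le_min A0 mulr_ge0.
have idk := intg_norm (id k).
rewrite ger0_norm; last by apply: Rintegral_ge0 => x _; rewrite mulr_ge0.
have : \int[m]_(x in D) (`|G x| * Num.min A (C * `|d_ k x|)) <=
    \int[m]_(x in D) (A * (\1_(E N) x * `|G x|) + N%:R * C * `|d_ k x|).
  apply: le_Rintegral => //.
  - under eq_fun do rewrite /= mulrC; apply: (intgMb mD (M := A)) => //.
      exact: intg_norm.
    by move=> x _; rewrite ger0_norm// ge_min lexx.
  - by apply: intgD => //; exact: intgZ.
  - move=> x _; rewrite indicE; have [|] := boolP (x \in E N).
      rewrite inE /E/= => _; rewrite mul1r mulrC.
      rewrite (@le_trans _ _ (A * `|G x|))// ?ler_wpM2r// ?ge_min ?lexx//.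
      by rewrite lerDl !mulr_ge0.
    move=> /negP; rewrite inE /E/= => /negP; rewrite -leNgt => GN.
    rewrite mul0r mulr0 add0r -mulrA ler_pM// ge_min lexx orbT//.
move=> /le_lt_trans; apply.
rewrite RintegralD ?RintegralZl//; [|exact: intgZ|exact: intgZ].
rewrite (splitr e) ler_ltD//.
  rewrite (@le_trans _ _ ((A + 1) * (e / 2 / (A + 1))))//.
    rewrite ler_pM ?(ltW EN)//; last by rewrite lerDl.
    by apply: Rintegral_ge0 => x _; rewrite mulr_ge0// indicE.
  by rewrite mulrC divfK// gt_eqF// ltr_wpDl.
rewrite (@le_lt_trans _ _ ((N%:R * C + 1) * \int[m]_(x in D) `|d_ k x|))//.
  by rewrite ler_wpM2r ?Rintegral_ge0// lerDl.
by rewrite -ltr_pdivlMl ?ltr_wpDl ?mulr_ge0// mulrC.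
Qed.

End shift_estimates.

(** * The chain rule against a fixed test function *)

Section chain_rule.
Context {R : realType} {n : nat}.
Local Notation mu := (@lebesgue_rV R n).
Local Notation leb := (@lebesgue_measure R).
Local Notation e_ i := (delta_mx 0 i : 'rV[R]_n).
Local Notation intg f := (mu.-integrable setT (EFin \o f)).
Implicit Types (f g U G V phi psi : 'rV[R]_n -> R).

Lemma smooth_lipschitz phi i (C : R) (y : 'rV[R]_n) (t : R) : smooth phi ->
  (forall x, `|partial i phi x| <= C) -> 0 < t ->
  `|phi (t *: e_ i + y) - phi y| <= C * t.
Proof.
move=> sphi phiC t0; rewrite -(smooth_ftc i y sphi t0).
have mp : measurable_fun setT (fun s : R => partial i phi (s *: e_ i + y)).
  apply: continuous_measurable_fun; apply: smooth_continuous_line.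
  exact: smooth_partial.
have ip := @bounded_itv_integrable R (fun s : R => partial i phi (s *: e_ i + y)) C 0 t mp
  (fun s => phiC _).
apply: (le_trans (le_normr_Rintegral _ ip)); first exact: measurable_itv.
rewrite -[X in C * X]subr0 -(Rintegral_itv_cst C (ltW t0)).
apply: le_Rintegral => //; first exact: integrable_norm.
by apply: (@bounded_itv_integrable R (fun=> C) `|C|).
Qed.

(** The quotients of [phi] are bounded by the supremum of its partial derivative, so a multiple of
    |V| dominates. It lets the partial derivative of [phi] be traded for differences of [V], which
    need have no derivative. *)
Lemma cvg_difference_quotient V phi i (d : R) : 0 < d ->
  intg V -> test_function setT phi ->
  (d / k.+1%:R)^-1 * \int[mu]_x (V x * (phi (x - (d / k.+1%:R) *: e_ i) - phi x))
    @[k --> \oo] --> - \int[mu]_x (V x * partial i phi x).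
Proof.
move=> d0 iV tphi; have sphi : smooth phi by case: tphi.
have mphi : measurable_fun setT phi.
  by apply: continuous_rV_measurable; exact: smooth_continuous.
have mV := intg_measurable iV.
have [C C0 dphiC] := test_function_bounded (test_function_partial i tphi).
have [M M0 phiM] := test_function_bounded tphi.
pose t_ k := d / k.+1%:R : R.
have t0 k : 0 < t_ k by rewrite divr_gt0.
have mphis k : measurable_fun setT (fun x : 'rV[R]_n => phi (x - t_ k *: e_ i)).
  exact: (measurableT_comp mphi (measurable_rV_shift _)).
pose q k (x : 'rV[R]_n) := V x * ((t_ k)^-1 * (phi (x - t_ k *: e_ i) - phi x)).
have qC k (x : 'rV[R]_n) : `|(t_ k)^-1 * (phi (x - t_ k *: e_ i) - phi x)| <= C.
  rewrite normrM normfV (gtr0_norm (t0 k)) ler_pdivrMl// mulrC distrC.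
  have := smooth_lipschitz (x - t_ k *: e_ i) sphi dphiC (t0 k).
  by rewrite [t_ k *: _ + _]addrC subrK.
have [||||_ _] := @Rdominated_convergence _ _ R mu setT q
    (fun x => V x * - partial i phi x) (fun x => C * `|V x|) measurableT.
- move=> k; apply: measurable_funM => //; apply: measurable_funM => //.
  exact: measurable_funB.
- by apply: intgZ => //; exact: intg_norm.
- by move=> k x _; rewrite /q normrM mulrC ler_wpM2r.
- move=> x _; apply: cvgM; first exact: cvg_cst.
  have [+ dE] := smooth_is_derive i x sphi.
  rewrite /derivable => /cvg_ex[l hl].
  have lE : l = partial i phi x by rewrite -dE; apply/esym/cvg_lim.
  rewrite lE in hl.
  (* The increments [- t_ k] are nonzero, as the punctured limit demands. Dividing by [t_ k] instead
     of [- t_ k] produces the minus sign of the limit. *)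
  have t0' : - t_ k @[k --> \oo] --> (0 : R)^'.
    move=> P /= Pd; have : \forall k \near \oo, - t_ k != 0 -> P (- t_ k).
      have tc : - t_ k @[k --> \oo] --> (0 : R).
        rewrite -oppr0; apply: cvgN; rewrite -(mulr0 d).
        by apply: cvgM; [exact: cvg_cst|exact: cvg_harmonic].
      exact: tc Pd.
    by apply: filterS => k; apply; rewrite oppr_eq0 gt_eqF.
  rewrite (_ : (fun k => _) = - ((fun h : R => h^-1 *: ((phi \o shift x) (h *: e_ i) - phi x))
      \o (fun k => - t_ k))); first exact: cvgN (cvg_comp _ _ t0' hl).
  apply/funext => k; rewrite !fctE /= invrN !scaleNr opprK.
  by rewrite [- _ + x]addrC.
under eq_fun => k.
  rewrite (_ : \int[mu]_x q k x = (t_ k)^-1 * \int[mu]_x (V x * (phi (x - t_ k *: e_ i) - phi x))).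
    over.
  rewrite -RintegralZl//; first by apply: eq_Rintegral => x _; rewrite /q mulrCA.
  under eq_fun do rewrite /= mulrC.
  apply: (intgMb measurableT (M := M + M)) => //; first exact: measurable_funB.
  by move=> x _; rewrite (le_trans (ler_normB _ _))// lerD.
rewrite (_ : \int[mu]_x (V x * - partial i phi x) = - \int[mu]_x (V x * partial i phi x))//.
rewrite -mulN1r -RintegralZl//; first by apply: eq_Rintegral => x _; rewrite mulN1r mulrN.
under eq_fun do rewrite /= mulrC; apply: (intgMb measurableT (M := C)) => //.
by apply: continuous_rV_measurable; apply: smooth_continuous; exact: smooth_partial.
Qed.

Section fixed_test_function.
Variables (i : 'I_n) (U G phi : 'rV[R]_n -> R) (d : R).
Hypotheses (iU : intg U) (iG : intg G) (tphi : test_function setT phi) (d0 : 0 < d).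
Hypothesis UG : forall psi r, smooth psi -> 0 <= r <= d ->
  \int[mu]_x (U x * partial i (fun y => phi y * psi y) (x - r *: e_ i)) =
  - \int[mu]_x (G x * (phi (x - r *: e_ i) * psi (x - r *: e_ i))).

Let mU := intg_measurable iU.
Let mG := intg_measurable iG.

Let sphi : smooth phi. Proof. by case: tphi. Qed.
Let mphi : measurable_fun setT phi.
Proof. by apply: continuous_rV_measurable; exact: smooth_continuous. Qed.

Let intg_prim (h : R -> R) (M : R) : measurable_fun setT h -> (forall s, `|h s| <= M) ->
  intg (fun x => prim h (U x)).
Proof.
move=> mh hM; apply: (intg_le measurableT (g := fun x => M * `|U x|)).
- exact: measurableT_comp (measurable_prim mh hM) _.
- by move=> x _; have := prim_lipschitz 0 (U x) mh hM; rewrite prim0 !subr0.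
- by apply: intgZ => //; exact: intg_norm.
Qed.

(** After a translation the left side is, up to sign, the limit of the quotients of prim h o U
    against [phi]. Taylor's formula replaces these differences by h(U) times the difference of [U],
    and [difference_le] replaces the latter by [t_ k * G] up to an error small compared with
    [t_ k]. *)
Let chain_rule_lipschitz (h : R -> R) (M C : R) : 0 <= C -> (forall s, `|h s| <= M) ->
  (forall s s', `|h s - h s'| <= C * `|s - s'|) -> measurable_fun setT h ->
  \int[mu]_x (prim h (U x) * partial i phi x) = - \int[mu]_x (h (U x) * (G x * phi x)).
Proof.
move=> C0 hM hC mh.
have M0 : 0 <= M by exact: le_trans (hM 0).
have [Mp Mp0 phiM] := test_function_bounded tphi.
have mhU : measurable_fun setT (fun x => h (U x)) by exact: measurableT_comp mh _.
pose t_ k := d / k.+1%:R : R.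
have t0 k : 0 < t_ k by rewrite divr_gt0.
have td k : t_ k <= d by rewrite ler_piMr ?(ltW d0)// invf_le1// ler1n.
have tc : t_ k @[k --> \oo] --> (0 : R).
  by rewrite -(mulr0 d); apply: cvgM; [exact: cvg_cst|exact: cvg_harmonic].
pose V x := prim h (U x).
have iV : intg V by exact: intg_prim hM.
have cvg1 := cvg_difference_quotient (i := i) d0 iV tphi.
set b := \int[mu]_x (h (U x) * (G x * phi x)).
suff cvg2 : (d / k.+1%:R)^-1 *
    \int[mu]_x (V x * (phi (x - (d / k.+1%:R) *: e_ i) - phi x)) @[k --> \oo] --> b.
  by rewrite (cvg_unique _ cvg2 cvg1)// opprK.
pose d_ k (x : 'rV[R]_n) := U (x + t_ k *: e_ i) - U x.
have iUs k := integrable_rV_shift (t_ k *: e_ i) iU.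
have iVs k := integrable_rV_shift (t_ k *: e_ i) iV.
have id_ k : intg (d_ k) by exact: intgB.
have d_0 : \int[mu]_x `|d_ k x| @[k --> \oo] --> (0 : R).
  apply: cvg_L1_shift => //; rewrite -(scale0r (e_ i)); exact: cvgZr_tmp.
have W0 := cvg_L1_weight measurableT iG id_ (addr_ge0 M0 M0) C0 d_0.
have bphi f : intg f -> intg (fun x => f x * phi x).
  by move=> intf; under eq_fun do rewrite /= mulrC; apply: (intgMb measurableT (M := Mp)).
have iGphi := bphi _ iG.
have ihG : intg (fun x => h (U x) * G x) by apply: (intgMb measurableT (M := M)).
apply/cvgrPdist_lt => e e0.
have A0 : 0 < M *+ 3 * Mp + 1 by rewrite ltr_wpDl// mulr_ge0// mulrn_wge0.
have e1 : 0 < e / 2 / (M *+ 3 * Mp + 1) by rewrite !divr_gt0.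
have [d1 d10 Gd1] := L1_shift_eps (e_ i) iG e1.
have e2 : 0 < e / 2 / (Mp + 1) by rewrite !divr_gt0// ltr_wpDl.
have /cvgr0Pnorm_lt/(_ _ e2) W1 := W0.
have /cvgr0Pnorm_lt/(_ _ d10) tc1 := tc.
near=> k.
have tk1 : t_ k <= d1.
  have : `|t_ k| < d1 by near: k.
  by rewrite gtr0_norm// => /ltW.
have Wk : \int[mu]_x (`|G x| * Num.min (M + M) (C * `|d_ k x|)) < e / 2 / (Mp + 1).
  by apply: le_lt_trans (ler_norm _) _; near: k.
have diff := @difference_le R n i U G phi (t_ k) Mp (e / 2 / (M *+ 3 * Mp + 1)) iU iG tphi
  (t0 k) phiM.
have {}diff : \int[mu]_x (`|U (x + t_ k *: e_ i) - U x - t_ k * G x| * `|phi x|) <=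
    Mp * (t_ k * (e / 2 / (M *+ 3 * Mp + 1))).
  apply: diff.
    by move=> psi r spsi /andP[r0 rt]; apply: UG => //; rewrite r0 (le_trans rt).
  by move=> r /andP[r0 rt]; apply: Gd1; rewrite ger0_norm// (le_trans rt).
have -> : (d / k.+1%:R)^-1 * \int[mu]_x (V x * (phi (x - (d / k.+1%:R) *: e_ i) - phi x)) =
   (t_ k)^-1 * \int[mu]_x ((V (x + t_ k *: e_ i) - V x) * phi x).
  congr (_ * _); rewrite -/(t_ k).
  under eq_Rintegral do rewrite mulrBr; under [RHS]eq_Rintegral do rewrite mulrBl.
  have iVp : intg (fun x : 'rV[R]_n => V x * phi (x - t_ k *: e_ i)).
    under eq_fun do rewrite /= mulrC; apply: (intgMb measurableT (M := Mp)) => //.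
    exact: (measurableT_comp mphi (measurable_rV_shift _)).
  rewrite RintegralB//; last exact: bphi.
  rewrite RintegralB//; [|exact: bphi|exact: bphi].
  congr (_ - _); rewrite -(Rintegral_rV_shift (t_ k *: e_ i) iVp).
  by apply: eq_Rintegral => x _; rewrite addrK.
have iVd : intg (fun x : 'rV[R]_n => (V (x + t_ k *: e_ i) - V x) * phi x).
  by apply: bphi; exact: intgB.
have ihGp : intg (fun x => h (U x) * (G x * phi x)).
  by apply: (intgMb measurableT (M := M)).
have -> : b - (t_ k)^-1 * \int[mu]_x ((V (x + t_ k *: e_ i) - V x) * phi x) =
    (t_ k)^-1 * \int[mu]_x (t_ k * (h (U x) * (G x * phi x)) - (V (x + t_ k *: e_ i) - V x) * phi x).
  rewrite RintegralB//; last exact: intgZ.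
  by rewrite RintegralZl// mulrBr mulKf// gt_eqF.
have iE : intg (fun x : 'rV[R]_n => t_ k * (h (U x) * (G x * phi x)) - (V (x + t_ k *: e_ i) - V x) * phi x).
  by apply: intgB => //; exact: intgZ.
rewrite normrM normfV (gtr0_norm (t0 k)) ltr_pdivrMl//.
apply: (le_lt_trans (le_normr_Rintegral measurableT iE)).
pose D (x : 'rV[R]_n) := U (x + t_ k *: e_ i) - U x - t_ k * G x.
have iD : intg D by apply: intgB => //; [exact: intgB|exact: intgZ].
have iDp : intg (fun x => `|D x| * `|phi x|).
  under eq_fun do rewrite /= mulrC; apply: (intgMb measurableT (M := Mp)).
  - exact: intg_norm.
  - exact: measurableT_comp.
  - by move=> x _; rewrite normr_id.
have iWm : intg (fun x => `|G x| * Num.min (M + M) (C * `|d_ k x|)).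
  under eq_fun do rewrite /= mulrC; apply: (intgMb measurableT (M := M + M)).
  - exact: intg_norm.
  - apply: measurable_minr => //; apply: measurable_funM => //.
    by apply: measurableT_comp => //; exact: intg_measurable (id_ k).
  - move=> x _; rewrite ger0_norm ?ge_min ?lexx//.
    by rewrite le_min addr_ge0// mulr_ge0.
have : \int[mu]_x `|t_ k * (h (U x) * (G x * phi x)) - (V (x + t_ k *: e_ i) - V x) * phi x| <=
    \int[mu]_x (M *+ 3 * (`|D x| * `|phi x|) +
       t_ k * Mp * (`|G x| * Num.min (M + M) (C * `|d_ k x|))).
  apply: le_Rintegral => //; first exact: intg_norm.
    by apply: intgD => //; exact: intgZ.
  move=> x _.
  (* The remainder is at most 2 M |d|, as [prim h] is Lipschitz, and at most C |d|^2 by Taylor. The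
     minimum is kept because |d|^2 may fail to be integrable. *)
  have r1 : `|V (x + t_ k *: e_ i) - V x - h (U x) * d_ k x| <=
      `|d_ k x| * Num.min (M + M) (C * `|d_ k x|).
    rewrite minr_pMr// le_min; apply/andP; split.
      rewrite (le_trans (ler_normB _ _))// [leRHS]mulrDr lerD//.
        by rewrite mulrC; exact: prim_lipschitz.
      by rewrite normrM mulrC ler_wpM2l.
    by rewrite mulrCA -expr2; exact: prim_taylor.
  have dD : `|d_ k x| <= `|D x| + t_ k * `|G x|.
    rewrite -[X in X * `|G x|](gtr0_norm (t0 k)) -normrM.
    by rewrite -[X in `|X| <= _](subrK (t_ k * G x)) ler_normD.
  set m := Num.min _ _ in r1 *.
  have m0 : 0 <= m by rewrite le_min addr_ge0// mulr_ge0.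
  have mM : m <= M + M by rewrite ge_min lexx.
  rewrite (_ : t_ k * _ - _ = - ((V (x + t_ k *: e_ i) - V x - h (U x) * d_ k x) +
      h (U x) * D x) * phi x); last by rewrite /D /d_; ring.
  rewrite normrM normrN.
  (* Insert |d| <= |D| + t |G|. On the |D| part the minimum is bounded by 2 M, which with the term M
     |D| makes 3 M; on the t |G| part it is kept, and [cvg_L1_weight] makes it small. *)
  have r2 : `|V (x + t_ k *: e_ i) - V x - h (U x) * d_ k x + h (U x) * D x| <=
      M *+ 3 * `|D x| + t_ k * `|G x| * m.
    rewrite (le_trans (ler_normD _ _))// normrM.
    have h1 : `|h (U x)| * `|D x| <= M * `|D x| by rewrite ler_wpM2r.
    have h2 : `|d_ k x| * m <= `|D x| * (M + M) + t_ k * `|G x| * m.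
      rewrite (le_trans (ler_wpM2r m0 dD))// mulrDl lerD2r.
      by rewrite ler_wpM2l.
    rewrite (le_trans (lerD (le_trans r1 h2) h1))//.
    rewrite (_ : M *+ 3 * _ = `|D x| * (M + M) + M * `|D x|); last by ring.
    by rewrite addrAC.
  rewrite (le_trans (ler_wpM2r _ r2))// mulrDl -(mulrA (M *+ 3)) lerD2l.
  rewrite (_ : t_ k * Mp * _ = t_ k * `|G x| * m * Mp); last by ring.
  by rewrite ler_wpM2l// !mulr_ge0// ltW.
move=> /le_lt_trans; apply.
rewrite RintegralD//; [|exact: intgZ|exact: intgZ].
rewrite !RintegralZl//.
rewrite (splitr e) mulrDr ltr_leD//.
- apply: (@le_lt_trans _ _ (M *+ 3 * (Mp * (t_ k * (e / 2 / (M *+ 3 * Mp + 1)))))).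
    by rewrite ler_wpM2l// mulrn_wge0.
  rewrite (_ : M *+ 3 * _ = t_ k * (M *+ 3 * Mp * (e / 2) / (M *+ 3 * Mp + 1))); last by ring.
  rewrite ltr_pM2l// ltr_pdivrMr// mulrC [ltRHS]mulrDr mulr1 ltrDl divr_gt0//.
- rewrite -mulrA ler_pM2l//.
  apply: (@le_trans _ _ ((Mp + 1) * (e / 2 / (Mp + 1)))).
    rewrite ler_pM ?(ltW Wk)//; last by rewrite lerDl.
    by apply: Rintegral_ge0 => x _; rewrite mulr_ge0// le_min addr_ge0// mulr_ge0.
  by rewrite mulrC divfK// gt_eqF// ltr_wpDl.
Unshelve. all: by end_near. Qed.

(** For [f_ k] bounded by [F], the primitives satisfy |prim (f_ k) (U)| <= F |U|, so both sides of
    the identity pass to bounded pointwise limits by dominated convergence. *)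
Lemma chain_rule_test (h : R -> R) (M : R) :
  measurable_fun setT h -> (forall s, `|h s| <= M) ->
  \int[mu]_x (prim h (U x) * partial i phi x) = - \int[mu]_x (h (U x) * (G x * phi x)).
Proof.
move=> mh hM.
have [Mp Mp0 phiM] := test_function_bounded tphi.
have [Md Md0 dphiM] := test_function_bounded (test_function_partial i tphi).
have mdphi : measurable_fun setT (partial i phi).
  by apply: continuous_rV_measurable; apply: smooth_continuous; exact: smooth_partial.
have iGp : intg (fun x => G x * phi x).
  by under eq_fun do rewrite /= mulrC; apply: (intgMb measurableT (M := Mp)).
have bdphi f : intg f -> intg (fun x => f x * partial i phi x).
  by move=> intf; under eq_fun do rewrite /= mulrC; apply: (intgMb measurableT (M := Md)).
pose P (h : R -> R) := [/\ measurable_fun setT h, exists M : R, forall s, `|h s| <= M &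
  \int[mu]_x (prim h (U x) * partial i phi x) = - \int[mu]_x (h (U x) * (G x * phi x))].
suff [] : P h by [].
apply: (lipschitz_monotone_class (P := P)) mh hM.
- move=> {}h {}M C C0 hM hC.
  have mh : measurable_fun setT h.
    apply: continuous_measurable_fun => x; apply/cvgrPdist_lt => e e0; near=> y.
    rewrite (le_lt_trans (hC _ _))// (@le_lt_trans _ _ ((C + 1) * `|x - y|))//.
      by rewrite ler_wpM2r// lerDl.
    rewrite -ltr_pdivlMl ?ltr_wpDl//; near: y.
    apply/nbhs_ballP; exists ((C + 1)^-1 * e) => //=.
    by rewrite mulr_gt0// invr_gt0 ltr_wpDl.
  by split=> //; [exists M|exact: chain_rule_lipschitz hM hC mh].
- move=> a f g [mf [F fF] f0] [mg [N gN] g0]; split.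
  + by apply: measurable_funD => //; exact: measurable_funM.
  + exists (`|a| * F + N) => x; rewrite (le_trans (ler_normD _ _))// lerD// normrM.
    by rewrite ler_wpM2l.
  + have ipf : intg (fun x => prim f (U x) * partial i phi x).
      by apply: bdphi; exact: intg_prim fF.
    have ipg : intg (fun x => prim g (U x) * partial i phi x).
      by apply: bdphi; exact: intg_prim gN.
    have ifG : intg (fun x => f (U x) * (G x * phi x)).
      by apply: (intgMb measurableT (M := F)) => //; exact: measurableT_comp.
    have igG : intg (fun x => g (U x) * (G x * phi x)).
      by apply: (intgMb measurableT (M := N)) => //; exact: measurableT_comp.
    transitivity (\int[mu]_x (a * (prim f (U x) * partial i phi x) + prim g (U x) * partial i phi x)).
      by apply: eq_Rintegral => x _; rewrite (primZD _ _ mf fF mg gN); ring.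
    rewrite RintegralD//; last exact: intgZ.
    rewrite RintegralZl// f0 g0 mulrN -opprD; congr (- _).
    rewrite -RintegralZl// -RintegralD//; last exact: intgZ.
    by apply: eq_Rintegral => x _; ring.
- move=> f_ f F Pf fF cvf.
  have mf_ k : measurable_fun setT (f_ k) by have [] := Pf k.
  have mf : measurable_fun setT f by exact: (measurable_fun_cvg (h := f_)).
  have fF' x : `|f x| <= F.
    rewrite -(cvg_lim _ (cvg_norm (cvf x)))//.
    by apply: limr_le; [exact: cvgP (cvg_norm (cvf x))|exact: nearW].
  split => //; first by exists F.
  have F0 : 0 <= F by exact: le_trans (fF' 0).
  have [||||_ _ h1] := @Rdominated_convergence _ _ R mu setT
     (fun k x => prim (f_ k) (U x) * partial i phi x)
     (fun x => prim f (U x) * partial i phi x) (fun x => F * Md * `|U x|) measurableT.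
  + by move=> k; apply: intg_measurable; apply: bdphi; exact: intg_prim (fF k).
  + by apply: intgZ => //; exact: intg_norm.
  + move=> k x _; rewrite normrM mulrAC ler_pM//.
    by have := prim_lipschitz 0 (U x) (mf_ k) (fF k); rewrite prim0 !subr0.
  + by move=> x _; apply: cvgM; [exact: prim_cvg fF cvf|exact: cvg_cst].
  have [||||_ _ h2] := @Rdominated_convergence _ _ R mu setT
     (fun k x => f_ k (U x) * (G x * phi x))
     (fun x => f (U x) * (G x * phi x)) (fun x => F * `|G x * phi x|) measurableT.
  + move=> k; apply: measurable_funM; first exact: measurableT_comp.
    exact: intg_measurable iGp.
  + by apply: intgZ => //; exact: intg_norm.
  + by move=> k x _; rewrite normrM ler_wpM2r.
  + by move=> x _; apply: cvgM => //; exact: cvg_cst.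
  have E : (fun k => \int[mu]_x (prim (f_ k) (U x) * partial i phi x)) =
     (fun k => - \int[mu]_x (f_ k (U x) * (G x * phi x))).
    by apply/funext => k; have [] := Pf k.
  by rewrite E in h1; exact: (cvg_unique _ h1 (cvgN h2)).
Unshelve. all: by end_near. Qed.

End fixed_test_function.
End chain_rule.

(** * The chain rule for weak gradients *)

Section weak_gradient_chain.
Context {R : realType} {n : nat}.
Local Notation mu := (@lebesgue_rV R n).
Local Notation e_ i := (delta_mx 0 i : 'rV[R]_n).
Local Notation intg f := (mu.-integrable setT (EFin \o f)).
Implicit Types (phi psi u : 'rV[R]_n -> R) (Omega K : set 'rV[R]_n) (g : 'rV[R]_n -> 'rV[R]_n).

Lemma Rintegral_support Omega K (q : 'rV[R]_n -> R) : K `<=` Omega ->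
  (forall x, ~ K x -> q x = 0) -> \int[mu]_(x in Omega) q x = \int[mu]_x q x.
Proof.
move=> KO qK; rewrite Rintegral_mkcond; apply: eq_Rintegral => x _.
rewrite /patch; case: ifPn => // /negP; rewrite inE => xO.
by rewrite qK// => /KO.
Qed.

Lemma intg_restrict K (f : 'rV[R]_n -> R) : measurable K ->
  mu.-integrable K (EFin \o f) -> intg (f \_ K).
Proof.
move=> mK /(integrable_mkcond _ mK); apply: eq_integrable => // x _.
by rewrite /patch /=; case: ifP.
Qed.

Lemma partial_eq0 phi K i : closed K -> (forall x, ~ K x -> phi x = 0) ->
  forall x, ~ K x -> partial i phi x = 0.
Proof.
move=> cK phiK x Kx; rewrite /partial.
transitivity ('D_(e_ i) (cst 0 : 'rV[R]_n -> R) x); last exact: derive_cst.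
apply: near_eq_derive; have : nbhs x (~` K).
  by apply: open_nbhs_nbhs; split => //; exact: closed_openC.
by apply: filterS => y /phiK.
Qed.

Lemma compact_rV_closed K : compact K -> closed K.
Proof. by apply: compact_closed; exact: norm_hausdorff. Qed.

Lemma test_function_setT Omega phi : test_function Omega phi -> test_function setT phi.
Proof. by case=> *; split. Qed.

(** The constant 1 may be replaced by the indicator of a compact set [K'] around the support, which
    is integrable; each difference quotient then has integral 0 by translation invariance. This
    disposes of the additive constant in the chain rule. *)
Lemma Rintegral_partial phi i : test_function setT phi -> \int[mu]_x partial i phi x = 0.
Proof.
move=> tphi; have [sphi [K [cK _ phiK]]] := (test_functionP _ _).1 tphi.
have [d d0 [K' [cK' _ KK']]] := compact_shift_sub (e_ i) cK openT (@subsetT _ K).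
have mK' := compact_rV_measurable cK'.
have KK'0 : K `<=` K'.
  by move=> x Kx; rewrite -[x]addr0 -(scale0r (e_ i)); apply: KK' => //; rewrite normr0 ltW.
have iK' : intg (\1_K' : 'rV[R]_n -> R).
  by apply: intg_indic => //; exact: compact_rV_lty.
have := cvg_difference_quotient (i := i) d0 iK' tphi.
have [M M0 phiM] := test_function_bounded tphi.
have mphi : measurable_fun setT phi.
  by apply: continuous_rV_measurable; exact: smooth_continuous.
have phi1 x : \1_K' x * phi x = phi x.
  rewrite indicE; have [K'x|K'x] := pselect (K' x); first by rewrite mem_set// mul1r.
  by rewrite phiK ?mulr0// => /KK'0.
have iphi : intg phi.
  have -> : phi = fun x => phi x * \1_K' x by apply/funext => x; rewrite mulrC phi1.
  by apply: (intgMb measurableT (M := M)).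
have -> : (fun k => (d / k.+1%:R)^-1 *
    \int[mu]_x (\1_K' x * (phi (x - (d / k.+1%:R) *: e_ i) - phi x))) = fun=> 0.
  apply/funext => k; set t := d / k.+1%:R.
  have t0 : 0 < t by rewrite divr_gt0.
  have td : t <= d by rewrite ler_piMr ?(ltW d0)// invf_le1// ler1n.
  rewrite (_ : \int[mu]_x _ = \int[mu]_x (phi (x - t *: e_ i) - phi x)).
    rewrite RintegralB//; last exact: integrable_rV_shift.
    by rewrite Rintegral_rV_shift// subrr mulr0.
  apply: eq_Rintegral => x _; rewrite mulrBr phi1; congr (_ - _).
  rewrite indicE; have [K'x|K'x] := pselect (K' x); first by rewrite mem_set// mul1r.
  rewrite phiK ?mulr0// => Kx; apply: K'x; rewrite -[x](subrK (t *: e_ i)).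
  by apply: KK' => //; rewrite gtr0_norm.
move=> h; have /eqP : - (\int[mu]_x (\1_K' x * partial i phi x)) = 0.
  exact: (cvg_unique _ h (cvg_cst _)).
rewrite oppr_eq0 => /eqP <-.
apply: eq_Rintegral => x _; rewrite indicE.
have [K'x|K'x] := pselect (K' x); first by rewrite mem_set// mul1r.
by rewrite memNset// mul0r (partial_eq0 _ (compact_rV_closed cK) phiK)// => /KK'0.
Qed.

(** [K] contains the translates of the support by at most [d] along the [i]-th axis, so a shifted
    [phi * psi] is still a test function on [Omega]. Cutting [u] and [g] off outside [K] makes them
    integrable on the whole space without changing the pairings. *)
Lemma weak_gradient_local Omega u g phi i : open Omega -> weak_gradient Omega u g ->
  test_function Omega phi ->
  exists2 d : R, 0 < d & exists K, [/\ compact K, K `<=` Omega,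
    forall x, ~ K x -> phi x = 0 &
    forall psi r, smooth psi -> 0 <= r <= d ->
    \int[mu]_x ((u \_ K) x * partial i (fun y => phi y * psi y) (x - r *: e_ i)) =
    - \int[mu]_x (((fun x => g x 0 i) \_ K) x * (phi (x - r *: e_ i) * psi (x - r *: e_ i)))].
Proof.
move=> oO [_ _ wg] tphi; have [sphi [K [cK KO phiK]]] := (test_functionP _ _).1 tphi.
have [d d0 [K' [cK' K'O KK']]] := compact_shift_sub (e_ i) cK oO KO.
exists d => //; exists K'; split => //.
  move=> x K'x; apply: phiK => Kx; apply: K'x.
  by rewrite -[x]addr0 -(scale0r (e_ i)); apply: KK' => //; rewrite normr0 ltW.
move=> psi r spsi /andP[r0 rd].
pose theta y := phi y * psi y.
have stheta : smooth theta by exact: smoothM.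
pose theta' y := theta (y - r *: e_ i).
have theta'K x : ~ K' x -> theta' x = 0.
  move=> K'x; rewrite /theta' /theta phiK ?mul0r// => Kx; apply: K'x.
  by rewrite -[x](subrK (r *: e_ i)); apply: KK' => //; rewrite ger0_norm.
have ttheta' : test_function Omega theta'.
  by apply/test_functionP; split; [exact: smooth_shift|exists K'].
have E := wg _ ttheta' i.
have dtheta'E x : partial i theta' x = partial i theta (x - r *: e_ i).
  by rewrite /theta' partial_shift.
have dtheta'K x : ~ K' x -> partial i theta (x - r *: e_ i) = 0.
  by move=> K'x; rewrite -dtheta'E (partial_eq0 _ (compact_rV_closed cK') theta'K).
transitivity (\int[mu]_(x in Omega) (u x * partial i theta' x)).
  under [RHS]eq_Rintegral do rewrite dtheta'E.
  rewrite (Rintegral_support K'O); last by move=> x /dtheta'K ->; rewrite mulr0.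
  apply: eq_Rintegral => x _; rewrite /patch; case: ifPn => // /negP; rewrite inE => K'x.
  by rewrite dtheta'K// !mulr0.
rewrite E; congr (- _).
rewrite (Rintegral_support K'O); last by move=> x /theta'K ->; rewrite mulr0.
apply: eq_Rintegral => x _; rewrite /patch; case: ifPn => // /negP; rewrite inE => K'x.
by rewrite theta'K// -/(theta _) -/(theta' x) theta'K// !mulr0.
Qed.

(** Apply [chain_rule_test] to [u] and [g] cut off outside [K]. The cut-off is invisible in the
    pairings, since [phi] and its partial derivatives vanish there. *)
Lemma weak_gradient_chain Omega u g (h : R -> R) (M c : R) : open Omega ->
  measurable_fun setT h -> (forall s, `|h s| <= M) -> weak_gradient Omega u g ->
  weak_gradient Omega (fun x => c + prim h (u x)) (fun x => h (u x) *: g x).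
Proof.
move=> oO mh hM wug; have [[mu_ iu] ig wg] := wug.
have mO : measurable Omega by exact: rV_open_measurable.
have mp := measurable_prim mh hM.
split.
- split.
    by apply: measurable_funD => //; exact: (measurableT_comp mp).
  move=> K cK KO; have mK := compact_rV_measurable cK.
  apply: intgD => //.
    apply: measurable_bounded_integrable => //; first exact: compact_rV_lty.
    by exists `|c|; split; [exact: num_real|move=> N cN x _; exact: ltW].
  apply: (intg_le mK (g := fun x => M * `|u x|)).
  + by apply: (measurableT_comp mp); exact: measurable_funS mu_.
  + by move=> x _; have := prim_lipschitz 0 (u x) mh hM; rewrite prim0 !subr0.
  + by apply: intgZ => //; apply: intg_norm; exact: iu.
- move=> i; have [mgi igi] := ig i.
  have mhu : measurable_fun Omega (fun x => h (u x)) by exact: (measurableT_comp mh).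
  rewrite (_ : (fun x => _) = fun x => h (u x) * g x 0 i); last first.
    by apply/funext => x; rewrite mxE.
  split; first exact: measurable_funM.
  move=> K cK KO; have mK := compact_rV_measurable cK.
  by apply: (intgMb mK (M := M)); [exact: igi|exact: measurable_funS mhu|].
move=> phi tphi i.
have tphi' := test_function_setT tphi.
have [d d0 [K [cK KO phiK UG]]] := weak_gradient_local i oO wug tphi.
have mK := compact_rV_measurable cK.
have dphiK := partial_eq0 i (compact_rV_closed cK) phiK.
have iU := intg_restrict mK (iu K cK KO).
have iG := intg_restrict mK ((ig i).2 K cK KO).
have E := chain_rule_test iU iG tphi' d0 UG mh hM.
have [C C0 dphiC] := test_function_bounded (test_function_partial i tphi').
have mdphi : measurable_fun setT (partial i phi).
  apply: continuous_rV_measurable; apply: smooth_continuous; apply: smooth_partial.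
  by case: tphi.
have idphi : intg (partial i phi).
  have -> : partial i phi = fun x => partial i phi x * \1_K x.
    apply/funext => x; rewrite indicE; have [Kx|Kx] := pselect (K x).
      by rewrite mem_set// mulr1.
    by rewrite dphiK// mul0r.
  apply: (intgMb measurableT (M := C)) => //.
  by apply: intg_indic => //; exact: compact_rV_lty.
have ipU : intg (fun x => prim h ((u \_ K) x) * partial i phi x).
  under eq_fun do rewrite /= mulrC; apply: (intgMb measurableT (M := C)) => //.
  apply: (intg_le measurableT (g := fun x => M * `|(u \_ K) x|)).
  - exact: (measurableT_comp mp (intg_measurable iU)).
  - by move=> x _; have := prim_lipschitz 0 ((u \_ K) x) mh hM; rewrite prim0 !subr0.
  - by apply: intgZ => //; exact: intg_norm.
transitivity (\int[mu]_x (c * partial i phi x + prim h ((u \_ K) x) * partial i phi x)).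
  rewrite (Rintegral_support KO); last by move=> x /dphiK ->; rewrite mulr0.
  apply: eq_Rintegral => x _; rewrite mulrDl /patch; congr (_ + _).
  by case: ifPn => // /negP; rewrite inE => /dphiK ->; rewrite !mulr0.
rewrite RintegralD//; last exact: intgZ.
rewrite RintegralZl// Rintegral_partial// mulr0 add0r E; congr (- _).
rewrite [RHS](Rintegral_support KO); last by move=> x /phiK ->; rewrite mulr0.
apply: eq_Rintegral => x _; rewrite mxE /patch; case: ifPn => [_|/negP]; first by rewrite mulrA.
by rewrite inE => /phiK ->; rewrite !mulr0.
Qed.

End weak_gradient_chain.

(** * Lipschitz functions as primitives *)

Section lipschitz_primitive.
Context {R : realType}.
Local Notation leb := (@lebesgue_measure R).

(* The proof is an argument so that the instance of [cumulative] below can be found. *)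
Definition lipschitz_shear (f : R -> R) (L : R)
  (_ : forall x y, `|f x - f y| <= L * `|x - y|) : R -> R := fun t => f t + L * t.

Section shear_cumulative.
Variables (f : R -> R) (L : R) (hf : forall x y, `|f x - f y| <= L * `|x - y|).

Lemma lipschitz_shear_nd : nondecreasing (lipschitz_shear hf).
Proof.
move=> x y xy; rewrite /lipschitz_shear -subr_ge0.
rewrite (_ : _ - _ = (f y - f x) + L * (y - x)); last by ring.
have := hf y x; rewrite (ger0_norm (_ : 0 <= y - x)) ?subr_ge0// ler_norml => /andP[h _].
by rewrite addrC -lerBlDl sub0r.
Qed.

Lemma lipschitz_continuous : continuous f.
Proof.
move=> x; have L0 : 0 <= L by have := hf 1 0; rewrite subr0 normr1 mulr1; exact: le_trans.
apply/cvgrPdist_lt => e e0; near=> y.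
rewrite (le_lt_trans (hf _ _))// (@le_lt_trans _ _ ((L + 1) * `|x - y|))//.
  by rewrite ler_wpM2r// lerDl.
rewrite -ltr_pdivlMl ?ltr_wpDl//; near: y.
apply/nbhs_ballP; exists ((L + 1)^-1 * e) => //=.
by rewrite mulr_gt0// invr_gt0 ltr_wpDl.
Unshelve. all: by end_near. Qed.

Lemma lipschitz_shear_rc : right_continuous (lipschitz_shear hf).
Proof.
apply: right_continuousW => x; apply: cvgD; first exact: lipschitz_continuous.
by apply: cvgM; [exact: cvg_cst|exact: cvg_id].
Qed.

HB.instance Definition _ := isCumulative.Build R _ R (lipschitz_shear hf)
  lipschitz_shear_nd lipschitz_shear_rc.

End shear_cumulative.

Lemma lebesgue_stieltjes_itv (F : cumulative R R) (a b : R) : a <= b ->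
  lebesgue_stieltjes_measure F `]a, b]%classic = (F b - F a)%:E.
Proof.
move=> ab; rewrite /lebesgue_stieltjes_measure/= /measure_extension/=.
by rewrite measurable_mu_extE/= ?wlength_itv_bnd//; exact: is_ocitv.
Qed.

Variables (f : R -> R) (L : R).
Hypotheses (L0 : 0 < L) (hf : forall x y, `|f x - f y| <= L * `|x - y|).

Let hNf x y : `|(- f x) - (- f y)| <= L * `|x - y|.
Proof. by rewrite -opprD normrN. Qed.

Let F : cumulative R R := lipschitz_shear hf.
Let G : cumulative R R := lipschitz_shear hNf.
Let nu := lebesgue_stieltjes_measure F.
Let nu' := lebesgue_stieltjes_measure G.

Let k0 : 0 <= (L + L)^-1. Proof. by rewrite invr_ge0 addr_ge0// ltW. Qed.

(** The Stieltjes measures of f + L t and of -f + L t add up to 2 L times Lebesgue measure, because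
    f cancels on intervals; the first is at most the sum. *)
Let nu_le A : measurable A -> (nu A <= (L + L)%:E * leb A)%E.
Proof.
move=> mA.
have mE B : mscale (NngNum k0) (measure_add nu nu') B = ((L + L)^-1%:E * (nu B + nu' B))%E.
  by rewrite /mscale; congr (_ * _)%E; exact: measure_addE.
have -> : leb A = mscale (NngNum k0) (measure_add nu nu') A.
  apply: lebesgue_measure_unique => // _ [[a b] _ <-] /=.
  have [ab|ba] := leP a b; last by rewrite set_itv_ge ?bnd_simp -?leNgt ?(ltW ba)// !measure0.
  rewrite mE /nu /nu' !lebesgue_stieltjes_itv//.
  rewrite /leb [LHS](lebesgue_stieltjes_itv _ ab) -EFinD -EFinM /F /G /= /lipschitz_shear /=.
  congr EFin; have L2 : L + L != 0 by rewrite gt_eqF// addr_gt0.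
  apply: (mulfI L2); rewrite mulrA divff// mul1r; ring.
rewrite mE muleA -EFinM divff ?gt_eqF ?addr_gt0// mul1e.
by rewrite leeDl.
Qed.

(** Disjoint bounded pieces of the line, on each of which [nu] is finite. Radon-Nikodym is applied
    piece by piece and the densities are summed. *)
Let E_ := seqDU (fun k : nat => `](- k%:R), k%:R]%classic : set (measurableTypeR R)).

Let mE k : measurable (E_ k).
Proof.
apply: measurableD; first exact: measurable_itv.
by apply: bigsetU_measurable => j _; exact: measurable_itv.
Qed.

Let E_cover : \bigcup_k E_ k = setT.
Proof.
rewrite -seqDU_bigcup_eq; apply/seteqP; split => // x _.
exists (Num.truncn `|x|).+1 => //=; rewrite in_itv/=.
have : `|x| < (Num.truncn `|x|).+1%:R by exact: truncnS_gt.
by rewrite ltr_norml => /andP[-> /ltW].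
Qed.

Let nuEoo k : (nu (E_ k) < +oo)%E.
Proof.
apply: (@le_lt_trans _ _ (nu `](- k%:R), k%:R]%classic)).
  apply: le_measure; rewrite ?inE; [exact: mE|exact: measurable_itv|].
  exact: subDsetl.
rewrite /nu lebesgue_stieltjes_itv ?ltry//.
by rewrite (@le_trans _ _ 0)// oppr_le0.
Qed.

Let density : exists h : R -> \bar R, [/\ measurable_fun setT h, forall x, (0 <= h x)%E &
  forall A, measurable A -> nu A = (\int[leb]_(x in A) h x)%E].
Proof.
pose nu_ k : {finite_measure set (measurableTypeR R) -> \bar R} := mfrestr (mE k) (nuEoo k).
have nu_E k A : nu_ k A = nu (A `&` E_ k) by [].
have nu_leb k : nu_ k `<< leb.
  apply/null_content_dominatesP => A mA A0; rewrite nu_E.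
  have mAE : measurable (A `&` E_ k) by exact: measurableI.
  apply/eqP; rewrite eq_le measure_ge0 andbT (le_trans (nu_le mAE))//.
  by rewrite (subset_measure0 mAE mA (@subIsetl _ _ _) A0) mule0.
have [h_ Hh] := choice (fun k => radon_nikodym_sigma_finite (nu_leb k)).
have h0 k x : (0 <= h_ k x)%E by have [] := Hh k.
have mh k : measurable_fun setT (h_ k) by have [_ _ /measurable_int] := Hh k.
exists (fun x => \sum_(k <oo) h_ k x)%E; split.
- by apply: ge0_emeasurable_sum => [k x _ _|k _]; [exact: h0|exact: mh].
- by move=> x; exact: nneseries_ge0.
- move=> A mA; rewrite integral_nneseries//; last by move=> k; exact: measurable_funTS.
  transitivity (\sum_(k <oo) nu (A `&` E_ k))%E; last first.
    by apply: eq_eseriesr => k _; rewrite -nu_E; have [_ _ _ ->] := Hh k.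
  rewrite -[in LHS](setIT A) -E_cover setI_bigcupr; apply/esym/cvg_lim => //.
  apply: measure_semi_sigma_additive.
  + by move=> k; exact: measurableI.
  + by apply: trivIset_setIl; exact: trivIset_seqDU.
  + by apply: bigcup_measurable => k _; exact: measurableI.
Qed.

Lemma lipschitz_primitive : exists h : R -> R, [/\ measurable_fun setT h,
  exists M, forall s, `|h s| <= M & forall t, f t = f 0 + prim h t].
Proof.
have [h [mh h0 hE]] := density.
have L20 : 0 < L + L by rewrite addr_gt0.
(* Where the density exceeds 2 L, its integral over any measurable part is still at most that of 2 L
   by [nu_le]. The two integrals therefore agree on all parts, so the functions agree almost
   everywhere on [B j], which must be null. The bounded interval makes 2 L integrable. *)
pose B j : set (measurableTypeR R) := [set x | ((L + L)%:E < h x)%E] `&` `](- j%:R), j%:R]%classic.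
have mB j : measurable (B j).
  apply: measurableI; last exact: measurable_itv.
  rewrite -[X in measurable X]setTI; exact: emeasurable_fun_o_infty.
have Boo j : (leb (B j) < +oo)%E.
  apply: (@le_lt_trans _ _ (leb `](- j%:R), j%:R]%classic)).
    apply: le_measure; rewrite ?inE; [exact: mB|exact: measurable_itv|exact: subIsetr].
  by rewrite [ltLHS](lebesgue_measure_itv `](- j%:R), j%:R])/=; case: ifP => _; rewrite -?EFinD ltry.
have B0 j : leb (B j) = 0%E.
  have iB : leb.-integrable (B j) (cst (L + L)%:E).
    apply: (measurable_bounded_integrable (f := fun=> L + L)) => //; first exact: Boo.
    by exists `|L + L|; split; [exact: num_real|move=> N cN x _; exact: ltW].
  have : ae_eq leb (B j) (cst (L + L)%:E) h.
    apply: integral_ae_eq => //; first exact: measurable_funTS.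
    move=> E EB mE'; apply/eqP; rewrite eq_le; apply/andP; split.
      apply: ge0_le_integral => //.
      - by move=> x _; rewrite lee_fin ltW.
      - exact: measurable_funTS.
      - by move=> x /EB[/= /ltW].
    by rewrite -hE// integral_cst//; exact: nu_le.
  move=> [N [mN N0 BN]]; apply: (subset_measure0 (mB j) mN _ N0).
  move=> x Bx; apply: BN => /= /(_ Bx) hx; move: Bx => [/=].
  by rewrite -hx ltxx.
have hae : {ae leb, forall x, (h x <= (L + L)%:E)%E}.
  suff : leb.-negligible (~` [set x : measurableTypeR R | (h x <= (L + L)%:E)%E]) by [].
  have NB : leb.-negligible (\bigcup_j B j).
    by apply: negligible_bigcup => j; apply/negligibleP; [exact: mB|exact: B0].
  apply: negligibleS NB.
  move=> x /= /negP; rewrite -ltNge => hx.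
  exists (Num.truncn `|x|).+1 => //; split => //=; rewrite in_itv/=.
  have : `|x| < (Num.truncn `|x|).+1%:R by exact: truncnS_gt.
  by rewrite ltr_norml => /andP[-> /ltW].
(* The bound has to hold at every point and not only almost everywhere, because [u] may take values
   in a null set on a set of positive measure. *)
pose hb x := fine (h x) * \1_[set x | (h x <= (L + L)%:E)%E] x.
have mhb : measurable_fun setT hb.
  apply: measurable_funM; first exact: measurableT_comp.
  apply: measurable_indic; rewrite -[X in measurable X]setTI.
  exact: emeasurable_fun_infty_c.
have hbL x : 0 <= hb x <= L + L.
  rewrite /hb indicE; have [|_] := boolP (x \in _); last first.
    by rewrite mulr0 lexx ltW.
  rewrite inE /= mulr1; have := h0 x; case: (h x) => //= r.
  by rewrite !lee_fin => -> ->.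
have hbE : {ae leb, forall x, (hb x)%:E = h x}.
  apply: (@filterS _ _ (ae_filter_ringOfSetsType _) _ _ _ hae) => x hx; rewrite /hb indicE mem_set// mulr1.
  by have := h0 x; move: hx; case: (h x).
have hbM s : `|hb s - L| <= L + L + L.
  have /andP[s0 sL] := hbL s.
  by rewrite (le_trans (ler_normB _ _))// ger0_norm// ger0_norm ?(ltW L0)// lerD2r.
have mhL : measurable_fun setT (fun s => hb s - L) by exact: measurable_funB.
exists (fun s => hb s - L); split => //; first by exists (L + L + L).
(* [hb] integrates to the increments of f + L t; subtracting [L] undoes the shear. *)
have fE x y : x <= y -> \int[leb]_(s in `[x, y]) (hb s - L) = f y - f x.
  move=> xy.
  have ihb : leb.-integrable `[x, y] (EFin \o hb).
    apply: (@bounded_itv_integrable R hb (L + L)) => // s.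
    by have /andP[s0 sL] := hbL s; rewrite ger0_norm.
  have icL : leb.-integrable `[x, y] (EFin \o (fun=> L)).
    by apply: (@bounded_itv_integrable R (fun=> L) `|L|).
  rewrite RintegralB// (Rintegral_itv_cst L xy).
  have -> : \int[leb]_(s in `[x, y]) hb s = F y - F x; last by rewrite /F /= /lipschitz_shear; ring.
  rewrite -Rintegral_itv_obnd_cbnd; last first.
    by apply: integrableS ihb => //; exact: subset_itv_oc_cc.
  rewrite /Rintegral -[RHS]/(fine (F y - F x)%:E) -(lebesgue_stieltjes_itv F xy); congr fine.
  rewrite -/nu hE//; apply: ae_eq_integral => //.
  - by apply/measurable_EFinP; exact: measurable_funTS.
  - exact: measurable_funTS.
  - by apply: (@filterS _ _ (ae_filter_ringOfSetsType _) _ _ _ hbE) => s -> _.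
move=> t; have [t0|t0] := leP 0 t.
  by have := primB mhL hbM t0; rewrite prim0 subr0 fE// => ->; ring.
by have := primB mhL hbM (ltW t0); rewrite prim0 sub0r fE ?(ltW t0)// => E; rewrite -[prim _ t]opprK E; ring.
Qed.

End lipschitz_primitive.

(** * Young functions *)

Section young_functions.
Context {R : realType}.
Variable A : R -> \bar R.
Hypotheses (YA : young_function A).
Local Open Scope ereal_scope.

Lemma young_scale (theta t : R) : (0 <= theta <= 1)%R -> (0 <= t)%R ->
  A (theta * t)%R <= theta%:E * A t.
Proof.
move=> th t0; have := young_convex YA t0 (lexx 0%R) th.
by rewrite mulr0 addr0 young0// mule0 adde0.
Qed.

Lemma young_le (s t : R) : (0 <= s)%R -> (s <= t)%R -> A s <= A t.
Proof.
move=> s0 st; have t0 := le_trans s0 st.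
have [->//|tn0] := eqVneq s t.
have t1 : (0 < t)%R by rewrite (le_lt_trans s0)// lt_neqAle tn0.
have th : (0 <= s / t <= 1)%R by rewrite divr_ge0//= ler_pdivrMr// mul1r.
have := young_scale th t0; rewrite divfK ?gt_eqF// => /le_trans; apply.
have /andP[_ th1] := th.
rewrite -[leRHS]mul1e lee_wpmul2r ?lee_fin//; exact: young_ge0.
Qed.

Lemma young_fin : exists2 t : R, (0 < t)%R & A t < +oo.
Proof.
have [s [t [s0 t0 st]]] := young_nonconstant YA.
have [sy|sy] := eqVneq (A s) +oo; last by exists s => //; rewrite ltey.
by exists t => //; rewrite ltey; apply: contra st => /eqP ->; rewrite sy.
Qed.

Lemma young_addition (a b : R) : (0 <= a)%R -> (0 <= b)%R ->
  A (a + b)%R <= A (2 * a)%R + A (2 * b)%R.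
Proof.
move=> a0 b0.
have h : (0 <= (2^-1 : R) <= 1)%R by rewrite invr_ge0 ler0n invf_le1// ler1n.
have a20 : (0 <= 2 * a)%R by rewrite mulr_ge0.
have b20 : (0 <= 2 * b)%R by rewrite mulr_ge0.
have := young_convex YA a20 b20 h.
rewrite (_ : 2^-1 * (2 * a) + (1 - 2^-1) * (2 * b) = a + b)%R; last by field.
move=> /le_trans; apply.
have le1 (c : R) x : (0 <= c <= 1)%R -> 0 <= x -> c%:E * x <= x.
  by move=> /andP[_ c1] x0; rewrite -[leRHS]mul1e lee_wpmul2r// lee_fin.
apply: leeD; apply: le1 => //; try exact: young_ge0.
by rewrite subr_ge0 lerBlDr lerDl; case/andP: h => -> ->.
Qed.

(** [A] is monotone only on [0, +oo[. Precomposed with [Num.max 0] it is monotone on R, so its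
    sublevel sets are intervals. *)
Lemma measurable_young d (T : measurableType d) (D : set T) (w : T -> R) :
  measurable D -> measurable_fun D w -> (forall x, D x -> (0 <= w x)%R) ->
  measurable_fun D (fun x => A (w x)).
Proof.
move=> mD mw w0.
pose B (t : R) := A (Num.max 0%R t).
have mB : measurable_fun setT B.
  apply: (measurability _ (ErealGenInftyO.measurableE R)) => _ [_ [y ->] <-].
  rewrite setTI; apply: is_interval_measurable => s t /= Bs Bt z /andP[sz zt].
  move: Bt; rewrite /= !in_itv/=; apply: le_lt_trans; apply: young_le.
    by rewrite le_max lexx.
  by rewrite ge_max le_max lexx/= le_max zt orbT.
apply: (@eq_measurable_fun _ _ _ _ D (B \o w)).
  by move=> x; rewrite inE => /w0 wx; rewrite /B /=; congr A; apply/max_idPr.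
exact: (measurableT_comp mB).
Qed.

(** For t > eps, convexity between 0 and t gives A eps <= (eps / t) A t, which is the second term;
    for t <= eps the first term suffices. This is how modulars control L^1 norms. *)
Lemma young_linear_lower (eps t : R) : (0 < eps)%R -> A eps < +oo -> 0 < A eps -> (0 <= t)%R ->
  t%:E <= eps%:E + (eps / fine (A eps))%:E * A t.
Proof.
move=> e0 efin epos t0.
have Afin : A eps \is a fin_num by rewrite ge0_fin_numE// ltW.
have a0 : (0 < fine (A eps))%R by rewrite fine_gt0// epos efin.
have [te|te] := leP t eps.
  rewrite (@le_trans _ _ eps%:E)// ?lee_fin// leeDl// mule_ge0//.
    by rewrite lee_fin divr_ge0// ltW.
  exact: young_ge0.
have th : (0 <= eps / t <= 1)%R.
  by rewrite divr_ge0 ?(ltW e0)//= ler_pdivrMr ?mul1r ?(ltW te)// (lt_trans e0).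
have := young_scale th t0; rewrite divfK ?gt_eqF ?(lt_trans e0)// => h.
have tp : (0 < t)%R by exact: lt_trans te.
apply: (@le_trans _ _ ((eps / fine (A eps))%:E * A t)); last by rewrite leeDr// lee_fin ltW.
have [->|At] := eqVneq (A t) +oo.
  by rewrite gt0_muley ?leey// lte_fin divr_gt0.
have Atfin : A t \is a fin_num by rewrite ge0_fin_numE ?ltey// young_ge0.
move: h; rewrite -(fineK Afin) -(fineK Atfin) -!EFinM !lee_fin /=.
rewrite mulrAC ler_pdivlMr// => h.
by rewrite mulrAC ler_pdivlMr// mulrC.
Qed.

End young_functions.

Section euclidean_norm.
Context {R : realType} {n : nat}.
Implicit Types v w : 'rV[R]_n.

Lemma euclidean_norm_ge0 v : 0 <= euclidean_norm v.
Proof. exact: sqrtr_ge0. Qed.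

Lemma sqr_euclidean_norm v : euclidean_norm v ^+ 2 = \sum_(i < n) v 0 i ^+ 2.
Proof. by rewrite sqr_sqrtr// sumr_ge0// => i _; rewrite sqr_ge0. Qed.

Lemma euclidean_normZ (c : R) v : euclidean_norm (c *: v) = `|c| * euclidean_norm v.
Proof.
rewrite /euclidean_norm -sqrtr_sqr -sqrtrM ?sqr_ge0//; congr Num.sqrt.
by rewrite mulr_sumr; apply: eq_bigr => i _; rewrite mxE exprMn.
Qed.

Lemma coord_le_euclidean_norm v i : `|v 0 i| <= euclidean_norm v.
Proof.
rewrite -sqrtr_sqr ler_wsqrtr// (bigD1 i)//= lerDl sumr_ge0// => j _.
by rewrite sqr_ge0.
Qed.

(** Follows from (a + b)^2 <= 2 (a^2 + b^2) coordinate by coordinate. The lost factor 2 costs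
    nothing, since the scale of a modular is free. *)
Lemma euclidean_normD_le v w :
  euclidean_norm (v + w) <= 2 * (euclidean_norm v + euclidean_norm w).
Proof.
have nv := euclidean_norm_ge0 v; have nw := euclidean_norm_ge0 w.
rewrite -(@ler_pXn2r _ 2)// ?nnegrE ?euclidean_norm_ge0// ?mulr_ge0 ?addr_ge0//.
apply: (@le_trans _ _ (2 * (euclidean_norm v ^+ 2 + euclidean_norm w ^+ 2))).
  rewrite !sqr_euclidean_norm -big_split mulr_sumr; apply: ler_sum => i _ /=.
  by rewrite mxE; have := sqr_ge0 (v 0 i - w 0 i); nra.
nra.
Qed.

Lemma euclidean_norm0P v : (forall i, v 0 i = 0) -> euclidean_norm v = 0.
Proof.
by move=> v0; rewrite /euclidean_norm big1 ?sqrtr0// => i _; rewrite v0 expr0n.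
Qed.

Lemma measurable_euclidean_norm d (T : measurableType d) (D : set T) (g : T -> 'rV[R]_n) :
  (forall i, measurable_fun D (fun x => g x 0 i)) ->
  measurable_fun D (fun x => euclidean_norm (g x)).
Proof.
move=> mg.
have ms : measurable_fun setT (@Num.sqrt R).
  by apply: continuous_measurable_fun; exact: sqrt_continuous.
apply: (measurableT_comp ms); apply: measurable_sum => i.
by under eq_fun do rewrite expr2; apply: measurable_funM.
Qed.

End euclidean_norm.

(** * Continuity of superposition *)

(* The weak convergence of h(v_k) with respect to |q| for h and for h^2
   gives the convergence of the integral of |h(v_k) - h(v)|^2 |q| to 0. *)
Lemma weak_to_strong d (T : measurableType d) (R : realType) (m : {measure set T -> \bar R})
    (D : set T) (q v : T -> R) (v_ : nat -> T -> R) :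
  measurable D -> m.-integrable D (EFin \o q) ->
  (forall k, measurable_fun D (v_ k)) -> measurable_fun D v ->
  (forall (h : R -> R) (M : R) (b : T -> R) (N : R), measurable_fun setT h ->
    (forall s, `|h s| <= M) -> measurable_fun setT b -> (forall x, `|b x| <= N) ->
    \int[m]_(x in D) (h (v_ k x) * (q x * b x)) @[k --> \oo] -->
    \int[m]_(x in D) (h (v x) * (q x * b x))) ->
  forall (h : R -> R) (M : R), measurable_fun setT h -> (forall s, `|h s| <= M) ->
  \int[m]_(x in D) (`|h (v_ k x) - h (v x)| * `|q x|) @[k --> \oo] --> (0 : R).
Proof.
move=> mD iq mv_ mv H h M mh hM.
have M0 : 0 <= M by exact: le_trans (hM 0).
have mq := intg_measurable iq.
have mhv : measurable_fun D (fun x => h (v x)) by exact: (measurableT_comp mh).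
have mhv_ k : measurable_fun D (fun x => h (v_ k x)) by exact: (measurableT_comp mh).
have msq : measurable_fun D (fun x => Num.sg (q x)).
  exact: (measurableT_comp (@measurable_sgr R)).
have inq := intg_norm iq.
have sg1 (x : R) : `|Num.sg x| <= 1 by rewrite normr_sg; case: (_ != 0).
(* The multipliers built from [q] and [v] are measurable on [D] only, while [H] asks for multipliers
   on the whole space: they are extended by 0. *)
have restrictM (f : T -> R) (F : R) : measurable_fun D f -> (forall x, `|f x| <= F) ->
    measurable_fun setT (f \_ D) /\ forall x, `|(f \_ D) x| <= F.
  move=> mf fF; split; first exact/(measurable_restrictT _ mD).
  move=> x; rewrite /patch; case: ifP => // _; rewrite normr0.
  exact: le_trans (fF x).
(* The sign of [q] in the multiplier turns [q] into |q|. For the cross term [h (v x)] is put into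
   the multiplier as well; for the square term [H] is applied to h^2. *)
have cv1 : \int[m]_(x in D) (h (v_ k x) * h (v x) * `|q x|) @[k --> \oo] -->
    \int[m]_(x in D) (h (v x) ^+ 2 * `|q x|).
  have hsgM x : `|h (v x) * Num.sg (q x)| <= M by rewrite normrM -[M]mulr1 ler_pM.
  have [mb bN] := @restrictM (fun x => h (v x) * Num.sg (q x)) M
    (measurable_funM mhv msq) hsgM.
  have E (a : R) x : D x -> a * (q x * ((fun x => h (v x) * Num.sg (q x)) \_ D) x) =
      a * h (v x) * `|q x|.
    by move=> Dx; rewrite /patch mem_set// [in RHS]normrEsg; ring.
  have := H h M _ _ mh hM mb bN.
  rewrite (_ : \int[m]_(x in D) (h (v x) * _) = \int[m]_(x in D) (h (v x) ^+ 2 * `|q x|)).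
    rewrite (_ : (fun k => \int[m]_(x in D) _) =
       (fun k => \int[m]_(x in D) (h (v_ k x) * h (v x) * `|q x|)))//.
    by apply/funext => k; apply: eq_Rintegral => x /set_mem Dx; rewrite E.
  by apply: eq_Rintegral => x /set_mem Dx; rewrite E// expr2.
have cv2 : \int[m]_(x in D) (h (v_ k x) ^+ 2 * `|q x|) @[k --> \oo] -->
    \int[m]_(x in D) (h (v x) ^+ 2 * `|q x|).
  have [mb bN] := @restrictM (fun x => Num.sg (q x)) 1 msq (fun x => sg1 _).
  have E (a : R) x : D x -> a * (q x * ((fun x => Num.sg (q x)) \_ D) x) = a * `|q x|.
    by move=> Dx; rewrite /patch mem_set// [in RHS]normrEsg [q x * _]mulrC.
  have mh2 : measurable_fun setT (fun s => h s ^+ 2).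
    by under eq_fun do rewrite expr2; exact: measurable_funM.
  have h2M s : `|h s ^+ 2| <= M ^+ 2 by rewrite normrX lerXn2r ?nnegrE.
  have := H (fun s => h s ^+ 2) (M ^+ 2) _ _ mh2 h2M mb bN.
  rewrite (_ : \int[m]_(x in D) (h (v x) ^+ 2 * _) = \int[m]_(x in D) (h (v x) ^+ 2 * `|q x|)).
    rewrite (_ : (fun k => \int[m]_(x in D) _) =
       (fun k => \int[m]_(x in D) (h (v_ k x) ^+ 2 * `|q x|)))//.
    by apply/funext => k; apply: eq_Rintegral => x /set_mem Dx; rewrite E.
  by apply: eq_Rintegral => x /set_mem Dx; rewrite E.
have iM2 (f f' : T -> R) : measurable_fun D f -> (forall x, `|f x| <= M) ->
    measurable_fun D f' -> (forall x, `|f' x| <= M) ->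
    m.-integrable D (EFin \o (fun x => f x * f' x * `|q x|)).
  move=> mf fM mf' fM'; apply: (intgMb mD (M := M * M)) => //.
    exact: measurable_funM.
  by move=> x _; rewrite normrM ler_pM.
pose S k := \int[m]_(x in D) ((h (v_ k x) - h (v x)) ^+ 2 * `|q x|).
have S0 : S k @[k --> \oo] --> (0 : R).
  have SE k : S k = (\int[m]_(x in D) (h (v_ k x) ^+ 2 * `|q x|) -
     2 * \int[m]_(x in D) (h (v_ k x) * h (v x) * `|q x|)) +
     \int[m]_(x in D) (h (v x) ^+ 2 * `|q x|).
    have i1 : m.-integrable D (EFin \o (fun x => h (v_ k x) ^+ 2 * `|q x|)).
      by under eq_fun do rewrite /= expr2; exact: iM2.
    have i2 : m.-integrable D (EFin \o (fun x => h (v_ k x) * h (v x) * `|q x|)).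
      exact: iM2.
    have i3 : m.-integrable D (EFin \o (fun x => h (v x) ^+ 2 * `|q x|)).
      by under eq_fun do rewrite /= expr2; exact: iM2.
    rewrite -RintegralZl// -RintegralB//; last exact: intgZ.
    rewrite -RintegralD//; last by apply: intgB => //; exact: intgZ.
    by apply: eq_Rintegral => x _; ring.
  rewrite (_ : 0 = (\int[m]_(x in D) (h (v x) ^+ 2 * `|q x|) -
     2 * \int[m]_(x in D) (h (v x) ^+ 2 * `|q x|)) +
     \int[m]_(x in D) (h (v x) ^+ 2 * `|q x|)); last by ring.
  under eq_fun do rewrite SE.
  apply: cvgD; last exact: cvg_cst.
  by apply: cvgB => //; apply: cvgM => //; exact: cvg_cst.
apply/cvgr0Pnorm_lt => e e0.
set Q := \int[m]_(x in D) `|q x|.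
have Q0 : 0 <= Q by exact: Rintegral_ge0.
(* In place of the Cauchy-Schwarz inequality: |a| <= dl + a^2 / dl. This [dl] makes the first term
   contribute at most [e / 2]. *)
pose dl := e / 2 / (Q + 1).
have dl0 : 0 < dl by rewrite !divr_gt0// ltr_wpDl.
have e1 : 0 < e / 2 * dl by rewrite mulr_gt0// divr_gt0.
have /cvgr0Pnorm_lt/(_ _ e1) := S0; apply: filterS => k.
have Sk0 : 0 <= S k by apply: Rintegral_ge0 => x _; rewrite mulr_ge0// sqr_ge0.
rewrite ger0_norm// => Ske.
have mdk : measurable_fun D (fun x => h (v_ k x) - h (v x)) by exact: measurable_funB.
have dkM x : `|h (v_ k x) - h (v x)| <= M + M.
  by rewrite (le_trans (ler_normB _ _))// lerD.
have iS : m.-integrable D (EFin \o (fun x => (h (v_ k x) - h (v x)) ^+ 2 * `|q x|)).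
  apply: (intgMb mD (M := (M + M) ^+ 2)) => //.
    by under eq_fun do rewrite expr2; exact: measurable_funM.
  by move=> x _; rewrite normrX lerXn2r ?nnegrE// addr_ge0.
rewrite ger0_norm; last by apply: Rintegral_ge0 => x _; rewrite mulr_ge0.
have : \int[m]_(x in D) (`|h (v_ k x) - h (v x)| * `|q x|) <=
    \int[m]_(x in D) (dl * `|q x| + dl^-1 * ((h (v_ k x) - h (v x)) ^+ 2 * `|q x|)).
  apply: le_Rintegral => //.
  - apply: (intgMb mD (M := M + M)) => //; first exact: measurableT_comp.
    by move=> x _; rewrite normr_id.
  - by apply: intgD => //; exact: intgZ.
  - move=> x _; rewrite mulrA -mulrDl ler_wpM2r//.
    set a := h (v_ k x) - h (v x).
    have [ad|da] := leP `|a| dl.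
      by rewrite (le_trans ad)// lerDl mulr_ge0 ?sqr_ge0// invr_ge0 ltW.
    rewrite (@le_trans _ _ (dl^-1 * a ^+ 2))//; last by rewrite lerDr ltW.
    rewrite ler_pdivlMl// -real_normK ?num_real// expr2 ler_wpM2r// ltW//.
move=> /le_lt_trans; apply.
rewrite RintegralD//; [|exact: intgZ|exact: intgZ].
rewrite !RintegralZl// -/(S k) -/Q (splitr e) ler_ltD//.
  rewrite /dl (@le_trans _ _ (e / 2 / (Q + 1) * (Q + 1)))//.
    by rewrite ler_wpM2l ?(ltW dl0)// lerDl.
  by rewrite divfK// gt_eqF// ltr_wpDl.
by rewrite ltr_pdivrMl// mulrC.
Qed.

Section superposition_convergence.
Context {R : realType} {n : nat}.
Local Notation mu := (@lebesgue_rV R n).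
Local Notation e_ i := (delta_mx 0 i : 'rV[R]_n).
Implicit Types (phi psi u : 'rV[R]_n -> R) (Omega K : set 'rV[R]_n) (g : 'rV[R]_n -> 'rV[R]_n).

Lemma Rintegral_supportK Omega K (q : 'rV[R]_n -> R) : K `<=` Omega ->
  (forall x, ~ K x -> q x = 0) -> \int[mu]_(x in Omega) q x = \int[mu]_(x in K) q x.
Proof.
by move=> KO qK; rewrite (Rintegral_support KO qK) (@Rintegral_support _ _ K K).
Qed.

Lemma intg_test Omega phi (f : 'rV[R]_n -> R) : measurable Omega ->
  locally_integrable_on Omega f -> test_function Omega phi ->
  mu.-integrable Omega (EFin \o (fun x => f x * phi x)).
Proof.
move=> mO [mf lf] tphi; have [sphi [K [cK KO phiK]]] := (test_functionP _ _).1 tphi.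
have mK := compact_rV_measurable cK.
have [M M0 phiM] := test_function_bounded tphi.
have mphi : measurable_fun setT phi.
  by apply: continuous_rV_measurable; exact: smooth_continuous.
have iK : mu.-integrable K (EFin \o (fun x => f x * phi x)).
  under eq_fun do rewrite /= mulrC.
  by apply: (intgMb mK (M := M)) => //; [exact: lf|exact: measurable_funTS].
have := integrableS measurableT mO (@subsetT _ _) (intg_restrict mK iK).
apply: eq_integrable => // x _; rewrite /= /patch; case: ifPn => // /negP.
by rewrite inE => /phiK ->; rewrite mulr0.
Qed.

(** Since the [v_ k] share the bound [M], replacing a multiplier [f_ j] by its limit costs at most M
    times the L^1 norm of q (f_j - f), uniformly in [k]. Hence the multipliers with the claimed
    convergence are stable under bounded limits. *)
Lemma cvg_Rintegral_bounded Omega (q v : 'rV[R]_n -> R) (v_ : nat -> 'rV[R]_n -> R) (M : R) :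
  measurable Omega -> mu.-integrable Omega (EFin \o q) ->
  (forall k, measurable_fun Omega (v_ k)) -> measurable_fun Omega v ->
  (forall k x, `|v_ k x| <= M) -> (forall x, `|v x| <= M) ->
  (forall psi, smooth psi ->
    \int[mu]_(x in Omega) (v_ k x * (q x * psi x)) @[k --> \oo] -->
    \int[mu]_(x in Omega) (v x * (q x * psi x))) ->
  forall (b : 'rV[R]_n -> R) (N : R), measurable_fun setT b -> (forall x, `|b x| <= N) ->
    \int[mu]_(x in Omega) (v_ k x * (q x * b x)) @[k --> \oo] -->
    \int[mu]_(x in Omega) (v x * (q x * b x)).
Proof.
move=> mO iq mv_ mv v_M vM H b N mb bN.
have M0 : 0 <= M by exact: le_trans (vM 0).
pose P (b : 'rV[R]_n -> R) := [/\ measurable_fun setT b, exists N : R, forall x, `|b x| <= N &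
    \int[mu]_(x in Omega) (v_ k x * (q x * b x)) @[k --> \oo] -->
    \int[mu]_(x in Omega) (v x * (q x * b x))].
have iqb (c : 'rV[R]_n -> R) (C : R) : measurable_fun setT c -> (forall x, `|c x| <= C) ->
    mu.-integrable Omega (EFin \o (fun x => q x * c x)).
  move=> mc cC; under eq_fun do rewrite /= mulrC.
  by apply: (intgMb mO (M := C)) => //; exact: measurable_funTS.
have iv_ k (c : 'rV[R]_n -> R) (C : R) : measurable_fun setT c -> (forall x, `|c x| <= C) ->
    mu.-integrable Omega (EFin \o (fun x => v_ k x * (q x * c x))).
  by move=> mc cC; apply: (intgMb mO (M := M)) => //; exact: iqb cC.
have iv (c : 'rV[R]_n -> R) (C : R) : measurable_fun setT c -> (forall x, `|c x| <= C) ->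
    mu.-integrable Omega (EFin \o (fun x => v x * (q x * c x))).
  by move=> mc cC; apply: (intgMb mO (M := M)) => //; exact: iqb cC.
suff [] : P b by [].
apply: (smooth_monotone_class (P := P)) mb bN.
- move=> psi spsi psi01; split; last exact: H.
    by apply: continuous_rV_measurable; exact: smooth_continuous.
  by exists 1 => x; have /andP[p0 p1] := psi01 x; rewrite ger0_norm.
- move=> a f g [mf [F fF] f0] [mg [G gG] g0]; split.
  + by apply: measurable_funD => //; exact: measurable_funM.
  + exists (`|a| * F + G) => x; rewrite (le_trans (ler_normD _ _))// lerD// normrM.
    by rewrite ler_wpM2l.
  + have E (w : 'rV[R]_n -> R) : mu.-integrable Omega (EFin \o (fun x => w x * (q x * f x))) ->
        mu.-integrable Omega (EFin \o (fun x => w x * (q x * g x))) ->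
        \int[mu]_(x in Omega) (w x * (q x * (a * f x + g x))) =
        a * \int[mu]_(x in Omega) (w x * (q x * f x)) +
        \int[mu]_(x in Omega) (w x * (q x * g x)).
      move=> iwf iwg; rewrite -RintegralZl// -RintegralD//; last exact: intgZ.
      by apply: eq_Rintegral => x _; ring.
    rewrite E; [|exact: iv fF|exact: iv gG].
    under eq_fun => k do rewrite (E (v_ k) (iv_ k _ _ mf fF) (iv_ k _ _ mg gG)).
    by apply: cvgD => //; apply: cvgM => //; exact: cvg_cst.
- move=> f_ f F Pf fF cvf.
  have mf_ k : measurable_fun setT (f_ k) by have [] := Pf k.
  have mf : measurable_fun setT f by exact: (measurable_fun_cvg (h := f_)).
  have fF' x : `|f x| <= F.
    rewrite -(cvg_lim _ (cvg_norm (cvf x)))//.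
    by apply: limr_le; [exact: cvgP (cvg_norm (cvf x))|exact: nearW].
  split => //; first by exists F.
  have [||||_ h1 _] := @Rdominated_convergence _ _ R mu Omega
     (fun k x => q x * f_ k x) (fun x => q x * f x) (fun x => F * `|q x|) mO.
  + by move=> k; exact: intg_measurable (iqb _ _ (mf_ k) (fF k)).
  + by apply: intgZ => //; exact: intg_norm.
  + by move=> k x _; rewrite normrM mulrC ler_wpM2r.
  + by move=> x _; apply: cvgM => //; exact: cvg_cst.
  apply/cvgrPdist_lt => e e0.
  have e3 : 0 < e / 3 / (M + 1) by rewrite !divr_gt0// ltr_wpDl.
  have /cvgr0Pnorm_lt/(_ _ e3)[j _ /(_ j (leqnn j))] := h1.
  rewrite ger0_norm ?Rintegral_ge0// => fj.
  have [_ _ cvj] := Pf j.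
  have e30 : 0 < e / 3 by rewrite divr_gt0.
  move/cvgrPdist_lt/(_ _ e30) : cvj; apply: filterS => k hk.
  have iqj := iqb _ _ (mf_ j) (fF j).
  have iqf := iqb _ _ mf fF'.
  have inj := intg_norm (intgB mO iqj iqf).
  have D (w : 'rV[R]_n -> R) : measurable_fun Omega w -> (forall x, `|w x| <= M) ->
      `|\int[mu]_(x in Omega) (w x * (q x * f_ j x)) -
        \int[mu]_(x in Omega) (w x * (q x * f x))| < e / 3.
    move=> mw wM.
    have i1 : mu.-integrable Omega (EFin \o (fun x => w x * (q x * f_ j x))).
      exact: (intgMb mO (M := M)).
    have i2 : mu.-integrable Omega (EFin \o (fun x => w x * (q x * f x))).
      exact: (intgMb mO (M := M)).
    rewrite -RintegralB//.
    have i3 := intgB mO i1 i2.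
    apply: (le_lt_trans (le_normr_Rintegral mO i3)).
    apply: (@le_lt_trans _ _ (\int[mu]_(x in Omega) ((M + 1) * `|q x * f_ j x - q x * f x|))).
      apply: le_Rintegral => //; [exact: intg_norm|exact: intgZ|].
      by move=> x _; rewrite -mulrBr normrM ler_wpM2r// (le_trans (wM x))// lerDl.
    by rewrite RintegralZl// -ltr_pdivlMl ?ltr_wpDl// mulrC.
  rewrite (_ : e = e / 3 + (e / 3 + e / 3)); last by field.
  have := D _ mv vM; have := D _ (mv_ k) (v_M k).
  set a1 := \int[mu]_(x in Omega) _; set a2 := \int[mu]_(x in Omega) _ => A12.
  set a3 := \int[mu]_(x in Omega) _; set a4 := \int[mu]_(x in Omega) _ => A34.
  rewrite (_ : a4 - a2 = (a4 - a3) + ((a3 - a1) + (a1 - a2))); last by ring.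
  rewrite (le_lt_trans (ler_normD _ _))// ltrD//; first by rewrite distrC.
  by rewrite (le_lt_trans (ler_normD _ _))// ltrD.
Qed.

(** [weak_to_strong] leads to integrals linear in h(u_k), and [cvg_Rintegral_bounded] to smooth
    multipliers [psi]. Then [phi * psi] is again a test function, so the chain rule integrates by
    parts and L^1 convergence on its support suffices. *)
Lemma marcus_mizel Omega u g (u_ : nat -> 'rV[R]_n -> R) (g_ : nat -> 'rV[R]_n -> 'rV[R]_n)
    (h : R -> R) (M : R) phi i : open Omega ->
  (forall k, weak_gradient Omega (u_ k) (g_ k)) -> weak_gradient Omega u g ->
  (forall K, compact K -> K `<=` Omega ->
    \int[mu]_(x in K) `|u_ k x - u x| @[k --> \oo] --> (0 : R)) ->
  (forall K, compact K -> K `<=` Omega ->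
    \int[mu]_(x in K) `|g_ k x 0 i - g x 0 i| @[k --> \oo] --> (0 : R)) ->
  test_function Omega phi -> measurable_fun setT h -> (forall s, `|h s| <= M) ->
  \int[mu]_(x in Omega) (`|h (u_ k x) - h (u x)| * `|g x 0 i * phi x|)
    @[k --> \oo] --> (0 : R).
Proof.
move=> oO wg_ wg cu cg tphi mh hM.
have mO : measurable Omega by exact: rV_open_measurable.
have [[mu_ lu] lg _] := wg.
have mu_k k : measurable_fun Omega (u_ k) by have [[]] := wg_ k.
have iq : mu.-integrable Omega (EFin \o (fun x => g x 0 i * phi x)) by exact: intg_test.
apply: (weak_to_strong mO iq mu_k mu_) mh hM => {M h} h M b N mh hM.
have M0 : 0 <= M by exact: le_trans (hM 0).
have mhu : measurable_fun Omega (fun x => h (u x)) by exact: (measurableT_comp mh).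
have mhu_ k : measurable_fun Omega (fun x => h (u_ k x)) by exact: (measurableT_comp mh).
apply: (cvg_Rintegral_bounded mO iq mhu_ mhu (fun k x => hM _) (fun x => hM _)) => {b N} psi spsi.
(* For smooth psi, integrate by parts: prim h o u_k tends to prim h o u in L^1 on compact sets. *)
have ttheta := test_functionM tphi spsi; set theta := (fun x => phi x * psi x) in ttheta.
have [stheta [K [cK KO thetaK]]] := (test_functionP _ _).1 ttheta.
have mK := compact_rV_measurable cK.
have [C0 C00 thetaC] := test_function_bounded ttheta.
have [C1 C10 dthetaC] := test_function_bounded (test_function_partial i ttheta).
have dthetaK := partial_eq0 i (compact_rV_closed cK) thetaK.
have wc := weak_gradient_chain 0 oO mh hM wg.
have wc_ k := weak_gradient_chain 0 oO mh hM (wg_ k).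
have [lpu lhg wE] := wc; have {wE} := wE _ ttheta i => wE.
have ihg : mu.-integrable Omega (EFin \o (fun x => (h (u x) *: g x) 0 i * theta x)).
  by apply: intg_test => //; exact: lhg.
have lg_ k : locally_integrable_on Omega (fun x => g_ k x 0 i) by have [_ lgk _] := wg_ k; exact: lgk.
have lhg_ k : locally_integrable_on Omega (fun x => (h (u_ k x) *: g_ k x) 0 i).
  by have [_ lhg_ _] := wc_ k; exact: lhg_.
have ig : mu.-integrable Omega (EFin \o (fun x => g x 0 i * theta x)) by exact: intg_test.
have ig_ k : mu.-integrable Omega (EFin \o (fun x => g_ k x 0 i * theta x)) by exact: intg_test.
have ipu : mu.-integrable Omega (EFin \o (fun x => (0 + prim h (u x)) * partial i theta x)).
  by apply: intg_test => //; exact: test_function_partial.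
have ipu_ k : mu.-integrable Omega (EFin \o (fun x => (0 + prim h (u_ k x)) * partial i theta x)).
  apply: intg_test => //; last exact: test_function_partial.
  by have [] := wc_ k.
have iuk k : mu.-integrable K (EFin \o (fun x => u_ k x - u x)).
  by apply: intgB => //; [have [[_ lk] _ _] := wg_ k; exact: lk|exact: lu].
have igk k : mu.-integrable K (EFin \o (fun x => g_ k x 0 i - g x 0 i)).
  by apply: intgB => //; [have [_ lk] := lg_ k; exact: lk|exact: (lg i).2].
have iD k : mu.-integrable Omega (EFin \o (fun x => h (u_ k x) * (g_ k x 0 i * theta x - g x 0 i * theta x))).
  by apply: (intgMb mO (M := M)) => //; exact: intgB.
(* h(u_k) grad u is h(u_k) grad u_k, the weak gradient of prim h o u_k, minus an error carrying the
   factor grad u_k - grad u. *)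
have E k : \int[mu]_(x in Omega) (h (u_ k x) * (g x 0 i * phi x * psi x)) -
    \int[mu]_(x in Omega) (h (u x) * (g x 0 i * phi x * psi x)) =
    - (\int[mu]_(x in Omega) ((0 + prim h (u_ k x)) * partial i theta x -
         (0 + prim h (u x)) * partial i theta x)) -
    \int[mu]_(x in Omega) (h (u_ k x) * (g_ k x 0 i * theta x - g x 0 i * theta x)).
  have [_ _ wEk] := wc_ k; have {}wEk := wEk _ ttheta i.
  rewrite RintegralB// wE wEk !opprB opprK.
  rewrite (_ : \int[mu]_(x in Omega) (h (u x) * _) =
     \int[mu]_(x in Omega) ((h (u x) *: g x) 0 i * theta x)); last first.
    by apply: eq_Rintegral => x _; rewrite mxE /theta !mulrA.
  rewrite (_ : \int[mu]_(x in Omega) (h (u_ k x) * (g x 0 i * phi x * psi x)) =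
     \int[mu]_(x in Omega) ((h (u_ k x) *: g_ k x) 0 i * theta x) -
     \int[mu]_(x in Omega) (h (u_ k x) * (g_ k x 0 i * theta x - g x 0 i * theta x))).
    by ring.
  rewrite -RintegralB//; last exact: intg_test.
  by apply: eq_Rintegral => x _; rewrite mxE /theta; ring.
suff X0 : (\int[mu]_(x in Omega) (h (u_ k x) * (g x 0 i * phi x * psi x)) -
    \int[mu]_(x in Omega) (h (u x) * (g x 0 i * phi x * psi x))) @[k --> \oo] --> (0 : R).
  exact/subr_cvg0.
apply/norm_cvg0P; apply: (@squeeze_cvgr _ _ _ _ (fun=> 0) (fun k =>
   M * C1 * (\int[mu]_(x in K) `|u_ k x - u x|) +
   M * C0 * (\int[mu]_(x in K) `|g_ k x 0 i - g x 0 i|))); last 2 first.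
- exact: cvg_cst.
- rewrite -[X in _ --> X](addr0 0) -[X in X + _](mulr0 (M * C1)) -[X in _ + X](mulr0 (M * C0)).
  by apply: cvgD; apply: cvgM; [exact: cvg_cst|exact: cu|exact: cvg_cst|exact: cg].
apply: nearW => k; rewrite normr_ge0/= E.
have inu := intg_norm (iuk k); have ing := intg_norm (igk k).
rewrite (le_trans (ler_normB _ _))// normrN lerD//.
- have i1 := intgB mO (ipu_ k) ipu.
  have i1n := intg_norm i1.
  apply: (le_trans (le_normr_Rintegral mO i1)).
  rewrite (Rintegral_supportK KO); last by move=> x /dthetaK ->; rewrite !mulr0 subrr normr0.
  rewrite -RintegralZl//; apply: le_Rintegral => //.
  + exact: integrableS i1n.
  + exact: intgZ.
  + move=> x _; rewrite !add0r -mulrBl normrM mulrAC ler_pM//.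
    exact: prim_lipschitz.
- apply: (le_trans (le_normr_Rintegral mO (iD k))).
  rewrite (Rintegral_supportK KO); last by move=> x /thetaK ->; rewrite !mulr0 subrr mulr0 normr0.
  rewrite -RintegralZl//; apply: le_Rintegral => //.
  + exact: integrableS (intg_norm (iD k)).
  + exact: intgZ.
  + move=> x _; rewrite -mulrBl normrM [X in _ * X]normrM -mulrA ler_pM ?mulr_ge0//.
    by rewrite mulrC ler_wpM2r.
Qed.

(** Multiplied by a test function, the difference of the gradients is integrable and orthogonal to
    all smooth functions, hence null. Countably many test functions cover [Omega]. *)
Lemma weak_gradient_unique Omega u g g' : open Omega ->
  weak_gradient Omega u g -> weak_gradient Omega u g' ->
  {ae mu, forall x, Omega x -> g x = g' x}.
Proof.
move=> oO [_ lg wg] [_ lg' wg'].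
have mO : measurable Omega by exact: rV_open_measurable.
have [phi_ [tphi phic]] := test_function_cover oO.
have H q i : {ae mu, forall x, ((fun x => (g x 0 i - g' x 0 i) * phi_ q x) \_ Omega) x = 0}.
  set rho := (_ \_ Omega).
  have i1 := intg_test mO (lg i) (tphi q).
  have i2 := intg_test mO (lg' i) (tphi q).
  have irhoO : mu.-integrable Omega (EFin \o (fun x => (g x 0 i - g' x 0 i) * phi_ q x)).
    by apply: eq_integrable (intgB mO i1 i2) => // x _; rewrite /= mulrBl.
  have irho : mu.-integrable setT (EFin \o rho) by exact: intg_restrict.
  have rho0 : \int[mu]_x `|rho x| = 0.
    apply: smooth_orthogonal => // psi spsi _.
    have t' := test_functionM (tphi q) spsi.
    have j1 := intg_test mO (lg i) t'; have j2 := intg_test mO (lg' i) t'.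
    transitivity (\int[mu]_(x in Omega) (g x 0 i * (phi_ q x * psi x) -
        g' x 0 i * (phi_ q x * psi x))).
      rewrite [RHS]Rintegral_mkcond; apply: eq_Rintegral => x _; rewrite /rho /patch.
      by case: ifP => _; rewrite ?mul0r//; ring.
    by rewrite RintegralB//; have := wg _ t' i; rewrite (wg' _ t' i) => /oppr_inj ->; rewrite subrr.
  have mrho := intg_measurable irho.
  have := (ae_eq_integral_abs mu measurableT (f := EFin \o rho) _).1.
  have mErho : measurable_fun setT (EFin \o rho) by exact/measurable_EFinP.
  move=> /(_ mErho); have E0 : (\int[mu]_x `|(EFin \o rho) x|)%E = 0%E.
    by have := EFin_Rintegral measurableT (intg_norm irho); rewrite rho0 => <-.
  move=> /(_ E0); apply: filterS => x /(_ I)/= [].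
  by [].
have H' : {ae mu, forall x, forall q i,
    ((fun x => (g x 0 i - g' x 0 i) * phi_ q x) \_ Omega) x = 0}.
  by apply: ae_foralln => q; apply: filter_forall => i; exact: H.
apply: filterS H' => x Hx Ox; apply/rowP => i.
have [q phiq] := phic x Ox.
have := Hx q i; rewrite /patch mem_set// => /eqP.
by rewrite mulf_eq0 (negPf phiq) orbF subr_eq0 => /eqP.
Qed.

End superposition_convergence.

(** The measure with density [a] is absolutely continuous with respect to those with densities |w_j|
    taken together, and the [d_ k] share a bound, so smallness against each [w_ j] carries over to
    [a]. *)
Lemma cvg_weighted_dominated d (T : measurableType d) (R : realType) (m : {measure set T -> \bar R})
    (D : set T) (a : T -> R) (w_ d_ : nat -> T -> R) (B : R) :
  measurable D -> m.-integrable D (EFin \o a) -> (forall x, D x -> 0 <= a x) ->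
  (forall k, measurable_fun D (d_ k)) -> (forall k x, `|d_ k x| <= B) ->
  (forall j, m.-integrable D (EFin \o w_ j)) ->
  (forall j, \int[m]_(x in D) (`|d_ k x| * `|w_ j x|) @[k --> \oo] --> (0 : R)) ->
  (forall x, D x -> a x != 0 -> exists j, w_ j x != 0) ->
  \int[m]_(x in D) (`|d_ k x| * a x) @[k --> \oo] --> (0 : R).
Proof.
move=> mD ia a0 md dB iw dw aw.
have B0 : 0 <= B by apply: le_trans (dB 0 point).
have ma := intg_measurable ia.
pose s l x := \sum_(j < l) `|w_ j x|.
have s0 l x : 0 <= s l x by apply: sumr_ge0.
have ms l : measurable_fun D (s l).
  by apply: measurable_sum => j; apply: measurableT_comp => //; exact: intg_measurable (iw j).
have ids l : (forall k, m.-integrable D (EFin \o (fun x => `|d_ k x| * s l x))) /\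
    \int[m]_(x in D) (`|d_ k x| * s l x) @[k --> \oo] --> (0 : R).
  elim: l => [|l [IHi IHc]].
    have E0 k : (fun x => `|d_ k x| * s 0 x) = cst 0.
      by apply/funext => x; rewrite /s big_ord0 mulr0.
    split => [k|].
      by rewrite E0; exact: integrable0.
    under eq_fun do rewrite E0 Rintegral_cst// mul0r.
    exact: cvg_cst.
  have iwl k : m.-integrable D (EFin \o (fun x => `|d_ k x| * `|w_ l x|)).
    apply: (intgMb mD (M := B)); first exact: intg_norm.
      exact: measurableT_comp.
    by move=> x _; rewrite normr_id.
  have ES k : (fun x => `|d_ k x| * s l.+1 x) =
      fun x => `|d_ k x| * s l x + `|d_ k x| * `|w_ l x|.
    by apply/funext => x; rewrite /s big_ord_recr mulrDr.
  split => [k|]; first by rewrite ES; exact: intgD.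
  have EI k : \int[m]_(x in D) (`|d_ k x| * s l.+1 x) =
      \int[m]_(x in D) (`|d_ k x| * s l x) + \int[m]_(x in D) (`|d_ k x| * `|w_ l x|).
    by rewrite ES RintegralD.
  under eq_fun do rewrite EI.
  have C := cvgD IHc (dw l); rewrite addr0 in C; exact: C.
(* Outside E l, a is at most l * s l, and the E l shrink to the empty set. *)
pose E l : set T := [set x | l%:R * s l x < a x].
have mE l : measurable_fun D (\1_(E l) : T -> R).
  have -> : \1_(E l) = (fun b : bool => b%:R : R) \o (fun x => l%:R * s l x < a x).
    apply/funext => x; rewrite indicE /=; congr (_%:R); congr nat_of_bool.
    by apply/idP/idP; rewrite inE.
  apply: (measurableT_comp (f := fun b : bool => b%:R : R)) => //.
  by apply: measurable_fun_ltr => //; exact: measurable_funM.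
have ind1 l x : `|\1_(E l) x| <= 1 :> R.
  by rewrite indicE; case: (_ \in _); rewrite ?normr1 ?normr0.
have iEa l : m.-integrable D (EFin \o (fun x => \1_(E l) x * a x)).
  exact: (intgMb mD (M := 1)).
have [||||_ _ Ea0] := @Rdominated_convergence _ _ R m D
    (fun l x => \1_(E l) x * a x) (fun=> 0) a mD.
- by move=> l; exact: intg_measurable (iEa l).
- exact: ia.
- by move=> l x Dx; rewrite normrM (ger0_norm (a0 x Dx)) ler_piMl// a0.
- move=> x Dx; apply: cvg_near_cst.
  have [ax|ax] := eqVneq (a x) 0; first by apply: nearW => l; rewrite ax mulr0.
  have [j wj] := aw x Dx ax.
  have wj0 : 0 < `|w_ j x| by rewrite normr_gt0.
  exists (maxn j.+1 (Num.truncn (a x / `|w_ j x|)).+1) => // l /=.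
  rewrite geq_max => /andP[jl al].
  rewrite indicE memNset ?mul0r// /E/=; apply/negP; rewrite -leNgt.
  apply: (@le_trans _ _ (l%:R * `|w_ j x|)).
    rewrite -ler_pdivrMr//; apply: ltW; apply: (lt_le_trans (truncnS_gt _)).
    by rewrite ler_nat.
  by rewrite ler_wpM2l// /s (bigD1 (Ordinal jl))//= lerDl sumr_ge0.
rewrite Rintegral_cst// mul0r in Ea0.
apply/cvgr0Pnorm_lt => e e0.
have e2 : 0 < e / 2 / (B + 1) by rewrite !divr_gt0// ltr_wpDl.
have /cvgr0Pnorm_lt/(_ _ e2)[l _ /(_ l (leqnn l))] := Ea0.
rewrite ger0_norm; last first.
  by apply: Rintegral_ge0 => x Dx; rewrite mulr_ge0// ?indicE// a0.
move=> El.
have [idsl cdsl] := ids l.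
have e3 : 0 < e / 2 / (l%:R + 1) by rewrite !divr_gt0// ltr_wpDl.
move/cvgr0Pnorm_lt/(_ _ e3) : cdsl; apply: filterS => k.
rewrite ger0_norm; last by apply: Rintegral_ge0 => x _; rewrite mulr_ge0.
move=> dk.
have ida : m.-integrable D (EFin \o (fun x => `|d_ k x| * a x)).
  apply: (intgMb mD (M := B)) => //; first exact: measurableT_comp.
  by move=> x _; rewrite normr_id.
rewrite ger0_norm; last by apply: Rintegral_ge0 => x Dx; rewrite mulr_ge0// a0.
have : \int[m]_(x in D) (`|d_ k x| * a x) <=
    \int[m]_(x in D) (B * (\1_(E l) x * a x) + l%:R * (`|d_ k x| * s l x)).
  apply: le_Rintegral => //; first by apply: intgD => //; exact: intgZ.
  move=> x Dx; rewrite indicE; have [|] := boolP (x \in E l).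
    rewrite inE /E/= => _; rewrite mul1r.
    rewrite (@le_trans _ _ (B * a x))// ?ler_wpM2r ?a0//.
    by rewrite lerDl !mulr_ge0.
  move=> /negP; rewrite inE /E/= => /negP; rewrite -leNgt => al.
  by rewrite mul0r mulr0 add0r mulrCA ler_wpM2l.
move=> /le_lt_trans; apply.
rewrite RintegralD//; [|exact: intgZ|exact: intgZ].
rewrite !RintegralZl// (splitr e) ltrD//.
  rewrite (@le_lt_trans _ _ ((B + 1) * \int[m]_(x in D) (\1_(E l) x * a x)))//.
    rewrite ler_wpM2r ?lerDl//.
    by apply: Rintegral_ge0 => x Dx; rewrite mulr_ge0// ?indicE// a0.
  by rewrite -ltr_pdivlMl ?ltr_wpDl// mulrC.
rewrite (@le_lt_trans _ _ ((l%:R + 1) * \int[m]_(x in D) (`|d_ k x| * s l x)))//.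
  rewrite ler_wpM2r ?lerDl//.
  by apply: Rintegral_ge0 => x _; rewrite mulr_ge0.
by rewrite -ltr_pdivlMl ?ltr_wpDl// mulrC.
Qed.

(** * Modulars and convergence in L^1 *)

Section orlicz_modular.
Context {R : realType} {n : nat}.
Local Notation mu := (@lebesgue_rV R n).
Variables (A : R -> \bar R) (Omega : set 'rV[R]_n).
Hypotheses (YA : young_function A) (NA : young_nondegenerate A) (mO : measurable Omega).
Implicit Types w : 'rV[R]_n -> R.
Local Open Scope ereal_scope.

Lemma measurable_young_scaled w (lam : R) : (0 < lam)%R -> measurable_fun Omega w ->
  (forall x, Omega x -> (0 <= w x)%R) -> measurable_fun Omega (fun x => A (w x / lam)%R).
Proof.
move=> lam0 mw w0; apply: (measurable_young YA mO (w := fun x => w x / lam)%R).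
  exact: measurable_funM.
by move=> x /w0 wx; rewrite divr_ge0// ltW.
Qed.

Lemma orlicz_modular_ge0 w (lam : R) : (0 < lam)%R ->
  (forall x, Omega x -> (0 <= w x)%R) -> 0 <= orlicz_modular A Omega w lam.
Proof.
move=> lam0 w0; apply: integral_ge0 => x /w0 wx; apply: (young_ge0 YA).
by rewrite divr_ge0// ltW.
Qed.

Lemma orlicz_modular_le w w' (lam lam' : R) : (0 < lam)%R -> (0 < lam')%R ->
  measurable_fun Omega w -> measurable_fun Omega w' ->
  (forall x, Omega x -> (0 <= w x)%R) ->
  (forall x, Omega x -> (w x / lam <= w' x / lam')%R) ->
  orlicz_modular A Omega w lam <= orlicz_modular A Omega w' lam'.
Proof.
move=> l0 l0' mw mw' w0 ww'.
have wl x : Omega x -> (0 <= w x / lam)%R by move=> /w0 wx; rewrite divr_ge0// ltW.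
apply: ge0_le_integral => //.
- by move=> x /wl; exact: (young_ge0 YA).
- exact: measurable_young_scaled.
- apply: measurable_young_scaled => // x Ox.
  rewrite -(@pmulr_lge0 _ lam'^-1) ?invr_gt0//.
  by rewrite (le_trans (wl x Ox))// ww'.
- by move=> x Ox; apply: (young_le YA); [exact: wl|exact: ww'].
Qed.

(** [young_linear_lower] at w_k / lam bounds w_k by [lam * eps], small on a set of finite measure,
    plus a multiple of A (w_k / lam), which the modular controls. Nondegeneracy enters as A eps > 0
    for arbitrarily small eps. *)
Lemma modular_cvg_L1 (w_ : nat -> 'rV[R]_n -> R) (lam : R) (K : set 'rV[R]_n) :
  (0 < lam)%R -> (forall k, measurable_fun Omega (w_ k)) -> (forall k x, (0 <= w_ k x)%R) ->
  orlicz_modular A Omega (w_ k) lam @[k --> \oo] --> 0 ->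
  measurable K -> mu K < +oo -> K `<=` Omega ->
  (forall k, mu.-integrable K (EFin \o w_ k)) ->
  (\int[mu]_(x in K) w_ k x)%R @[k --> \oo] --> (0 : R)%R.
Proof.
move=> l0 mw w0 cw mK Koo KO iw.
have [t0 t00 At0] := young_fin YA.
have Kfin : mu K \is a fin_num by rewrite ge0_fin_numE.
pose mk := fine (mu K).
have mk0 : (0 <= mk)%R by exact: fine_ge0.
apply/cvgr0Pnorm_lt => e e0.
(* [eps <= t0] keeps [A eps] finite, and the other bound gives [lam * eps * mk <= e / 2]. The
   modular then has to fall below [e / 2 / c]. *)
pose eps := Num.min t0 (e / 2 / (lam * (mk + 1)))%R.
have lm0 : (0 < lam * (mk + 1))%R by rewrite mulr_gt0// ltr_wpDl.
have eps0 : (0 < eps)%R by rewrite lt_min t00 !divr_gt0.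
have Aeps : A eps < +oo.
  by apply: le_lt_trans At0; apply: (young_le YA); [exact: ltW|rewrite ge_min lexx].
have Aeps0 := NA eps0.
pose c := (lam * (eps / fine (A eps)))%R.
have a0 : (0 < fine (A eps))%R by rewrite fine_gt0// Aeps0.
have c0 : (0 < c)%R by rewrite mulr_gt0// divr_gt0.
have e2c : (0 < e / 2 / c)%R by rewrite !divr_gt0.
have /fine_cvgP[cfin /cvgr0Pnorm_lt/(_ _ e2c) cn] := cw.
near=> k.
rewrite ger0_norm; last by apply: Rintegral_ge0 => x _; exact: w0.
have Ifin : orlicz_modular A Omega (w_ k) lam \is a fin_num by near: k.
have Ismall : (fine (orlicz_modular A Omega (w_ k) lam) < e / 2 / c)%R.
  by apply: (le_lt_trans (ler_norm _)); near: k.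
have mAK : measurable_fun K (fun x => A (w_ k x / lam)%R).
  apply: measurable_funS (measurable_young_scaled l0 (mw k) _) => //.
have A0 x : 0 <= A (w_ k x / lam)%R.
  by apply: (young_ge0 YA); rewrite divr_ge0// ltW.
rewrite -lte_fin (EFin_Rintegral mK (iw k)).
have Le : \int[mu]_(x in K) (w_ k x)%:E <=
    (lam * eps)%:E * mu K + c%:E * orlicz_modular A Omega (w_ k) lam.
  apply: (@le_trans _ _ (\int[mu]_(x in K) ((lam * eps)%:E + c%:E * A (w_ k x / lam)%R))).
    apply: ge0_le_integral => //.
    - by move=> x _; rewrite lee_fin.
    - exact: measurable_int (iw k).
    - by apply: emeasurable_funD => //; exact: measurable_funeM.
    - move=> x _.
      have wl : (0 <= w_ k x / lam)%R by rewrite divr_ge0// ltW.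
      have := young_linear_lower YA eps0 Aeps Aeps0 wl.
      move=> /(lee_wpmul2l (_ : 0 <= lam%:E)); rewrite lee_fin => /(_ (ltW l0)).
      rewrite -EFinM mulrC divfK ?gt_eqF// ge0_muleDr//.
      + by rewrite muleA -!EFinM.
      + by rewrite lee_fin ltW.
      + by rewrite mule_ge0// lee_fin ltW// divr_gt0.
  rewrite ge0_integralD//; first last.
  - exact: measurable_funeM.
  - by move=> x _; rewrite mule_ge0// lee_fin ltW.
  - by move=> x _; rewrite lee_fin mulr_ge0// ltW.
  rewrite integral_cst// ge0_integralZl//; last by rewrite lee_fin ltW.
  rewrite leeD2l// lee_wpmul2l//; first by rewrite lee_fin ltW.
  apply: ge0_subset_integral => //.
  by apply: measurable_young_scaled.
apply: (le_lt_trans Le); rewrite -(fineK Kfin) -(fineK Ifin) -!EFinM -EFinD lte_fin.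
rewrite (splitr e) ler_ltD//; last by rewrite -ltr_pdivlMl// mulrC.
rewrite -/mk mulrAC (@le_trans _ _ (lam * (mk + 1) * eps))%R//.
  by rewrite ler_wpM2r ?(ltW eps0)// ler_wpM2l ?(ltW l0)// lerDl.
by rewrite -ler_pdivlMl// mulrC ge_min lexx orbT.
Unshelve. all: by end_near. Qed.

End orlicz_modular.

(** [lipschitz] provides the inequality for all constants beyond some threshold, which may be
    negative; a positive one is selected because it will enter scales. *)
Lemma lipschitz_bound (R : realType) (f : R -> R) : lipschitz f ->
  exists2 L : R, 0 < L & forall x y, `|f x - f y| <= L * `|x - y|.
Proof.
move=> [L [_ hL]]; exists (Num.max 0 L + 1) => [|x y].
  by rewrite ltr_wpDl// le_max lexx.
apply: (hL _ _ (x, y)) => //=.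
by rewrite (@le_lt_trans _ _ (Num.max 0 L))// ?le_max ?lexx ?orbT// ltrDl.
Qed.

(** * Superposition in Orlicz spaces *)

Section superposition.
Context {R : realType} {n : nat}.
Local Notation mu := (@lebesgue_rV R n).
Variables (A : R -> \bar R) (Omega : set 'rV[R]_n).
Hypotheses (YA : young_function A) (oO : open Omega).
Implicit Types (u : 'rV[R]_n -> R) (g : 'rV[R]_n -> 'rV[R]_n).

Let mO : measurable Omega. Proof. exact: rV_open_measurable. Qed.

(** On a set of infinite measure f 0 = 0 gives |f(u)| <= L |u|. Otherwise |f(u)| <= |f 0| + L |u|,
    and the constant is scaled down to where [A] is finite. *)
Lemma orlicz_lipschitz f (L : R) u : 0 < L -> (forall x y, `|f x - f y| <= L * `|x - y|) ->
  (mu Omega = +oo%E -> f 0 = 0) -> orlicz A Omega u -> orlicz A Omega (f \o u).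
Proof.
move=> L0 hf f0 [mu_ [lam l0 lamoo]].
have mfu : measurable_fun Omega (f \o u).
  apply: measurableT_comp => //; apply: continuous_measurable_fun.
  exact: lipschitz_continuous hf.
have mau : measurable_fun Omega (fun x => `|u x|) by exact: measurableT_comp.
have mafu : measurable_fun Omega (fun x => `|(f \o u) x|) by exact: measurableT_comp.
split => //.
have [Ooo|Ofin] := eqVneq (mu Omega) +oo%E.
  have Ll0 : 0 < L * lam by rewrite mulr_gt0.
  exists (L * lam) => //; apply: le_lt_trans lamoo.
  apply: orlicz_modular_le => // x Ox.
  rewrite ler_pdivrMr// (_ : _ * (L * lam) = L * `|u x|); last by field; rewrite gt_eqF.
  by have := hf (u x) 0; rewrite f0// !subr0.
have [t0 t00 At0] := young_fin YA.
pose c := `|f 0| + 1; have c0 : 0 < c by rewrite ltr_wpDl.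
(* The summands give 2 c / lam' <= t0 and 2 L |u| / lam' <= |u| / lam; the factors 2 come from
   [young_addition]. *)
pose lam' := 2 * c / t0 + 2 * L * lam.
have c1 : 0 < 2 * c / t0 by rewrite divr_gt0// mulr_gt0.
have c2 : 0 < 2 * L * lam by rewrite !mulr_gt0.
have l'0 : 0 < lam' by rewrite addr_gt0.
exists lam' => //.
have bound x : (A (`|(f \o u) x| / lam') <= A t0 + A (`|u x| / lam))%E.
  have p0 : 0 <= c / lam' by rewrite divr_ge0// ltW.
  have q0 : 0 <= L * `|u x| / lam' by rewrite divr_ge0 ?mulr_ge0// ltW.
  have := young_addition YA p0 q0.
  have /(young_le YA) : 0 <= `|(f \o u) x| / lam' by rewrite divr_ge0// ltW.
  move=> /(_ (c / lam' + L * `|u x| / lam')) H1 H2.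
  apply: le_trans (le_trans (H1 _) H2) _.
    rewrite -mulrDl ler_pM2r ?invr_gt0//= /c.
    have := hf (u x) 0; rewrite subr0 => H.
    by have := ler_normD (f (u x) - f 0) (f 0); rewrite subrK; lra.
  apply: leeD; apply: (young_le YA).
  - by rewrite mulr_ge0.
  - by rewrite mulrA ler_pdivrMr// [leRHS]mulrC -ler_pdivrMr// /lam' lerDl ltW.
  - by rewrite mulr_ge0.
  - rewrite mulrA ler_pdivrMr// mulrAC ler_pdivlMr// mulrA mulrAC [leRHS]mulrC.
    by rewrite ler_wpM2r// /lam' lerDr ltW.
apply: (@le_lt_trans _ _ (\int[mu]_(x in Omega) (A t0 + A (`|u x| / lam)))%E).
  apply: ge0_le_integral => //.
  - by move=> x _; apply: (young_ge0 YA); rewrite divr_ge0// ltW.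
  - exact: (@measurable_young_scaled _ _ _ _ YA mO (fun x => `|(f \o u) x|)).
  - apply: emeasurable_funD => //.
    exact: (@measurable_young_scaled _ _ _ _ YA mO (fun x => `|u x|)).
rewrite ge0_integralD//.
- rewrite integral_cst// lte_add_pinfty//.
  rewrite lte_mul_pinfty//; first by apply: (young_ge0 YA); exact: ltW.
  + by rewrite ge0_fin_numE//; apply: (young_ge0 YA); exact: ltW.
  + by rewrite ltey.
- by move=> x _; apply: (young_ge0 YA); exact: ltW.
- by move=> x _; apply: (young_ge0 YA); rewrite divr_ge0// ltW.
- exact: (@measurable_young_scaled _ _ _ _ YA mO (fun x => `|u x|)).
Qed.

Lemma orlicz_vec_scale (b : 'rV[R]_n -> R) g (M : R) : 0 < M ->
  measurable_fun Omega b -> (forall x, `|b x| <= M) ->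
  orlicz_vec A Omega g -> orlicz_vec A Omega (fun x => b x *: g x).
Proof.
move=> M0 mb bM [mg [lam l0 lamoo]].
have mgi i : measurable_fun Omega (fun x => g x 0 i).
  exact: (measurableT_comp (measurable_coord i) mg).
have mbgi i : measurable_fun Omega (fun x => (b x *: g x) 0 i).
  by under eq_fun do rewrite mxE; exact: measurable_funM.
split; first exact: measurable_rV_coordP.
have Ml0 : 0 < M * lam by rewrite mulr_gt0.
exists (M * lam) => //; apply: le_lt_trans lamoo.
apply: orlicz_modular_le => //.
- exact: measurable_euclidean_norm.
- exact: measurable_euclidean_norm.
- by move=> x _; exact: euclidean_norm_ge0.
move=> x _; rewrite ler_pdivrMr// euclidean_normZ.
rewrite (_ : _ * (M * lam) = M * euclidean_norm (g x)); last by field; rewrite gt_eqF.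
by rewrite ler_wpM2r ?euclidean_norm_ge0.
Qed.

Lemma modular_cvg_lipschitz f (L : R) (u_ : nat -> 'rV[R]_n -> R) u : 0 < L ->
  (forall x y, `|f x - f y| <= L * `|x - y|) ->
  (forall k, measurable_fun Omega (u_ k)) -> measurable_fun Omega u ->
  modular_cvg A Omega u_ u -> modular_cvg A Omega (fun k => f \o u_ k) (f \o u).
Proof.
move=> L0 hf mu_ mu0 [lam l0 cu].
have mf : measurable_fun setT f.
  by apply: continuous_measurable_fun; exact: lipschitz_continuous hf.
have Ll0 : 0 < L * lam by rewrite mulr_gt0.
exists (L * lam) => //; apply: squeeze_cvge cu; last exact: cvg_cst.
apply: nearW => k; apply/andP; split; first exact: orlicz_modular_ge0.
apply: orlicz_modular_le => //.
- by apply: measurableT_comp => //; apply: measurable_funB; exact: measurableT_comp.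
- by apply: measurableT_comp => //; exact: measurable_funB.
move=> x _; rewrite ler_pdivrMr//.
rewrite (_ : _ * (L * lam) = L * `|u_ k x - u x|); last by field; rewrite gt_eqF.
exact: hf.
Qed.

(** Split b v - c w = b (v - w) + (b - c) w. The weak triangle inequality costs a factor 2 and
    [young_addition] another, leaving 4 M |v - w| and 4 |b - c| |w| over the new scale. Its summand
    4 M l1 brings the first below |v - w| / l1; 8 M l2 brings the second below |b - c| / (2 M) times
    |w| / l2, where the factor is at most 1 and leaves [A] by convexity. *)
Lemma young_scale_diff (b c M l1 l2 : R) (v w : 'rV[R]_n) : 0 < M -> 0 < l1 -> 0 < l2 ->
  `|b| <= M -> `|c| <= M ->
  (A (euclidean_norm (b *: v - c *: w) / (4 * M * l1 + 8 * M * l2))%R <=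
   A (euclidean_norm (v - w) / l1)%R +
     (`|b - c| / (2 * M))%:E * A (euclidean_norm w / l2)%R)%E.
Proof.
move=> M0 l10 l20 bM cM; set lam := _ + 8 * M * l2.
have h1 : 0 < 4 * M * l1 by rewrite !mulr_gt0.
have h2 : 0 < 8 * M * l2 by rewrite !mulr_gt0.
have lam0 : 0 < lam by rewrite addr_gt0.
have N1 := euclidean_norm_ge0 (v - w); have N2 := euclidean_norm_ge0 w.
set N := euclidean_norm (v - w) in N1 *; set W := euclidean_norm w in N2 *.
have p0 : 0 <= 2 * M * N / lam by rewrite divr_ge0 ?mulr_ge0// ltW.
have q0 : 0 <= 2 * `|b - c| * W / lam by rewrite divr_ge0 ?mulr_ge0// ltW.
have le1 : euclidean_norm (b *: v - c *: w) / lam <=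
    2 * M * N / lam + 2 * `|b - c| * W / lam.
  rewrite -mulrDl ler_pM2r ?invr_gt0//.
  have -> : b *: v - c *: w = b *: (v - w) + (b - c) *: w.
    by rewrite scalerBr scalerBl addrA subrK.
  apply: (le_trans (euclidean_normD_le _ _)); rewrite !euclidean_normZ -/N -/W.
  by rewrite mulrDr !mulrA lerD2r ler_wpM2r// ler_wpM2l.
have := young_le YA _ le1; rewrite divr_ge0 ?euclidean_norm_ge0 ?(ltW lam0)// => /(_ isT).
move=> /le_trans; apply; apply: (le_trans (young_addition YA p0 q0)); apply: leeD.
  apply: (young_le YA); first by rewrite mulr_ge0.
  rewrite mulrA ler_pdivrMr// [leRHS]mulrAC ler_pdivlMr//.
  by rewrite (_ : _ * l1 = N * (4 * M * l1)); [rewrite ler_wpM2l// lerDl ltW|ring].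
have th : 0 <= `|b - c| / (2 * M) <= 1.
  rewrite divr_ge0//= ?mulr_ge0// ?(ltW M0)// ler_pdivrMr ?mulr_gt0// mul1r.
  by rewrite (le_trans (ler_normB _ _))// mulr_natl mulr2n lerD.
have Wl0 : 0 <= W / l2 by rewrite divr_ge0// ltW.
apply: le_trans (young_scale YA th Wl0); apply: (young_le YA); first by rewrite mulr_ge0.
rewrite [leLHS]mulrA ler_pdivrMr//.
have -> : `|b - c| / (2 * M) * (W / l2) * lam =
    `|b - c| * W * (4 * M * l1) / (2 * M * l2) + 2 * (2 * `|b - c| * W).
  by rewrite /lam; field; rewrite !gt_eqF.
by rewrite lerDr divr_ge0 ?mulr_ge0// ?(ltW M0) ?(ltW l10) ?(ltW l20)//.
Qed.

End superposition.

(** * Modular convergence of the gradients *)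

Section superposition_gradient.
Context {R : realType} {n : nat}.
Local Notation mu := (@lebesgue_rV R n).
Variables (A : R -> \bar R) (Omega : set 'rV[R]_n).
Hypotheses (YA : young_function A) (NA : young_nondegenerate A) (oO : open Omega).
Implicit Types (u : 'rV[R]_n -> R) (g : 'rV[R]_n -> 'rV[R]_n).

Let mO : measurable Omega. Proof. exact: rV_open_measurable. Qed.

Lemma modular_cvg_L1_loc (w_ : nat -> 'rV[R]_n -> R) (lam : R) (K : set 'rV[R]_n) :
  0 < lam -> (forall k, locally_integrable_on Omega (w_ k)) ->
  orlicz_modular A Omega (fun x => `|w_ k x|) lam @[k --> \oo] --> 0%E ->
  compact K -> K `<=` Omega ->
  \int[mu]_(x in K) `|w_ k x| @[k --> \oo] --> (0 : R).
Proof.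
move=> l0 lw cw cK KO.
apply: (@modular_cvg_L1 _ _ A Omega YA NA mO (fun k x => `|w_ k x|) lam K l0) => //.
- by move=> k; apply: measurableT_comp => //; have [] := lw k.
- exact: compact_rV_measurable.
- exact: compact_rV_lty.
- by move=> k; apply: intg_norm; have [_] := lw k; apply.
Qed.

Lemma locally_integrableB (v w : 'rV[R]_n -> R) : locally_integrable_on Omega v ->
  locally_integrable_on Omega w -> locally_integrable_on Omega (fun x => v x - w x).
Proof.
move=> [mv iv] [mw iw]; split => [|K cK KO]; first exact: measurable_funB.
by apply: (intgB (compact_rV_measurable cK)); [exact: iv|exact: iw].
Qed.

Lemma modular_cvg_chain u g (u_ : nat -> 'rV[R]_n -> R) (g_ : nat -> 'rV[R]_n -> 'rV[R]_n)
    (h : R -> R) (M l2 : R) :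
  (forall k, weak_gradient Omega (u_ k) (g_ k)) -> weak_gradient Omega u g ->
  modular_cvg A Omega u_ u -> modular_cvg_vec A Omega g_ g ->
  0 < l2 -> (orlicz_modular A Omega (fun x => euclidean_norm (g x)) l2 < +oo)%E ->
  measurable_fun setT h -> 0 < M -> (forall s, `|h s| <= M) ->
  modular_cvg_vec A Omega (fun k x => h (u_ k x) *: g_ k x) (fun x => h (u x) *: g x).
Proof.
move=> wg_ wg [lu lu0 cu] [l1 l10 cg] l20 gl2 mh M0 hM.
have [lu_k lgk] : (forall k, locally_integrable_on Omega (u_ k)) /\
    (forall k i, locally_integrable_on Omega (fun x => g_ k x 0 i)).
  by split => k; have [] := wg_ k.
have [lu_ lg _] := wg.
have mgi i : measurable_fun Omega (fun x => g x 0 i) by have [] := lg i.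
have mgki k i : measurable_fun Omega (fun x => g_ k x 0 i) by have [] := lgk k i.
have mdi k i : measurable_fun Omega (fun x => (g_ k x - g x) 0 i).
  by under eq_fun do rewrite !mxE; exact: measurable_funB.
have mN : measurable_fun Omega (fun x => euclidean_norm (g x)).
  exact: measurable_euclidean_norm.
have mNk k : measurable_fun Omega (fun x => euclidean_norm (g_ k x - g x)).
  exact: measurable_euclidean_norm.
have mhu_ k : measurable_fun Omega (fun x => h (u_ k x)).
  by apply: (measurableT_comp mh); have [] := lu_k k.
have mhu : measurable_fun Omega (fun x => h (u x)).
  by apply: (measurableT_comp mh); have [] := lu_.
pose a x := A (euclidean_norm (g x) / l2).
have a0 x : (0 <= a x)%E.
  by apply: (young_ge0 YA); rewrite divr_ge0 ?euclidean_norm_ge0// ltW.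
have ma : measurable_fun Omega a.
  apply: (@measurable_young_scaled _ _ _ _ YA mO (fun x => euclidean_norm (g x))) => //.
  by move=> x _; exact: euclidean_norm_ge0.
have ia : mu.-integrable Omega a.
  apply/integrableP; split => //.
  by under eq_integral do rewrite gee0_abs//.
(* The weight may be +oo somewhere, but being integrable it is finite almost everywhere, so its
   real-valued version can be used. *)
have [iar _] := fine_integral mO ia.
have [phi_ [tphi phic]] := test_function_cover oO.
pose w_ (j : nat) : 'rV[R]_n -> R :=
  if @unpickle (nat * 'I_n)%type j is Some qi
  then fun x => g x 0 qi.2 * phi_ qi.1 x else fun=> 0.
pose d_ k x := h (u_ k x) - h (u x).
have md k : measurable_fun Omega (d_ k) by exact: measurable_funB.
have dM k x : `|d_ k x| <= 2 * M.
  by rewrite (le_trans (ler_normB _ _))// mulr_natl mulr2n lerD.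
have cuK K : compact K -> K `<=` Omega ->
    \int[mu]_(x in K) `|u_ k x - u x| @[k --> \oo] --> (0 : R).
  apply: (modular_cvg_L1_loc lu0) cu => k; exact: locally_integrableB.
have cgK i K : compact K -> K `<=` Omega ->
    \int[mu]_(x in K) `|g_ k x 0 i - g x 0 i| @[k --> \oo] --> (0 : R).
  apply: (modular_cvg_L1_loc l10) => [k|]; first exact: locally_integrableB.
  apply: squeeze_cvge cg; last exact: cvg_cst.
  apply: nearW => k; apply/andP; split; first exact: orlicz_modular_ge0.
  apply: orlicz_modular_le => //.
    by apply: measurableT_comp => //; exact: measurable_funB.
  move=> x _; rewrite ler_pM2r ?invr_gt0//.
  by have := coord_le_euclidean_norm (g_ k x - g x) i; rewrite !mxE.
have cda : \int[mu]_(x in Omega) (`|d_ k x| * fine (a x)) @[k --> \oo] --> (0 : R).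
  apply: (@cvg_weighted_dominated _ _ R mu Omega (fine \o a) w_ d_ (2 * M)) => //.
  - by move=> x _; exact: fine_ge0.
  - rewrite /w_ => j; case: (unpickle j) => [[q i]|]; first exact: intg_test.
    exact: integrable0.
  - rewrite /w_ => j; case: (unpickle j) => [[q i]|].
      exact: (marcus_mizel oO wg_ wg cuK (cgK i) (tphi q) mh hM).
    under eq_fun do under eq_Rintegral do rewrite normr0 mulr0.
    by under eq_fun do rewrite Rintegral_cst// mul0r; exact: cvg_cst.
  (* As A 0 = 0, a nonzero weight forces some component of [g] to be nonzero at [x], and the cover
     has a test function that is nonzero at [x]. *)
  - move=> x Ox ax; have [q qx] := phic x Ox.
    have [i gi] : exists i, g x 0 i != 0.
      apply/not_existsP => g0; move: ax; rewrite /= /a euclidean_norm0P.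
        by rewrite mul0r (young0 YA) eqxx.
      by move=> i; apply/eqP; apply: contra_notT (g0 i).
    exists (pickle (q, i)); rewrite /w_ pickleK mulf_neq0//.
exists (4 * M * l1 + 8 * M * l2); first by rewrite addr_gt0// !mulr_gt0.
pose b k := (orlicz_modular A Omega (fun x => euclidean_norm (g_ k x - g x)) l1 +
  ((2 * M)^-1 * \int[mu]_(x in Omega) (`|d_ k x| * fine (a x)))%:E)%E.
have M20 : 0 < 2 * M by rewrite mulr_gt0.
have cb : b k @[k --> \oo] --> 0%E.
  rewrite /b -[X in _ --> X](adde0 0%E); apply: cvgeD => //.
  apply: cvg_EFin; first exact: nearW.
  by have C := cvgM (cvg_cst (2 * M)^-1) cda; rewrite mulr0 in C; exact: C.
apply: squeeze_cvge cb; last exact: cvg_cst.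
apply: nearW => k; apply/andP; split.
  apply: orlicz_modular_ge0 => //; first by rewrite addr_gt0// !mulr_gt0.
  by move=> x _; exact: euclidean_norm_ge0.
have l0 : 0 < 4 * M * l1 + 8 * M * l2 by rewrite addr_gt0// !mulr_gt0.
have mdg i : measurable_fun Omega (fun x => (h (u_ k x) *: g_ k x - h (u x) *: g x) 0 i).
  by under eq_fun do rewrite !mxE; apply: measurable_funB; exact: measurable_funM.
apply: (@le_trans _ _ (\int[mu]_(x in Omega) (A (euclidean_norm (g_ k x - g x) / l1) +
    (`|d_ k x| / (2 * M))%:E * a x))%E).
  apply: ge0_le_integral => //.
  - by move=> x _; apply: (young_ge0 YA); rewrite divr_ge0 ?euclidean_norm_ge0// ltW.
  - apply: (@measurable_young_scaled _ _ _ _ YA mO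
      (fun x => euclidean_norm (h (u_ k x) *: g_ k x - h (u x) *: g x))) => //.
      exact: measurable_euclidean_norm.
    by move=> x _; exact: euclidean_norm_ge0.
  - apply: emeasurable_funD.
      apply: (@measurable_young_scaled _ _ _ _ YA mO
        (fun x => euclidean_norm (g_ k x - g x))) => //.
      by move=> x _; exact: euclidean_norm_ge0.
    apply: emeasurable_funM => //; apply/measurable_EFinP.
    by apply: measurable_funM => //; exact: measurableT_comp.
  - by move=> x _; exact: young_scale_diff.
rewrite ge0_integralD//; first last.
- apply: emeasurable_funM => //; apply/measurable_EFinP.
  by apply: measurable_funM => //; exact: measurableT_comp.
- by move=> x _; rewrite mule_ge0// lee_fin divr_ge0// ltW.
- apply: (@measurable_young_scaled _ _ _ _ YA mO
    (fun x => euclidean_norm (g_ k x - g x))) => //.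
  by move=> x _; exact: euclidean_norm_ge0.
- by move=> x _; apply: (young_ge0 YA); rewrite divr_ge0 ?euclidean_norm_ge0// ltW.
rewrite leeD2l//.
have ida : mu.-integrable Omega (EFin \o (fun x => `|d_ k x| * fine (a x))).
  apply: (intgMb mO (M := 2 * M)) => //; first exact: measurableT_comp.
  by move=> x _; rewrite normr_id.
rewrite -RintegralZl// (EFin_Rintegral mO); last exact: intgZ.
rewrite le_eqVlt; apply/orP; left; apply/eqP; apply: ae_eq_integral => //.
- apply: emeasurable_funM => //; apply/measurable_EFinP.
  by apply: measurable_funM => //; exact: measurableT_comp.
- by have /measurable_int := intgZ mO (2 * M)^-1 ida.
have := integrable_ae mO ia; apply: filterS => x ax Ox.
by rewrite -(fineK (ax Ox)) -EFinM mulrCA mulrA.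
Qed.

End superposition_gradient.

Theorem theorem3p1 (R : realType) (n : nat) (Omega : set 'rV[R]_n)
    (A : R -> \bar R) (f : R -> R) :
  (2 <= n)%N -> open Omega -> young_function A -> young_nondegenerate A ->
  lipschitz f -> (lebesgue_rV n Omega = +oo%E -> f 0 = 0) ->
  (forall u, orlicz_sobolev A Omega u -> orlicz_sobolev A Omega (f \o u)) /\
  (forall (u_ : nat -> 'rV[R]_n -> R) (u : 'rV[R]_n -> R),
    (forall k, orlicz_sobolev A Omega (u_ k)) -> orlicz_sobolev A Omega u ->
    modular_cvg_sobolev A Omega u_ u ->
    modular_cvg_sobolev A Omega (fun k => f \o u_ k) (f \o u)).
Proof.
move=> _ oO YA NA /lipschitz_bound[L L0 hf] f0.
have mO : measurable Omega by exact: rV_open_measurable.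
have [h [mh [M hM] fE]] := lipschitz_primitive L0 hf.
have M0 : 0 <= M by exact: le_trans (hM 0).
(* [M] may be 0, whereas the bound enters the scales of modulars as a positive factor. *)
have {}hM s : `|h s| <= M + 1 by rewrite (le_trans (hM s))// lerDl.
have {}M0 : 0 < M + 1 by rewrite ltr_wpDl.
have wgf u g : weak_gradient Omega u g -> weak_gradient Omega (f \o u) (fun x => h (u x) *: g x).
  move=> wg; rewrite (_ : f \o u = fun x => f 0 + prim h (u x)).
    exact: weak_gradient_chain oO mh hM wg.
  by apply/funext => x; exact: fE.
have mhu u g : weak_gradient Omega u g -> measurable_fun Omega (fun x => h (u x)).
  by move=> [[mu_ _] _ _]; exact: measurableT_comp mh mu_.
split.
  move=> u [ou [g wg og]]; split; first exact: (orlicz_lipschitz YA oO L0 hf f0 ou).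
  exists (fun x => h (u x) *: g x); first exact: wgf.
  exact: (orlicz_vec_scale YA oO M0 (mhu _ _ wg) (fun x => hM (u x)) og).
move=> u_ u ou_ ou [cu [g_ [g [wg_ wg cg]]]].
(* The convergence comes with one gradient [g], membership of [u] with another gradient [g'] of
   finite modular. Their equality almost everywhere transfers the finite modular to [g]. *)
have [[mu_ _] [g' wg' [mg' [l l0 gl]]]] := ou.
split.
  apply: (modular_cvg_lipschitz YA oO L0 hf) cu => // k.
  by have [[]] := ou_ k.
exists (fun k x => h (u_ k x) *: g_ k x), (fun x => h (u x) *: g x).
split; [by move=> k; exact: wgf|exact: wgf|].
apply: (modular_cvg_chain YA NA oO wg_ wg cu cg l0 _ mh M0 hM).
have mN v w : weak_gradient Omega v w -> measurable_fun Omega (fun x => euclidean_norm (w x)).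
  by move=> [_ lw _]; apply: measurable_euclidean_norm => i; have [] := lw i.
have mA v w : weak_gradient Omega v w ->
    measurable_fun Omega (fun x => A (euclidean_norm (w x) / l)).
  move=> wv; apply: (@measurable_young_scaled _ _ _ _ YA mO
    (fun x => euclidean_norm (w x))) => //; first exact: mN wv.
  by move=> x _; exact: euclidean_norm_ge0.
rewrite /orlicz_modular (ae_eq_integral (fun x => A (euclidean_norm (g' x) / l))) //.
- exact: mA wg.
- exact: mA wg'.
have := weak_gradient_unique oO wg wg'; apply: filterS => x gg Ox.
by rewrite gg.
Qed.
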